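(* Assume $-m<\delta_{\min}\le\delta_{\max}$ are known and $\delta_0,\delta_1\in(\delta_{\min},\delta_{\max})$. Let $\alpha\in(0,1)$, let $Q(G_n)=N_m(n)-n\,p_m(\hat\delta_n)$, and define the test $$\phi_{\rm cal}(G_n)=\mathbf 1\left\{|Q(G_n)|\ge\sqrt{n\,(w(\hat\delta_n,m)+u(\hat\delta_n,m))}\;z_{\alpha/2}\right\}.$$ As $n\to\infty$, the type-I error of this test converges to $\alpha$: $\mathbb P_0(\phi_{\rm cal}(G_n)\ne0)\to\alpha$. Furthermore, when $\delta_0\ne\delta_1$ and $\tfrac12<\gamma<1$, the type-II error vanishes: $\mathbb P_1(\phi_{\rm cal}(G_n)=0)\to0$ as $n\to\infty$.
   Context: Model. Fix an integer $m\ge1$ and a function $\delta:\mathbb N\to(-m,\infty)$. A random sequence of undirected loopless graphs $(G_t)_{t\ge1}$ (multiple edges allowed, degrees counted with multiplicity) is built as follows. $G_1$ has vertices $v_0,v_1$ joined by $m$ edges. For $t\ge2$, $G_{t,0}$ is $G_{t-1}$ plus an isolated vertex $v_t$; for $i=1,\dots,m$, given $G_{t,i-1}$, a vertex $v_{t,i}\in\{v_0,\dots,v_{t-1}\}$ is sampled with $\mathbb P(v_{t,i}=v\mid G_{t,i-1})=\frac{D_v(G_{t,i-1})+\delta(t)}{\sum_{j=0}^{t-1}(D_{v_j}(G_{t,i-1})+\delta(t))}$, where $D_v(G)$ is the degree of $v$ in $G$, and $G_{t,i}$ is $G_{t,i-1}$ plus the edge $\{v_{t,i},v_t\}$; finally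 $G_t=G_{t,m}$. Vertices are identified with $[n]=\{0,1,\dots,n\}$, $D_v(t)=D_v(G_t)$, $N_k(t)=\#\{v\in[t]:D_v(t)=k\}$, and $N_{>k}(t)=\sum_{j>k}N_j(t)$. Null model ($\mathbb P_0,\mathbb E_0$): $\delta(t)=\delta_0$ for all $t$. Alternative model ($\mathbb P_1,\mathbb E_1$): $\delta(t)=\delta_0$ for $t\le\tau_n$ and $\delta(t)=\delta_1$ for $t>\tau_n$, with $\delta_0,\delta_1>-m$ and $\tau_n=n-cn^\gamma$ (rounded down to an integer), $c>0$, $\gamma\in(0,1)$. The constants $m,\delta_0,\delta_1,c,\gamma$ are fixed as $n\to\infty$. For $\delta>-m$ and $k\ge m$, $$p_k(\delta)=(2+\delta/m)\frac{\Gamma(k+\delta)\,\Gamma(m+2+\delta+\delta/m)}{\Gamma(m+\delta)\,\Gamma(k+3+\delta+\delta/m)},\qquad\text{so } p_m(\delta)=\frac{2+\delta/m}{m+\delta+2+\delta/m}.$$ $$w(\delta,m)=\frac{m^2(m+\delta)(1+m+\delta)(2m+\delta)}{(\delta+2m(1+m+\delta))(\delta+m(2+m+\delta))^2},$$ $$v(\delta,m)=\sum_{k=m}^\infty\frac{m\,p_k(\delta)}{(k+\delta)(2m+\delta)}-\frac{m}{(2m+\delta)^2},\qquad u(\delta,m)=-\frac{m^4}{v(\delta,m)\,(\delta+m(2+m+\delta))^4}.$$ The estimator is $\hat\delta_n=\arg\max_{\delta\in[\delta_{\min},\delta_{\max}]}\iota_n(\delta)$, where, with $S_{t,i-1}(\delta)=t\delta+2m(t-1)+(i-1)$,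 $$\iota_n(\delta)=\frac1{n+1}\sum_{k=m}^\infty\log(k+\delta)\,N_{>k}(n)-\frac1{n+1}\sum_{t=2}^n\sum_{i=1}^m\log S_{t,i-1}(\delta).$$ Equivalently, for large $n$ (with high probability) $\hat\delta_n$ is the solution of $\iota_n'(\delta)=0$ in $[\delta_{\min},\delta_{\max}]$. For $\alpha\in(0,1)$, $z_\alpha$ is the unique solution of $\alpha=\int_{z_\alpha}^\infty\frac1{\sqrt{2\pi}}e^{-z^2/2}\,dz$. *)

(* Defs.v *)
From HB Require Import structures.
From mathcomp Require Import all_boot all_order all_algebra.
From mathcomp Require Import all_classical all_reals all_analysis.

Set Implicit Arguments.
Unset Strict Implicit.
Unset Printing Implicit Defensive.

Import Order.TTheory GRing.Theory Num.Theory.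
Import numFieldNormedType.Exports.

Local Open Scope classical_set_scope.
Local Open Scope ring_scope.

(* A multigraph is the list of its edges, a repeated entry being a multiple   *)
(* edge.  The vertex set {0, ..., t} of G_t is not stored: it is supplied by  *)
(* the index t, so adding the isolated vertex v_t leaves the list unchanged.  *)
Definition mgraph := seq (nat * nat).

(* All the graphs considered are loopless, so the two counts never see the    *)
(* same edge.                                                                 *)
Definition deg (g : mgraph) (v : nat) : nat :=
  (count (fun e => e.1 == v) g + count (fun e => e.2 == v) g)%N.

(* Finitely supported law on multigraphs: a list of (weight, outcome) pairs,  *)
(* the mass of an outcome being the sum of the weights attached to it.        *)
Definition law (R : realType) := seq (R * mgraph).

Definition Pr (R : realType) (L : law R) (A : pred mgraph) : R :=
  \sum_(x <- L | A x.2) x.1.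

Section Model.
Variable R : realType.

(* P(v_{t,i} = v | G_{t,i-1} = g), for v < t, when delta(t) = d.              *)
Definition attach_prob (d : R) (t : nat) (g : mgraph) (v : nat) : R :=
  ((deg g v)%:R + d) / \sum_(0 <= j < t) ((deg g j)%:R + d).

(* The law of G_{t,i}, where L is the law of G_{t-1}.                         *)
Fixpoint law_step (d : R) (t : nat) (L : law R) (i : nat) : law R :=
  if i is i'.+1 then
    [seq (x.1 * attach_prob d t x.2 v, (v, t) :: x.2)
       | x <- law_step d t L i', v <- iota 0 t]
  else L.

(* The law of G_t; the process starts at t = 1, the value at t = 0 is a       *)
(* placeholder.                                                               *)
Fixpoint pa_law (m : nat) (delta : nat -> R) (t : nat) : law R :=
  match t with
  | 0 => [:: (1, [::])]
  | 1 => [:: (1, nseq m (0%N, 1%N))]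
  | (_.+1 as t').+1 => law_step (delta t'.+1) t'.+1 (pa_law m delta t') m
  end.

Lemma deg_cons e (g : mgraph) v :
  deg (e :: g) v = ((e.1 == v) + (e.2 == v) + deg g v)%N.
Proof. by rewrite /deg /= addnACA. Qed.

Lemma law_step_deg (d : R) m t L i :
    (forall x, x \in L -> forall j, (j < t)%N -> (m <= deg x.2 j)%N) ->
  forall x, x \in law_step d t L i ->
    (forall j, (j < t)%N -> (m <= deg x.2 j)%N) /\ (i <= deg x.2 t)%N.
Proof.
move=> hL; elim: i => [|i IH] x /=; first by move=> /hL.
move=> /allpairsP[[y v] /= [/IH[h1 h2] _ ->]]; split => [j jt|] /=.
  by rewrite deg_cons (leq_trans (h1 j jt)) ?leq_addl.
by rewrite deg_cons /= eqxx addnAC addn1 ltnS (leq_trans h2) ?leq_addl.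
Qed.

Lemma pa_law_deg m (delta : nat -> R) t x : (0 < t)%N ->
  x \in pa_law m delta t -> forall j, (j <= t)%N -> (m <= deg x.2 j)%N.
Proof.
elim: t x => [//|[|t] IH] x _.
  rewrite inE => /eqP -> [|[|]] //= _; rewrite /deg /=.
    by rewrite count_nseq /= mul1n leq_addr.
  by rewrite !count_nseq /= mul1n leq_addl.
have hL y : y \in pa_law m delta t.+1 ->
    forall j, (j < t.+2)%N -> (m <= deg y.2 j)%N.
  by move=> /(IH _ isT) h j; rewrite ltnS; exact: h.
move=> /(law_step_deg hL)[h1 h2] j; rewrite leq_eqVlt => /predU1P[-> //|].
exact: h1.
Qed.

Lemma attach_prob_ge0 m (d : R) t g v : - m%:R < d -> (v < t)%N ->
  (forall j, (j < t)%N -> (m <= deg g j)%N) -> 0 <= attach_prob d t g v.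
Proof.
move=> hd vt hg.
have h j : (j < t)%N -> 0 <= (deg g j)%:R + d.
  move=> /hg; rewrite -(ler_nat R) => h; rewrite -(subrK m%:R (_%:R)) -addrA.
  by rewrite addr_ge0 ?subr_ge0// -lerBlDl sub0r ltW.
rewrite divr_ge0 ?h// big_nat sumr_ge0// => j /andP[_]; exact: h.
Qed.

Lemma sum_attach_prob m (d : R) t g : - m%:R < d -> (0 < t)%N ->
  (forall j, (j < t)%N -> (m <= deg g j)%N) ->
  \sum_(0 <= v < t) attach_prob d t g v = 1.
Proof.
move=> hd t0 hg; rewrite /attach_prob -mulr_suml divff// gt_eqF//.
have h j : (j < t)%N -> 0 < (deg g j)%:R + d.
  move=> /hg; rewrite -(ler_nat R) => h; rewrite -(subrK m%:R (_%:R)) -addrA.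
  by rewrite ltr_wpDl ?subr_ge0// -ltrBlDl sub0r.
case: t t0 {hg} h => // t _ h; rewrite big_nat_recl//= ltr_wpDr ?h//.
by rewrite big_nat sumr_ge0// => j /andP[_ jt]; rewrite ltW ?h.
Qed.

(* pa_law is a probability law: nonnegative weights, total mass 1.            *)
Lemma pa_law_ge0 m (delta : nat -> R) t x :
  (forall s, - m%:R < delta s) -> x \in pa_law m delta t -> 0 <= x.1.
Proof.
move=> hd; elim: t x => [|[|t] IH] x; [by rewrite inE => /eqP ->..|].
have hL y : y \in pa_law m delta t.+1 ->
    forall j, (j < t.+2)%N -> (m <= deg y.2 j)%N.
  by move=> hy j; rewrite ltnS; exact: (@pa_law_deg m delta t.+1).
rewrite [pa_law _ _ _]/=; set L := pa_law m delta t.+1 in IH hL *.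
suff h i z : z \in law_step (delta t.+2) t.+2 L i -> 0 <= z.1 by exact: h.
elim: i z => [|i IHi] z; first exact: IH.
move=> /allpairsP[[y v] /= [hy hv ->]].
have vt : (v < t.+2)%N by move: hv; rewrite (mem_iota 0 t.+2).
rewrite mulr_ge0 ?(IHi _ hy)// (attach_prob_ge0 (hd _) vt)//.
by have [] := law_step_deg hL hy.
Qed.

Lemma Pr_pa_lawT m (delta : nat -> R) t :
  (forall s, - m%:R < delta s) -> Pr (pa_law m delta t) predT = 1.
Proof.
move=> hd; elim: t => [|[|t] IH]; [by rewrite /Pr big_seq1..|].
have hL y : y \in pa_law m delta t.+1 ->
    forall j, (j < t.+2)%N -> (m <= deg y.2 j)%N.
  by move=> hy j; rewrite ltnS; exact: (@pa_law_deg m delta t.+1).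
rewrite [pa_law _ _ _]/=; set L := pa_law m delta t.+1 in IH hL *.
suff h i : Pr (law_step (delta t.+2) t.+2 L i) predT = 1 by exact: h.
elim: i => [|i IHi]; first exact: IH.
rewrite /Pr big_allpairs_dep /= -[RHS]IHi /Pr big_seq [RHS]big_seq.
apply: eq_bigr => y hy; have [hyd _] := law_step_deg hL hy.
by rewrite -[RHS]mulr1 -(sum_attach_prob (hd t.+2) (ltn0Sn t.+1) hyd) mulr_sumr.
Qed.

(* The time tau_n may be negative for small n, hence the comparison in int.   *)
Definition tau (c gam : R) (n : nat) : int :=
  Num.floor (n%:R - c * n%:R `^ gam).

Definition delta_null (d0 : R) (t : nat) : R := d0.

Definition delta_alt (d0 d1 c gam : R) (n t : nat) : R :=
  if (t%:Z <= tau c gam n)%R then d0 else d1.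

(* N_k(n) and N_{>k}(n) for a graph on the vertex set {0, ..., n}.            *)
Definition Ncount (n : nat) (g : mgraph) (k : nat) : nat :=
  #|[set v : 'I_n.+1 | deg g v == k]%SET|.

Definition Ngt (n : nat) (g : mgraph) (k : nat) : R :=
  limn (fun K => \sum_(k.+1 <= j < K) (Ncount n g j)%:R : R).

Definition Gamma (x : R) : R :=
  \int[lebesgue_measure]_(s in `]0, +oo[) (s `^ (x - 1) * expR (- s)).

Definition pk (m k : nat) (d : R) : R :=
  (2 + d / m%:R) *
  (Gamma (k%:R + d) * Gamma (m%:R + 2 + d + d / m%:R)) /
  (Gamma (m%:R + d) * Gamma (k%:R + 3 + d + d / m%:R)).

Definition w_coef (m : nat) (d : R) : R :=
  m%:R ^+ 2 * (m%:R + d) * (1 + m%:R + d) * (2 * m%:R + d) /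
  ((d + 2 * m%:R * (1 + m%:R + d)) * (d + m%:R * (2 + m%:R + d)) ^+ 2).

Definition v_coef (m : nat) (d : R) : R :=
  limn (fun K => \sum_(m <= k < K)
                   (m%:R * pk m k d / ((k%:R + d) * (2 * m%:R + d))) : R)
  - m%:R / (2 * m%:R + d) ^+ 2.

Definition u_coef (m : nat) (d : R) : R :=
  - (m%:R ^+ 4 / (v_coef m d * (d + m%:R * (2 + m%:R + d)) ^+ 4)).

(* S_{t,i-1}(d), for i >= 1.                                                  *)
Definition Snorm (m t i : nat) (d : R) : R :=
  t%:R * d + 2 * m%:R * (t%:R - 1) + (i%:R - 1).

Definition iota_n (m n : nat) (g : mgraph) (d : R) : R :=
  n.+1%:R^-1 *
    limn (fun K => \sum_(m <= k < K) (ln (k%:R + d) * Ngt n g k) : R)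
  - n.+1%:R^-1 * (\sum_(2 <= t < n.+1) \sum_(1 <= i < m.+1)
                     ln (Snorm m t i d)).

Definition is_argmax (a b : R) (f : R -> R) (d : R) : Prop :=
  a <= d <= b /\ forall d', a <= d' <= b -> f d' <= f d.

(* The maximiser of iota_n need not be unique for every graph: an estimator   *)
(* is any choice of a maximiser.                                              *)
Definition is_estimator (m : nat) (dmin dmax : R)
    (dhat : nat -> mgraph -> R) : Prop :=
  forall n g, is_argmax dmin dmax (iota_n m n g) (dhat n g).

Definition is_normal_quantile (a z : R) : Prop :=
  a = \int[lebesgue_measure]_(x in `[z, +oo[)
        ((Num.sqrt (2 * pi))^-1 * expR (- x ^+ 2 / 2)).

Definition Qstat (m n : nat) (g : mgraph) (d : R) : R :=
  (Ncount n g m)%:R - n%:R * pk m m d.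

Definition phi_cal (m : nat) (dhat : nat -> mgraph -> R) (z : R) (n : nat)
    (g : mgraph) : nat :=
  let d := dhat n g in
  if Num.sqrt (n%:R * (w_coef m d + u_coef m d)) * z <= `|Qstat m n g d|
  then 1 else 0.

End Model.

(* Main.v *)
Require Import Defs.
From HB Require Import structures.
From mathcomp Require Import all_boot all_order all_algebra.
From mathcomp Require Import all_classical all_reals all_analysis.
From mathcomp Require Import measurable_realfun.
From mathcomp Require Import ring lra zify.

Set Implicit Arguments.
Unset Strict Implicit.
Unset Printing Implicit Defensive.

Import Order.TTheory GRing.Theory Num.Theory.
Import numFieldNormedType.Exports.

Local Open Scope classical_set_scope.
Local Open Scope ring_scope.

(** Edges are added one at a time, so the graph after [k] edges is a Markov chain
    and every statistic below is a sum of one-step terms along the path.  Two of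
    them drive the result: the number of vertices of degree [m], recentred to [Z],
    which satisfies [Z' = (1 - O(1/k)) Z + (martingale increment)], and the score
    [M], the martingale with increments [1 / (D + delta)] centred.  A Lindeberg
    argument along the heat equation shows that every combination
    [(x Z + y M) / sqrt k] is asymptotically normal.  The derivative of the
    likelihood at [d] is [M - (d - delta0) (R + T) + S], where [R / k] tends to a
    positive constant [Vyy], [T] is negligible uniformly in [d] and [S] only sees
    the edges added after the change.  This gives the consistency of the estimator
    and its linearisation [delta_hat - delta0 ~ (M + S) / (k Vyy)].  Under the null
    [S = 0], and inserting the linearisation into [Q] yields [(Z + kappa M)], whose
    limit variance is [w + u].  Under the alternative with [J ~ c m n^gamma] late
    edges, both [Z] and [S] are shifted by non-cancelling multiples of [J], and [J]
    dominates [sqrt n] because [gamma > 1/2]. *)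

(** * The edge-by-edge chain *)

(** Two difficulties shape the argument. The estimator looks at the whole graph, so nothing
    evaluated at it is a martingale, and every bound on the score has to hold for all [d] at once.
    For the conditional means this comes from writing [rho] as a weighted variance of the degrees,
    comparable with its value at [delta0]; for the martingale remainder it comes from the weights
    [1 / (r + dmin)^2], summable over the degrees [r]. Moreover [Z] has a long memory: it forgets an
    increment only at rate [wrate / k], so increments enter the limit with weights [wprod], of limit
    mean [1 / (1 + wrate)] and limit mean square [1 / (1 + 2 wrate)]. The coefficient [kappa] is the
    value of [y] minimising the limit variance of [(Z + y M) / sqrt k]: estimating [delta0] removes
    from [Z] its component along the score, which is why [u] is negative, namely [- m kappa^2 Vyy].
    The factor [m] in [w + u = m * sig2] converts vertices into edges, as [G_n] has [m (n - 1)]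
    edges beyond those of [G_1]. *)

Section Process.
Variables (R : realType) (m : nat).
Hypothesis hm : (0 < m)%N.
Implicit Types (g : mgraph) (k t r v : nat) (dl : nat -> R) (d : R).

(* The edge added after [k] others (on top of [G_1]) comes from vertex [tt k]; its
   other end is one of the [tt k] vertices with a smaller number. *)
Definition tt k : nat := (k %/ m).+2.
Arguments tt : simpl never.

Definition dsum (f : nat -> R) t g : R := \sum_(0 <= v < t) f (deg g v).

Definition Ex (L : law R) (f : mgraph -> R) : R := \sum_(x <- L) x.1 * f x.2.

Fixpoint flaw dl k : law R :=
  if k is k'.+1 then law_step (dl (tt k')) (tt k') (flaw dl k') 1
  else [:: (1, nseq m (0%N, 1%N))].

Definition cond dl k g (phi : nat -> R) : R :=
  \sum_(0 <= v < tt k) attach_prob (dl (tt k)) (tt k) g v * phi v.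

(** Contains the support of [flaw dl k] for every [dl]: structural facts are proved once along
    [reach] and then hold under any parameter. *)
Fixpoint reach k g : Prop :=
  if k is k'.+1 then
    exists g' v, [/\ reach k' g', (v < tt k')%N & g = (v, tt k') :: g']
  else g = nseq m (0%N, 1%N).

(** The normalisation of the attachment probabilities at step [k]: the [tt k] older vertices have
    total degree [m * tt k + k], the [k %% m] edge ends already at the new vertex being left out. *)
Definition Stot k d : R := (tt k)%:R * (m%:R + d) + k%:R.

Lemma ttS k : tt k.+1 = (tt k + (m %| k.+1))%N.
Proof. by rewrite /tt divnS// addnC. Qed.

Lemma tt_mulD n i : (i < m)%N -> tt (m * n + i) = n.+2.
Proof. by move=> im; rewrite /tt mulnC divnMDl// divn_small// addn0. Qed.

Lemma tt_bounds k : (k%:R <= m%:R * ((tt k)%:R - 1) :> R) /\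
  (m%:R * ((tt k)%:R - 2) <= k%:R :> R).
Proof.
have h := divn_eq k m; have hk := ltn_pmod k hm.
split.
  have : (k <= m * (k %/ m).+1)%N by rewrite mulnS {1}h mulnC addnC leq_add// ltnW.
  by rewrite -(ler_nat R) natrM /tt -[(k %/ m).+2%:R]natr1 addrK.
have : (m * (k %/ m) <= k)%N by rewrite {2}h mulnC leq_addr.
rewrite -(ler_nat R) natrM /tt; congr (_ * _ <= _).
by rewrite -natr1 -natr1; ring.
Qed.

Lemma ExD L f1 f2 : Ex L (fun g => f1 g + f2 g) = Ex L f1 + Ex L f2.
Proof. by rewrite /Ex -big_split/=; apply: eq_bigr => x _; rewrite mulrDr. Qed.

Lemma ExZ L c f : Ex L (fun g => c * f g) = c * Ex L f.
Proof. by rewrite /Ex mulr_sumr; apply: eq_bigr => x _; rewrite mulrCA. Qed.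

Lemma ExN L f : Ex L (fun g => - f g) = - Ex L f.
Proof. by rewrite /Ex -sumrN; apply: eq_bigr => x _; rewrite mulrN. Qed.

Lemma ExB L f1 f2 : Ex L (fun g => f1 g - f2 g) = Ex L f1 - Ex L f2.
Proof. by rewrite ExD ExN. Qed.

Lemma Ex_sum L (I : Type) (s : seq I) (P : pred I) (F : I -> mgraph -> R) :
  Ex L (fun g => \sum_(i <- s | P i) F i g) = \sum_(i <- s | P i) Ex L (F i).
Proof.
by rewrite /Ex exchange_big/=; apply: eq_bigr => x _; rewrite mulr_sumr.
Qed.

Lemma PrE L (A : pred mgraph) : Pr L A = Ex L (fun g => (A g)%:R).
Proof.
rewrite /Pr /Ex big_mkcond/=; apply: eq_bigr => x _.
by case: (A x.2); rewrite ?mulr1 ?mulr0.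
Qed.

(** The vertex [tt k] is constant along a batch of [m] edges, so the nested recursion over times and
    edges flattens into one recursion over edges. *)
Lemma pa_lawE dl n : pa_law m dl n.+1 = flaw dl (m * n).
Proof.
elim: n => [|n IH]; first by rewrite muln0.
have h i : (i <= m)%N ->
    law_step (dl n.+2) n.+2 (pa_law m dl n.+1) i = flaw dl (m * n + i).
  elim: i => [|i IHi] im; first by rewrite addn0.
  rewrite addnS.
  rewrite -[RHS]/(law_step (dl (tt (m * n + i))) (tt (m * n + i)) (flaw dl (m * n + i)) 1).
  by rewrite (tt_mulD _ im) -IHi ?(ltnW im).
by rewrite [LHS]/= h// mulnS addnC.
Qed.

Lemma Ex_flawS dl k f : Ex (flaw dl k.+1) f =
  Ex (flaw dl k) (fun g => cond dl k g (fun v => f ((v, tt k) :: g))).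
Proof.
rewrite /Ex big_allpairs_dep /=; apply: eq_bigr => x _.
rewrite /cond mulr_sumr /index_iota subn0.
by apply: eq_bigr => v _; rewrite mulrA.
Qed.

Lemma reach_flaw dl k x : x \in flaw dl k -> reach k x.2.
Proof.
elim: k x => [|k IH] x; first by rewrite inE => /eqP ->.
move=> /allpairsP[[y v] /= [hy hv ->]]; exists y.2, v; split => //=.
  exact: IH.
have : v \in iota 0 (tt k) by exact: hv.
by rewrite mem_iota.
Qed.

(** The four facts sustain each other in the induction: the degree [k %% m] of the current vertex
    reaches [m] exactly when its batch is complete and it joins the older vertices. *)
Lemma reach_inv k g : reach k g ->
  [/\ size g = (k + m)%N, (forall v, (v < tt k)%N -> (m <= deg g v)%N),
      deg g (tt k) = (k %% m)%N & forall v, (tt k < v)%N -> deg g v = 0%N].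
Proof.
elim: k g => [|k IH] g /=.
  move=> ->; rewrite /tt div0n mod0n; split.
  - by rewrite size_nseq.
  - by move=> [|[|]] //= _; rewrite /deg !count_nseq /= mul1n ?leq_addl ?leq_addr.
  - by rewrite /deg !count_nseq.
  - by move=> [|[|v]] //= _; rewrite /deg !count_nseq /=.
move=> [g' [v [hg vt ->]]]; have [h1 h2 h3 h4] := IH _ hg.
have hD u : deg ((v, tt k) :: g') u = ((v == u) + (tt k == u) + deg g' u)%N.
  exact: deg_cons.
have hlt u : (u < tt k)%N -> (m <= deg ((v, tt k) :: g') u)%N.
  by move=> ut; rewrite hD (leq_trans (h2 _ ut))// leq_addl.
have h5 : deg ((v, tt k) :: g') (tt k) = (k %% m).+1.
  by rewrite hD eqxx h3 (ltn_eqF vt).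
have h6 u : (tt k < u)%N -> deg ((v, tt k) :: g') u = 0%N.
  by move=> tu; rewrite hD h4// (ltn_eqF tu) (ltn_eqF (ltn_trans vt tu)).
rewrite ttS /= h1; split => //.
- move=> u; case hd: (m %| k.+1)%N; last by rewrite addn0; exact: hlt.
  rewrite addn1 ltnS leq_eqVlt => /predU1P[->|]; last exact: hlt.
  rewrite h5; have := modnS k m; rewrite hd => h7.
  have e2 := divn_eq k.+1 m; have e1 := divn_eq k m.
  by rewrite h7 addn0 divnS// hd add1n mulSn in e2; lia.
- rewrite modnS; case hd: (m %| k.+1)%N; last by rewrite addn0.
  by rewrite addn1 h6.
- move=> u; case hd: (m %| k.+1)%N; last by rewrite addn0; exact: h6.
  by rewrite addn1 => hu; rewrite h6// ltnW.
Qed.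

Lemma reach_deg k g v : reach k g -> (v < tt k)%N -> (m <= deg g v)%N.
Proof. by move=> /reach_inv[_ h _ _]; exact: h. Qed.

(** The receiving vertex moves up by one degree; the last term is the vertex [tt k] itself, which
    enters the sum with degree [m] once its batch is complete. *)
Lemma dsum_step (f : nat -> R) k g v : reach k g -> (v < tt k)%N ->
  dsum f (tt k.+1) ((v, tt k) :: g) =
  dsum f (tt k) g - f (deg g v) + f (deg g v).+1 + (m %| k.+1)%:R * f m.
Proof.
move=> hg vt.
have h0 : dsum f (tt k) ((v, tt k) :: g) =
    dsum f (tt k) g - f (deg g v) + f (deg g v).+1.
  rewrite /dsum (bigD1_seq v) ?iota_uniq ?mem_index_iota//=.
  rewrite [in RHS](bigD1_seq v) ?iota_uniq ?mem_index_iota//=.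
  rewrite deg_cons /= eqxx (gtn_eqF vt) addn0 add1n.
  rewrite [X in _ = X + _]addrAC subrr add0r addrC; congr (_ + _).
  rewrite big_seq_cond [RHS]big_seq_cond; apply: eq_bigr => u.
  rewrite mem_index_iota => /andP[/andP[_ ut] uv].
  by rewrite deg_cons /= eq_sym (negbTE uv) (gtn_eqF ut).
rewrite ttS; case hd: (m %| k.+1)%N; last by rewrite addn0 mul0r addr0.
rewrite addn1 mul1r /dsum big_nat_recr//= -h0; congr (_ + f _).
have hg1 : reach k.+1 ((v, tt k) :: g) by exists g, v.
apply/eqP; rewrite eqn_leq; apply/andP; split; last first.
  by apply: (reach_deg hg1); rewrite ttS hd addn1.
have [_ _ h3 _] := reach_inv hg.
rewrite deg_cons /= (ltn_eqF vt) eqxx h3 add0n add1n; exact: ltn_pmod.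
Qed.

Lemma dsum0 f : dsum f (tt 0) (nseq m (0%N, 1%N)) = 2 * f m.
Proof.
rewrite /dsum /tt div0n big_nat_recr//= big_nat1 /deg !count_nseq /=.
by rewrite !mul1n !mul0n addn0 add0n mulr2n mulrDl mul1r.
Qed.

Lemma eq_dsum (f1 f2 : nat -> R) k g : reach k g ->
  (forall r, (m <= r)%N -> f1 r = f2 r) -> dsum f1 (tt k) g = dsum f2 (tt k) g.
Proof.
move=> hg h; rewrite /dsum big_nat [RHS]big_nat; apply: eq_bigr => v /andP[_ vt].
by rewrite h// (reach_deg hg).
Qed.

Lemma ler_dsum (f1 f2 : nat -> R) k g : reach k g ->
  (forall r, (m <= r)%N -> f1 r <= f2 r) ->
  dsum f1 (tt k) g <= dsum f2 (tt k) g.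
Proof.
move=> hg h; rewrite /dsum big_nat [leRHS]big_nat; apply: ler_sum => v /andP[_ vt].
by rewrite h// (reach_deg hg).
Qed.

Lemma dsumD f1 f2 t g :
  dsum (fun r => f1 r + f2 r) t g = dsum f1 t g + dsum f2 t g.
Proof. exact: big_split. Qed.

Lemma dsumZ c f t g : dsum (fun r => c * f r) t g = c * dsum f t g.
Proof. by rewrite /dsum mulr_sumr. Qed.

Lemma dsum_cst c t g : dsum (fun=> c) t g = t%:R * c.
Proof. by rewrite /dsum sumr_const_nat subn0 mulr_natl. Qed.

Lemma dsum_deg d k g : reach k g -> dsum (fun r => r%:R + d) (tt k) g = Stot k d.
Proof.
rewrite dsumD dsum_cst /Stot => hg.
suff -> : dsum (fun r => r%:R) (tt k) g = (tt k)%:R * m%:R + k%:R by ring.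
elim: k g hg => [|k IH] g.
  by move=> /= ->; rewrite dsum0 /tt div0n addr0.
move=> [g' [v [hg vt ->]]]; rewrite dsum_step// IH// ttS natrD -!natr1.
by ring.
Qed.

End Process.

Arguments tt : simpl never.

(** * Conditional means and martingale sums along the chain *)

Section Expectation.
Variables (R : realType) (m : nat).
Hypothesis hm : (0 < m)%N.
Implicit Types (g : mgraph) (k t r v : nat) (d : R).

Local Notation tt := (tt m).
Local Notation reach := (reach m).

Lemma natm_gt0 : 0 < m%:R :> R. Proof. by rewrite ltr0n. Qed.

Lemma Stot_gt0 k d : - m%:R < d -> 0 < Stot m k d.
Proof. by move=> hd; rewrite /Stot ltr_wpDr// mulr_gt0// addrC -ltrBlDr sub0r. Qed.

Lemma attachE d k g v : reach k g ->
  attach_prob d (tt k) g v = ((deg g v)%:R + d) / Stot m k d.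
Proof. by move=> hg; rewrite /attach_prob -(dsum_deg hm d hg). Qed.

Section FixedParameter.
Variable dl : nat -> R.
Hypothesis hdl : forall t, - m%:R < dl t.
Local Notation cond := (cond m dl).
Local Notation E k := (Ex (flaw m dl k)).
Local Notation dd k := (dl (tt k)).

Lemma attach_ge0 k g v : reach k g -> (v < tt k)%N ->
  0 <= attach_prob (dd k) (tt k) g v.
Proof.
move=> hg vt; apply: (@attach_prob_ge0 _ m) => // j jt.
exact: (reach_deg hm hg).
Qed.

Lemma condE k g (f : nat -> R) : reach k g ->
  cond k g (fun v => f (deg g v)) =
  dsum (fun r => (r%:R + dd k) * f r) (tt k) g / Stot m k (dd k).
Proof.
move=> hg; rewrite /cond /dsum mulr_suml; apply: eq_bigr => v _.
by rewrite attachE// mulrAC.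
Qed.

Lemma cond_cst k g c : reach k g -> cond k g (fun=> c) = c.
Proof.
move=> hg; rewrite /cond -mulr_suml.
rewrite (@sum_attach_prob _ m) ?mul1r// => j jt; exact: (reach_deg hm hg).
Qed.

Lemma condD k g f1 f2 :
  cond k g (fun v => f1 v + f2 v) = cond k g f1 + cond k g f2.
Proof. by rewrite /cond -big_split/=; apply: eq_bigr => x _; rewrite mulrDr. Qed.

Lemma condZ k g c f : cond k g (fun v => c * f v) = c * cond k g f.
Proof. by rewrite /cond mulr_sumr; apply: eq_bigr => x _; rewrite mulrCA. Qed.

Lemma condN k g f : cond k g (fun v => - f v) = - cond k g f.
Proof. by rewrite /cond -sumrN; apply: eq_bigr => x _; rewrite mulrN. Qed.

Lemma condB k g f1 f2 :
  cond k g (fun v => f1 v - f2 v) = cond k g f1 - cond k g f2.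
Proof. by rewrite condD condN. Qed.

Lemma ler_cond k g f1 f2 : reach k g ->
  (forall v, (v < tt k)%N -> f1 v <= f2 v) -> cond k g f1 <= cond k g f2.
Proof.
move=> hg h; rewrite /cond big_nat [leRHS]big_nat; apply: ler_sum => v /andP[_ vt].
by rewrite ler_wpM2l ?attach_ge0// h.
Qed.

Lemma eq_cond k g f1 f2 : reach k g ->
  (forall v, (v < tt k)%N -> f1 v = f2 v) -> cond k g f1 = cond k g f2.
Proof. by move=> hg h; apply/le_anti/andP; split; apply: ler_cond => // v /h ->. Qed.

Lemma ler_norm_cond k g f : reach k g ->
  `|cond k g f| <= cond k g (fun v => `|f v|).
Proof.
move=> hg; rewrite ler_norml -condN; apply/andP; split; apply: ler_cond => // v _.
  by rewrite lerNl -normrN ler_norm.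
exact: ler_norm.
Qed.

Lemma flaw_ge0 k x : x \in flaw m dl k -> 0 <= x.1.
Proof.
elim: k x => [|k IH] x; first by rewrite inE => /eqP ->.
move=> /allpairsP[[y v] /= [hy hv ->]].
have vt : v \in iota 0 (tt k) by exact: hv.
rewrite mem_iota in vt.
by rewrite /= mulr_ge0// ?IH// attach_ge0//; exact: (reach_flaw hy).
Qed.

Lemma ler_Ex k f1 f2 : (forall g, reach k g -> f1 g <= f2 g) ->
  E k f1 <= E k f2.
Proof.
move=> h; rewrite /Ex big_seq [leRHS]big_seq; apply: ler_sum => x hx.
by rewrite ler_wpM2l ?(flaw_ge0 hx)// h//; exact: (reach_flaw hx).
Qed.

Lemma eq_Ex k f1 f2 : (forall g, reach k g -> f1 g = f2 g) -> E k f1 = E k f2.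
Proof. by move=> h; apply/le_anti/andP; split; apply: ler_Ex => g /h ->. Qed.

Lemma Ex_cst k c : E k (fun=> c) = c.
Proof.
elim: k => [|k IH]; first by rewrite /Ex big_seq1 mul1r.
by rewrite Ex_flawS -[RHS]IH; apply: eq_Ex => g hg; rewrite cond_cst.
Qed.

Lemma Ex0 f : E 0 f = f (nseq m (0%N, 1%N)).
Proof. by rewrite /Ex big_seq1 mul1r. Qed.

Lemma Ex_ge0 k f : (forall g, reach k g -> 0 <= f g) -> 0 <= E k f.
Proof. by move=> h; rewrite -[leLHS](Ex_cst k 0); exact: ler_Ex. Qed.

Lemma Ex_le_cst k f c : (forall g, reach k g -> f g <= c) -> E k f <= c.
Proof. by move=> h; rewrite -[leRHS](Ex_cst k c); exact: ler_Ex. Qed.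

Lemma ler_norm_Ex k f : `|E k f| <= E k (fun g => `|f g|).
Proof.
rewrite ler_norml -ExN; apply/andP; split; apply: ler_Ex => g _.
  by rewrite lerNl -normrN ler_norm.
exact: ler_norm.
Qed.

(** From expanding the nonnegative mean of [(|f| - a)^2], where [a] is the mean of [|f|]. *)
Lemma Ex_norm_sqrt k f c : 0 <= c -> E k (fun g => f g ^+ 2) <= c ->
  E k (fun g => `|f g|) <= Num.sqrt c.
Proof.
move=> c0 hc; set a := E k _.
have a0 : 0 <= a by apply: Ex_ge0.
have : 0 <= E k (fun g => (`|f g| - a) ^+ 2).
  by apply: Ex_ge0 => g _; rewrite sqr_ge0.
rewrite (@eq_Ex _ _ (fun g => f g ^+ 2 + (- 2 * a) * `|f g| + a ^+ 2)); last first.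
  by move=> g _; rewrite -(real_normK (num_real (f g))); ring.
rewrite ExD ExD ExZ Ex_cst -/a => h.
rewrite -(ger0_norm a0) -sqrtr_sqr ler_wsqrtr//; lra.
Qed.

Lemma Pr_le_Ex k (A : pred mgraph) f :
  (forall g, reach k g -> 0 <= f g) ->
  (forall g, reach k g -> A g -> 1 <= f g) ->
  Pr (flaw m dl k) A <= E k f.
Proof.
move=> f0 f1; rewrite PrE; apply: ler_Ex => g hg.
by case: (boolP (A g)) => [/(f1 _ hg)//|_]; exact: f0.
Qed.

Lemma markov k (A : pred mgraph) (f : mgraph -> R) a : 0 < a ->
  (forall g, reach k g -> A g -> a <= `|f g|) ->
  Pr (flaw m dl k) A <= E k (fun g => `|f g|) / a.
Proof.
move=> a0 h; rewrite mulrC -ExZ; apply: Pr_le_Ex => g hg.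
  by rewrite mulr_ge0// invr_ge0 ltW.
by move=> /(h _ hg); rewrite mulrC ler_pdivlMr// mul1r.
Qed.

End FixedParameter.

(* The last edge of a graph is the head of its list, so that a graph determines its
   whole history and path functionals are functions of the graph. *)
Fixpoint psum (phi : nat -> mgraph -> nat -> R) (g : mgraph) : R :=
  if g is e :: g' then
    psum phi g' + (if (m <= size g')%N then phi (size g' - m)%N g' e.1 else 0)
  else 0.

Lemma psum0 phi : psum phi (nseq m (0%N, 1%N)) = 0.
Proof.
suff h i : (i <= m)%N -> psum phi (nseq i (0%N, 1%N)) = 0 by exact: h.
elim: i => [//|i IH] im /=; rewrite IH ?(ltnW im)// add0r size_nseq.
by rewrite leqNgt im.
Qed.

Lemma psumS phi k g v u : reach k g -> psum phi ((v, u) :: g) = psum phi g + phi k g v.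
Proof. by move=> /(reach_inv hm)[h _ _ _] /=; rewrite h leq_addl addnK. Qed.

Lemma psum_eq phi psi k g : reach k g ->
  (forall i h v, (i < k)%N -> reach i h -> (v < tt i)%N -> phi i h v = psi i h v) ->
  psum phi g = psum psi g.
Proof.
elim: k g => [|k IH] g; first by move=> -> _; rewrite !psum0.
move=> [g' [v [hg vt ->]]] h; rewrite !(psumS _ _ _ hg) h//; congr (_ + _).
by apply: IH => // i g1 u ik; apply: h; rewrite ltnW.
Qed.

Lemma psum_le phi psi k g : reach k g ->
  (forall i h v, (i < k)%N -> reach i h -> (v < tt i)%N -> phi i h v <= psi i h v) ->
  psum phi g <= psum psi g.
Proof.
elim: k g => [|k IH] g; first by move=> -> _; rewrite !psum0.
move=> [g' [v [hg vt ->]]] h; rewrite !(psumS _ _ _ hg) lerD ?h//.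
by apply: IH => // i g1 u ik; apply: h; rewrite ltnW.
Qed.

Lemma psumD phi psi g :
  psum (fun i h v => phi i h v + psi i h v) g = psum phi g + psum psi g.
Proof.
elim: g => [|e g IH] /=; first by rewrite addr0.
by rewrite IH; case: ifP => _; ring.
Qed.

Lemma psumZ c phi g : psum (fun i h v => c * phi i h v) g = c * psum phi g.
Proof.
elim: g => [|e g IH] /=; first by rewrite mulr0.
by rewrite IH; case: ifP => _; ring.
Qed.

Lemma psumB phi psi g :
  psum (fun i h v => phi i h v - psi i h v) g = psum phi g - psum psi g.
Proof.
rewrite -[- psum psi g]mulN1r -psumZ -psumD.
elim: g => [//|e g IH] /=; rewrite IH; case: ifP => _ //; by rewrite mulN1r.
Qed.

Lemma psum_det (c : nat -> R) k g : reach k g ->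
  psum (fun i _ _ => c i) g = \sum_(0 <= i < k) c i.
Proof.
elim: k g => [|k IH] g; first by move=> ->; rewrite psum0 big_geq.
move=> [g' [v [hg vt ->]]]; rewrite (psumS _ _ _ hg) big_nat_recr//=.
by rewrite IH.
Qed.

Lemma ler_norm_psum phi g :
  `|psum phi g| <= psum (fun i h v => `|phi i h v|) g.
Proof.
elim: g => [|e g IH] /=; first by rewrite normr0.
by rewrite (le_trans (ler_normD _ _))// lerD//; case: ifP => // _; rewrite normr0.
Qed.

Section Martingale.
Variable dl : nat -> R.
Hypothesis hdl : forall t, - m%:R < dl t.
Local Notation cond := (cond m dl).
Local Notation E k := (Ex (flaw m dl k)).

Lemma Ex_psum phi k : E k (psum phi) = \sum_(0 <= i < k) E i (fun g => cond i g (phi i g)).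
Proof.
elim: k => [|k IH]; first by rewrite Ex0 psum0 big_geq.
rewrite big_nat_recr//= Ex_flawS -IH -ExD; apply: (eq_Ex hdl) => g hg.
rewrite (@eq_cond _ hdl _ _ _ (fun v => psum phi g + phi k g v)) //; last first.
  by move=> v _; rewrite (psumS _ _ _ hg).
by rewrite condD cond_cst.
Qed.

(** Orthogonality of martingale increments: the cross term has conditional mean 0, so second moments
    add up step by step. *)
Lemma Ex_psum_sqr phi (c : R) k :
  (forall i g, (i < k)%N -> reach i g -> cond i g (phi i g) = 0) ->
  (forall i g, (i < k)%N -> reach i g -> cond i g (fun v => phi i g v ^+ 2) <= c) ->
  E k (fun g => psum phi g ^+ 2) <= k%:R * c.
Proof.
elim: k => [|k IH] h1 h2; first by rewrite Ex0 psum0 mul0r expr0n.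
have {}IH : E k (fun g => psum phi g ^+ 2) <= k%:R * c.
  by apply: IH => i g ik; [apply: h1|apply: h2]; rewrite ltnW.
rewrite -natr1 mulrDl mul1r Ex_flawS.
rewrite (@eq_Ex _ hdl _ _ (fun g => psum phi g ^+ 2 +
    cond k g (fun v => phi k g v ^+ 2))); last first.
  move=> g hg; rewrite (@eq_cond _ hdl _ _ _ (fun v => psum phi g ^+ 2 +
      (2 * psum phi g) * phi k g v + phi k g v ^+ 2)) //; last first.
    by move=> v _; rewrite (psumS _ _ _ hg); ring.
  by rewrite !condD condZ h1// mulr0 addr0 cond_cst.
rewrite ExD lerD//; apply: (Ex_le_cst hdl) => g hg; exact: h2.
Qed.

Definition cen (f : nat -> R) (k : nat) (g : mgraph) (v : nat) : R :=
  f (deg g v) - cond k g (fun u => f (deg g u)).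

Lemma cond_cen f k g : reach k g -> cond k g (cen f k g) = 0.
Proof. by move=> hg; rewrite /cen condB cond_cst// subrr. Qed.

Lemma cond_cenM f1 f2 k g : reach k g ->
  cond k g (fun v => cen f1 k g v * cen f2 k g v) =
  cond k g (fun v => f1 (deg g v) * f2 (deg g v)) -
  cond k g (fun v => f1 (deg g v)) * cond k g (fun v => f2 (deg g v)).
Proof.
move=> hg; rewrite /cen; set a := cond k g (fun v => f1 (deg g v)).
set b := cond k g (fun v => f2 (deg g v)).
rewrite (@eq_cond _ hdl _ _ _ (fun v => f1 (deg g v) * f2 (deg g v) +
   - b * f1 (deg g v) + - a * f2 (deg g v) + a * b)) //; last first.
  by move=> v _; ring.
rewrite !condD !condZ cond_cst// -/a -/b; ring.
Qed.

Lemma cond_cen_sqr_le f c k g : reach k g ->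
  (forall r, (m <= r)%N -> `|f r| <= c) ->
  cond k g (fun v => cen f k g v ^+ 2) <= c ^+ 2.
Proof.
move=> hg hf.
under eq_fun do rewrite expr2.
rewrite cond_cenM// -expr2 (@le_trans _ _ (cond k g (fun v => f (deg g v) * f (deg g v))))//.
  by rewrite lerBlDr lerDl sqr_ge0.
rewrite -[leRHS](cond_cst hdl _ hg); apply: ler_cond => // v vt.
rewrite -expr2 -(real_normK (num_real (f _))) ler_sqr ?nnegrE//.
  by apply: hf; exact: (reach_deg hm hg).
by apply: le_trans (hf m _).
Qed.

Lemma Ex_mart_sqr f c k : (forall r, (m <= r)%N -> `|f r| <= c) ->
  E k (fun g => psum (cen f) g ^+ 2) <= k%:R * c ^+ 2.
Proof.
move=> hf; apply: Ex_psum_sqr => i g _ hg; first exact: cond_cen.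
exact: cond_cen_sqr_le.
Qed.

End Martingale.
End Expectation.

(** * Degree frequencies *)

Section LimitLaw.
Variables (R : realType) (m : nat).
Hypothesis hm : (0 < m)%N.
Local Notation mR := (m%:R : R).

Definition Bden (d : R) : R := d + mR * (2 + mR + d).

(* The frequencies [p_r(d)] of the paper, the Gamma quotient being replaced by its
   recursion in [r]; [pk_plim] identifies the two. *)
Fixpoint plim_shift (d : R) (i : nat) : R :=
  if i is i'.+1 then
    plim_shift d i' * (((m + i')%:R + d) / ((m + i')%:R + 3 + d + d / mR))
  else (2 * mR + d) / Bden d.

(** Extended by 0 below [m], so that [plim_balance] holds at every [r], the creation of vertices at
    [r.+1 = m] included. *)
Definition plim (d : R) (r : nat) : R :=
  if (r < m)%N then 0 else plim_shift d (r - m).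

Section Facts.
Variable d : R.
Hypothesis hd : - mR < d.

Let m0 : 0 < mR := natm_gt0 R hm.
Let m1 : 1 <= mR. Proof. by rewrite ler1n. Qed.
Let md0 : 0 < mR + d. Proof. by rewrite addrC -ltrBlDr sub0r. Qed.
Let dm1 : -1 < d / mR. Proof. by rewrite ltr_pdivlMr// mulN1r. Qed.
Ltac facts := have ? := m0; have ? := m1; have ? := md0; have ? := dm1.

Lemma Bden_gt0 : 0 < Bden d.
Proof.
facts.
rewrite /Bden; have -> : d + mR * (2 + mR + d) = (mR + d) + mR * (2 + (mR + d)) - mR by ring.
by have := mulr_gt0 m0 md0; lra.
Qed.

Lemma natd_gt0 r : (m <= r)%N -> 0 < r%:R + d.
Proof.
facts. by rewrite -(ler_nat R) => h; lra. Qed.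

Lemma plim_shift_gt0 i : 0 < plim_shift d i.
Proof.
facts.
elim: i => [|i IH] /=; first by rewrite divr_gt0 ?Bden_gt0//; lra.
have h := natd_gt0 (leq_addr i m).
rewrite mulr_gt0// divr_gt0//; lra.
Qed.

Lemma plim_ge0 r : 0 <= plim d r.
Proof. by rewrite /plim; case: ifP => // _; exact: ltW (plim_shift_gt0 _). Qed.

Lemma plimm : plim d m = (2 * mR + d) / Bden d.
Proof. by rewrite /plim ltnn subnn. Qed.

Lemma plim_lt r : (r < m)%N -> plim d r = 0.
Proof. by rewrite /plim => ->. Qed.

Lemma plimS r : (m <= r)%N ->
  plim d r.+1 = plim d r * ((r%:R + d) / (r%:R + 3 + d + d / mR)).
Proof.
move=> mr; rewrite /plim ltnNge (leqW mr)/= ltnNge mr /= subSn//=.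
by rewrite subnKC.
Qed.

(** Stationarity of the degree frequencies. With [k / m] vertices and normalisation
    [(2 m + d) k / m], the class of degree [r.+1] gains from degree [r], loses to degree [r.+2] and
    receives one vertex per [m] steps if [r.+1 = m]; the balance must equal its growth
    [plim d r.+1 / m]. *)
Lemma plim_balance r :
  ((r%:R + d) * plim d r - (r.+1%:R + d) * plim d r.+1) / (2 * mR + d) +
  ((r.+1 == m)%:R - plim d r.+1) / mR = 0.
Proof.
facts.
have h2 : 2 * mR + d != 0 by rewrite gt_eqF//; lra.
have hm0 : mR != 0 by rewrite gt_eqF.
have [rm|] := ltnP r.+1 m.
  by rewrite !plim_lt ?(ltnW rm)// (ltn_eqF rm) !mulr0 subrr !mul0r addr0.
rewrite leq_eqVlt => /predU1P[rm|rm].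
  have rm1 : (r < m)%N by rewrite rm.
  rewrite -rm eqxx (plim_lt rm1) plimm mulr0.
  have hB : Bden d != 0 by rewrite gt_eqF ?Bden_gt0.
  by move: hB; rewrite /Bden /= mulr1n => hB; field; rewrite hB h2 hm0.
rewrite gtn_eqF// plimS//.
have h0 := natd_gt0 rm; have h3 : r%:R + 3 + d + d / mR != 0 by rewrite gt_eqF//; lra.
have h4 : mR * (r%:R + 3 + d) + d != 0.
  by have := mulf_neq0 hm0 h3; rewrite mulrDr mulrCA divff// mulr1.
rewrite -natr1 /= mulr0n; field.
by rewrite h2 hm0 [(_ + d) * _]mulrC h4.
Qed.

(** Summing [plim_balance] telescopes: the defect from 1 is the flux out of the last degree kept,
    hence nonnegative. *)
Lemma sum_plim_le1 K : \sum_(m <= r < K) plim d r <= 1.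
Proof.
facts.
have h2 : 0 < 2 * mR + d by lra.
have h i : \sum_(m <= r < (m + i).+1) plim d r =
   1 - ((m + i)%:R + d) * plim d (m + i) * mR / (2 * mR + d).
  elim: i => [|i IH].
    rewrite addn0 big_nat1 plimm; have := Bden_gt0; rewrite /Bden => hB.
    by field; rewrite !gt_eqF.
  rewrite addnS big_nat_recr ?leqW ?leq_addr//= IH.
  have := plim_balance (m + i); rewrite gtn_eqF ?ltnS ?leq_addr// => hb.
  have hm0 : mR != 0 by rewrite gt_eqF.
  have h2' : 2 * mR + d != 0 by rewrite gt_eqF.
  have e : plim d (m + i).+1 =
     mR * (((m + i)%:R + d) * plim d (m + i) - ((m + i).+1%:R + d) * plim d (m + i).+1) / (2 * mR + d).
    set x := _ / (2 * mR + d) in hb.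
    have -> : forall y, mR * y / (2 * mR + d) = mR * (y / (2 * mR + d)).
      by move=> y; rewrite mulrA.
    rewrite -/x; have -> : x = plim d (m + i).+1 / mR.
      by move: hb; rewrite /= mulr0n sub0r mulNr => /eqP; rewrite subr_eq0 => /eqP.
    by rewrite mulrC divfK.
  by rewrite [in LHS]e; field.
have [Km|mK] := leqP K m; first by rewrite big_geq.
rewrite -(ltn_predK mK); set K' := K.-1.
have mK' : (m <= K')%N by rewrite -ltnS /K' (ltn_predK mK).
rewrite -(subnKC mK') h lerBlDr lerDl.
by rewrite divr_ge0 ?(ltW h2)// !mulr_ge0 ?plim_ge0 ?(ltW m0)// ltW// natd_gt0// leq_addr.
Qed.

End Facts.
End LimitLaw.

(** * Square-root concentration of the degree counts *)

Section Concentration.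
Variables (R : realType) (m : nat).
Hypothesis hm : (0 < m)%N.
Local Notation mR := (m%:R : R).
Local Notation tt := (tt m).
Local Notation reach := (reach m).
Variable d : R.
Hypothesis hd : - mR < d.

Let m0 : 0 < mR := natm_gt0 R hm.
Let m1 : 1 <= mR. Proof. by rewrite ler1n. Qed.
Let md0 : 0 < mR + d. Proof. by rewrite addrC -ltrBlDr sub0r. Qed.

Ltac facts := have ? := m0; have ? := m1; have ? := md0.

Definition Nr (r k : nat) (g : mgraph) : R := dsum (fun x => (x == r)%:R) (tt k) g.

Definition tfrac (k : nat) : R := (tt k)%:R - k%:R / mR.

(* The number of vertices [tt k] is a staircase of mean slope [1 / m]; removing
   the staircase from the count of degree [m] makes the increments of [Zr]
   the same function of the sampled degree at every step. *)
Definition Zr (r k : nat) (g : mgraph) : R :=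
  Nr r k g - (r == m)%:R * tfrac k - k%:R / mR * plim m d r.

Lemma tfrac_bounds k : 1 <= tfrac k <= 2.
Proof.
have ? := m0; have ? := m1.
have [h1 h2] := tt_bounds R hm k; rewrite /tfrac.
apply/andP; split.
  by rewrite lerBrDr -lerBrDl ler_pdivrMr// mulrC.
by rewrite lerBlDr -lerBlDl ler_pdivlMr// mulrC.
Qed.

Lemma tfracS k : tfrac k.+1 = tfrac k + (m %| k.+1)%:R - mR^-1.
Proof. by rewrite /tfrac ttS// natrD -natr1 mulrDl mul1r; ring. Qed.

Lemma tt_ub k : (tt k)%:R <= 2 * (k%:R + 1) :> R.
Proof.
have ? := m0; have ? := m1.
have [_ h] := tt_bounds R hm k.
have k0 : 0 <= k%:R :> R by [].
have : (tt k)%:R - 2 <= k%:R :> R.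
  have [t2|t2] := leP ((tt k)%:R : R) 2; first by lra.
  nra.
lra.
Qed.

Lemma Stot_lb k (d' : R) : - mR < d' ->
  (mR + d') / (1 + mR + d') * (k%:R + 1) <= Stot m k d'.
Proof.
have ? := m0; have ? := m1.
move=> hd'; have md' : 0 < mR + d' by lra.
have t2 : 2 <= (tt k)%:R :> R by rewrite ler_nat.
have k0 : 0 <= k%:R :> R by [].
rewrite /Stot mulrAC ler_pdivrMr; last lra.
have : 0 <= (mR + d') * k%:R by rewrite mulr_ge0// ltW.
have : 2 * (mR + d') <= (tt k)%:R * (mR + d') by rewrite ler_wpM2r// ltW.
nra.
Qed.

Lemma Stot_ub k (d' : R) : - mR < d' ->
  Stot m k d' <= (2 * (mR + d') + 1) * (k%:R + 1).
Proof.
have ? := m0; have ? := m1.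
move=> hd'; have md' : 0 <= mR + d' by lra.
have := ler_wpM2r md' (tt_ub k); rewrite /Stot.
have k0 : 0 <= k%:R :> R by [].
nra.
Qed.

Lemma Zr_lt r k g : reach k g -> (r < m)%N -> Zr r k g = 0.
Proof.
move=> hg rm; rewrite /Zr (ltn_eqF rm) plim_lt// mulr0 mul0r !subr0 /Nr.
rewrite (@eq_dsum _ _ hm _ (fun=> 0) _ _ hg) ?dsum_cst ?mulr0//.
by move=> x mx; rewrite gtn_eqF// (leq_trans rm).
Qed.

Definition Uinc (r D : nat) : R :=
  (D.+1 == r)%:R - (D == r)%:R + ((r == m)%:R - plim m d r) / mR.

Lemma Zr_step r k g v : reach k g -> (v < tt k)%N ->
  Zr r k.+1 ((v, tt k) :: g) = Zr r k g + Uinc r (deg g v).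
Proof.
move=> hg vt; rewrite /Zr /Nr dsum_step// tfracS /Uinc (eq_sym m r) -natr1.
ring.
Qed.

Lemma cond_Uinc dl r k g : (forall t, - mR < dl t) -> reach k g ->
  cond m dl k g (fun v => Uinc r.+1 (deg g v)) =
  ((r%:R + dl (tt k)) * Nr r k g - (r.+1%:R + dl (tt k)) * Nr r.+1 k g) /
     Stot m k (dl (tt k)) + ((r.+1 == m)%:R - plim m d r.+1) / mR.
Proof.
move=> hdl hg; rewrite /Uinc condD cond_cst//; congr (_ + _).
rewrite condB (condE hm dl (fun D => (D.+1 == r.+1)%:R) hg).
rewrite (condE hm dl (fun D => (D == r.+1)%:R) hg) -mulrBl; congr ((_ - _) / _).
  rewrite /Nr -dsumZ; apply: eq_bigr => v _.
  by rewrite eqSS; case: eqP => [->|]; rewrite ?mulr0.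
rewrite /Nr -dsumZ; apply: eq_bigr => v _.
by case: eqP => [->|]; rewrite ?mulr0.
Qed.

Lemma Uinc_bound r D : `|Uinc r D| <= 3 + `|((r == m)%:R - plim m d r) / mR|.
Proof.
rewrite /Uinc; set c := _ / mR.
rewrite (le_trans (ler_normD _ _))// lerD2r (le_trans (ler_normB _ _))//.
by case: eqP; case: eqP => _ _; rewrite ?normr1 ?normr0; lra.
Qed.

(** Here [x] and [y] stand for [Zr r] and [Zr r.+1]. The terms of order [k] cancel by
    [plim_balance]; what remains is a contraction of [y], a forcing by [x] and an error of order
    [1 / S], since [tfrac] is bounded. *)
Lemma drift_Uinc r k (x y : R) (S := Stot m k d) :
  ((r%:R + d) * (x + (r == m)%:R * tfrac k + k%:R / mR * plim m d r) -
   (r.+1%:R + d) * (y + (r.+1 == m)%:R * tfrac k + k%:R / mR * plim m d r.+1)) / S +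
  ((r.+1 == m)%:R - plim m d r.+1) / mR =
  - ((r.+1%:R + d) / S) * y + (r%:R + d) / S * x +
  tfrac k * ((r%:R + d) * (r == m)%:R - (r.+1%:R + d) * (r.+1 == m)%:R +
             (mR + d) * (((r.+1 == m)%:R - plim m d r.+1) / mR)) / S.
Proof.
facts.
have S0 : S != 0 by rewrite gt_eqF// Stot_gt0.
have h2 : 2 * mR + d != 0 by rewrite gt_eqF//; lra.
have hm0 : mR != 0 by rewrite gt_eqF.
have hS : S = (2 * mR + d) * (k%:R / mR) + (mR + d) * tfrac k.
  by rewrite /S /Stot /tfrac; field.
have := plim_balance hm hd r.
set c := (_ - plim m d r.+1) / mR.
set a := (_ - _ : R) => hb.
have hc : c * (2 * mR + d) = - a.
  have -> : c = - (a / (2 * mR + d)) by lra.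
  by rewrite mulNr divfK.
have cS : c * S = - a * (k%:R / mR) + (mR + d) * c * tfrac k.
  by rewrite -hc hS; ring.
apply: (mulIf S0); rewrite [LHS]mulrDl divfK// cS /a.
by clearbody S c; field; rewrite S0.
Qed.

(** Induction on [r]: [Zr r.+1] is contracted and driven by [Zr r], whose second moment is already
    at most linear; each step then adds a bounded amount to the second moment. *)
Lemma Zr_sqr_le r : exists2 C, 0 <= C & forall dl K,
  (forall t, - mR < dl t) -> (forall k, (k < K)%N -> dl (tt k) = d) ->
  forall k, (k <= K)%N -> Ex (flaw m dl k) (fun g => Zr r k g ^+ 2) <= C * (k%:R + 1).
Proof.
facts.
elim: r => [|r [C C0 IH]].
  exists 0 => // dl K hdl _ k _; rewrite mul0r; apply: (Ex_le_cst hm hdl) => g hg.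
  by rewrite Zr_lt// expr0n.
have [rm|rm] := ltnP r.+1 m.
  exists 0 => // dl K hdl _ k _; rewrite mul0r; apply: (Ex_le_cst hm hdl) => g hg.
  by rewrite Zr_lt// expr0n.
have rd0 : 0 < r.+1%:R + d := natd_gt0 hm hd rm.
have [s0 s00 Slb0] : exists2 s0 : R, 0 < s0 &
    forall k, s0 * (k%:R + 1) <= Stot m k d.
  exists ((mR + d) / (1 + mR + d)); first by rewrite divr_gt0//; lra.
  by move=> k; exact: Stot_lb.
pose s1 := 2 * (mR + d) + 1.
pose c2 := (r%:R + d) * (r == m)%:R - (r.+1%:R + d) * (r.+1 == m)%:R +
             (mR + d) * (((r.+1 == m)%:R - plim m d r.+1) / mR) : R.
pose cU := 3 + `|((r.+1 == m)%:R - plim m d r.+1) / mR| : R.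
pose z0 := (2 * (m == r.+1)%:R - (r.+1 == m)%:R * 2) ^+ 2 : R.
pose C1 := (r%:R + d) ^+ 2 / ((r.+1%:R + d) * s0) * C.
pose C2 := 4 * c2 ^+ 2 / ((r.+1%:R + d) * s0).
have C10 : 0 <= C1.
  apply: mulr_ge0 => //; apply: divr_ge0; first exact: sqr_ge0.
  by apply: mulr_ge0; exact: ltW.
have C20 : 0 <= C2.
  apply: divr_ge0; first by rewrite mulr_ge0 ?sqr_ge0.
  by apply: mulr_ge0; exact: ltW.
exists (z0 + (C1 + C2 + cU ^+ 2)) => [|dl K hdl hK].
  by rewrite !addr_ge0 ?sqr_ge0.
elim=> [|k IHk] kK.
  rewrite Ex0 /Zr /Nr dsum0// /tfrac /tt div0n !mul0r subr0 subr0 add0r mulr1 /z0.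
  by rewrite lerDl !addr_ge0 ?sqr_ge0.
have {}IHk := IHk (ltnW kK).
rewrite Ex_flawS.
pose al := (r.+1%:R + d) / Stot m k d.
have S0 : 0 < Stot m k d by exact: Stot_gt0.
have al0 : 0 < al by rewrite divr_gt0.
have key g : reach k g ->
   cond m dl k g (fun v => Zr r.+1 k.+1 ((v, tt k) :: g) ^+ 2) <=
   Zr r.+1 k g ^+ 2 + (r%:R + d) ^+ 2 / ((r.+1%:R + d) * s0) / (k%:R + 1) * Zr r k g ^+ 2
   + C2 + cU ^+ 2.
  move=> hg.
  rewrite (@eq_cond _ _ hm _ hdl _ _ _ (fun v => Zr r.+1 k g ^+ 2 +
     (2 * Zr r.+1 k g) * Uinc r.+1 (deg g v) + Uinc r.+1 (deg g v) ^+ 2)) //; last first.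
    by move=> v vt; rewrite Zr_step//; ring.
  rewrite !condD condZ cond_cst// lerD//; last first.
    rewrite -[leRHS](cond_cst hm hdl _ hg); apply: (ler_cond hm hdl hg) => v _.
    rewrite -(real_normK (num_real (Uinc _ _))) ler_sqr ?nnegrE ?addr_ge0//.
    exact: Uinc_bound.
  rewrite -addrA lerD2l cond_Uinc// hK//.
  have -> : Nr r k g = Zr r k g + (r == m)%:R * tfrac k + k%:R / mR * plim m d r.
    by rewrite /Zr; ring.
  have -> : Nr r.+1 k g =
      Zr r.+1 k g + (r.+1 == m)%:R * tfrac k + k%:R / mR * plim m d r.+1.
    by rewrite /Zr; ring.
  rewrite drift_Uinc -/al -/c2; set Z := Zr r.+1 k g; set W := Zr r k g.
  set be := (r%:R + d) / _; set e := tfrac k * c2 / _.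
  have amgm x : 2 * Z * x <= al * Z ^+ 2 + x ^+ 2 / al.
    rewrite -subr_ge0.
    have -> : al * Z ^+ 2 + x ^+ 2 / al - 2 * Z * x = (al * Z - x) ^+ 2 / al.
      by field; rewrite gt_eqF.
    by rewrite divr_ge0 ?sqr_ge0// ltW.
  have h1 := amgm (be * W); have h2 := amgm e.
  have k1 : 0 < k%:R + 1 :> R by rewrite ltr_wpDl.
  have Slb : s0 * (k%:R + 1) <= Stot m k d by exact: Slb0.
  have iS : (Stot m k d)^-1 <= (s0 * (k%:R + 1))^-1.
    by rewrite lef_pV2 ?posrE// mulr_gt0.
  have iS0 : 0 <= (Stot m k d)^-1 by rewrite invr_ge0 ltW.
  have iS1 : (Stot m k d)^-1 <= s0^-1.
    apply: (le_trans iS); rewrite lef_pV2 ?posrE ?mulr_gt0//.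
    by rewrite ler_peMr ?(ltW s00)// lerDr.
  have h3 : (be * W) ^+ 2 / al <=
     (r%:R + d) ^+ 2 / ((r.+1%:R + d) * s0) / (k%:R + 1) * W ^+ 2.
    have -> : (be * W) ^+ 2 / al =
       (r%:R + d) ^+ 2 / (r.+1%:R + d) * W ^+ 2 * (Stot m k d)^-1.
      by rewrite /be /al; move: (r.+1%:R + d) rd0 => x x0; field; rewrite !gt_eqF.
    have -> : (r%:R + d) ^+ 2 / ((r.+1%:R + d) * s0) / (k%:R + 1) * W ^+ 2 =
       (r%:R + d) ^+ 2 / (r.+1%:R + d) * W ^+ 2 * (s0 * (k%:R + 1))^-1.
      by move: (r.+1%:R + d) rd0 => x x0; field; rewrite !gt_eqF.
    by apply: ler_wpM2l => //; rewrite mulr_ge0 ?sqr_ge0// divr_ge0 ?sqr_ge0// ltW.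
  have h4 : e ^+ 2 / al <= C2.
    have -> : e ^+ 2 / al =
       tfrac k ^+ 2 * (c2 ^+ 2 / (r.+1%:R + d) * (Stot m k d)^-1).
      by rewrite /e /al; move: (r.+1%:R + d) rd0 => x x0; field; rewrite !gt_eqF.
    have -> : C2 = 4 * (c2 ^+ 2 / (r.+1%:R + d) * s0^-1).
      by rewrite /C2; move: (r.+1%:R + d) rd0 => x x0; field; rewrite !gt_eqF.
    have /andP[u1 u2] := tfrac_bounds k.
    apply: ler_pM.
    - by rewrite sqr_ge0.
    - by rewrite mulr_ge0// divr_ge0 ?sqr_ge0// ltW.
    - nra.
    - by rewrite ler_wpM2l// divr_ge0 ?sqr_ge0// ltW.
  lra.
apply: (le_trans (ler_Ex hm hdl key)).
rewrite !ExD ExZ !Ex_cst//.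
have hr := IH dl K hdl hK k (ltnW kK).
have k1 : 0 < k%:R + 1 :> R by rewrite ltr_wpDl.
set q := (r%:R + d) ^+ 2 / ((r.+1%:R + d) * s0) in C1 C10 IHk *.
have q0 : 0 <= q.
  apply: divr_ge0; first exact: sqr_ge0.
  by apply: mulr_ge0; exact: ltW.
have h5 : q / (k%:R + 1) * Ex (flaw m dl k) (fun g => Zr r k g ^+ 2) <= C1.
  rewrite /C1 mulrAC -mulrA ler_wpM2l// ler_pdivrMr//.
have z00 : 0 <= z0 by rewrite sqr_ge0.
rewrite -natr1 mulrDr mulr1; lra.
Qed.

(** Up to step [K] this is the second moment bound; afterwards each step moves [Zr] by at most [cU],
    whence the term linear in the truncated difference [k - K]. *)
Lemma Zr_norm_le r : exists2 C, 0 <= C & forall dl K,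
  (forall t, - mR < dl t) -> (forall k, (k < K)%N -> dl (tt k) = d) ->
  forall k, Ex (flaw m dl k) (fun g => `|Zr r k g|) <=
    C * Num.sqrt (k%:R + 1) + C * (k - K)%:R.
Proof.
have [C C0 hC] := Zr_sqr_le r.
pose cU := 3 + `|((r == m)%:R - plim m d r) / mR| : R.
have cU0 : 0 <= cU by rewrite addr_ge0.
exists (Num.sqrt C + cU) => [|dl K hdl hK]; first by rewrite addr_ge0 ?sqrtr_ge0.
have hk k : (k <= K)%N -> Ex (flaw m dl k) (fun g => `|Zr r k g|) <=
    (Num.sqrt C + cU) * Num.sqrt (k%:R + 1).
  move=> kK; have := @Ex_norm_sqrt _ _ hm _ hdl k _ _ _ (hC dl K hdl hK k kK).
  move=> /(_ (mulr_ge0 C0 (addr_ge0 (ler0n _ k) ler01))) h.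
  by rewrite (le_trans h)// sqrtrM// ler_wpM2r ?sqrtr_ge0// lerDl.
have hj j : Ex (flaw m dl (K + j)) (fun g => `|Zr r (K + j) g|) <=
    (Num.sqrt C + cU) * Num.sqrt (K%:R + 1) + (Num.sqrt C + cU) * j%:R.
  elim: j => [|j IH]; first by rewrite addn0 mulr0 addr0; exact: hk.
  rewrite addnS Ex_flawS -natr1 mulrDr addrA mulr1.
  apply: (@le_trans _ _ (Ex (flaw m dl (K + j)) (fun g => `|Zr r (K + j) g| + cU))).
    apply: (ler_Ex hm hdl) => g hg.
    rewrite -[leRHS](cond_cst hm hdl _ hg); apply: (ler_cond hm hdl hg) => v vt.
    rewrite Zr_step// (le_trans (ler_normD _ _))// lerD2l; exact: Uinc_bound.
  by rewrite ExD Ex_cst// lerD// lerDr sqrtr_ge0.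
move=> k; have [kK|Kk] := leqP k K.
  by rewrite (eqP (_ : (k - K == 0)%N)) ?subn_eq0// mulr0 addr0; exact: hk.
rewrite -{1 2}(subnKC (ltnW Kk)) (le_trans (hj _))// lerD2r ler_wpM2l//.
  by rewrite addr_ge0 ?sqrtr_ge0.
by rewrite ler_wsqrtr// lerD2r ler_nat ltnW.
Qed.

(** Since [f] tends to 0, the vertices of degree at least a cutoff [B] cost at most [eps / 4] each,
    however they are distributed; only the finitely many [Zr r] with [r < B] remain. *)
Lemma dsum_le (f : nat -> R) (F : R) :
  f r @[r --> \oo] --> 0 ->
  (\sum_(m <= r < K) plim m d r * f r) @[K --> \oo] --> F ->
  forall eps, 0 < eps -> exists2 C, 0 <= C & forall dl K,
  (forall t, - mR < dl t) -> (forall k, (k < K)%N -> dl (tt k) = d) ->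
  forall k, Ex (flaw m dl k) (fun g => `|dsum f (tt k) g - (tt k)%:R * F|) <=
    eps * (k%:R + 1) + C * Num.sqrt (k%:R + 1) + C * (k - K)%:R.
Proof.
move=> f0 hF eps e0.
have e4 : 0 < eps / 4 by rewrite divr_gt0.
have [B [mB hB1 hB2]] : exists B, [/\ (m < B)%N,
    forall r, (B <= r)%N -> `|f r| <= eps / 4 &
    `|\sum_(m <= r < B) plim m d r * f r - F| <= eps / 4].
  have /cvgrPdist_le/(_ _ e4)[B1 _ h1] := f0.
  have /cvgrPdist_le/(_ _ e4)[B2 _ h2] := hF.
  exists (maxn m.+1 (maxn B1 B2)); split; first by rewrite leq_max leqnn.
    move=> r; rewrite !geq_max => /andP[_ /andP[hr _]].
    by have := h1 _ hr; rewrite /= sub0r normrN.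
  rewrite distrC; apply: h2; rewrite /= !leq_max leqnn !orbT//.
have /choice[Cz hCz] : forall r, exists C, 0 <= C /\ forall dl K,
    (forall t, - mR < dl t) -> (forall k, (k < K)%N -> dl (tt k) = d) ->
    forall k, Ex (flaw m dl k) (fun g => `|Zr r k g|) <=
    C * Num.sqrt (k%:R + 1) + C * (k - K)%:R.
  by move=> r; have [C C0 hC] := Zr_norm_le r; exists C.
pose A := 2 * `|f m| + 2 * `|F|.
pose C1 := \sum_(m <= r < B) `|f r| * Cz r.
have C10 : 0 <= C1.
  by apply: sumr_ge0 => r _; rewrite mulr_ge0//; case: (hCz r).
have A0 : 0 <= A by rewrite addr_ge0// mulr_ge0.
have ptw k g : reach k g -> `|dsum f (tt k) g - (tt k)%:R * F| <=
    \sum_(m <= r < B) `|f r| * `|Zr r k g| + (A + eps * (k%:R + 1)).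
  move=> hg.
  have hsplit : dsum f (tt k) g = \sum_(m <= r < B) f r * Nr r k g +
      dsum (fun x => f x * (B <= x)%:R) (tt k) g.
    rewrite (@eq_dsum _ _ hm _ (fun x => \sum_(m <= r < B) f r * (x == r)%:R +
       f x * (B <= x)%:R) _ _ hg); last first.
      move=> x mx; have [xB|Bx] := ltnP x B.
        rewrite (bigD1_seq x) ?iota_uniq ?mem_index_iota ?mx ?xB//= eqxx mulr1.
        rewrite big1 ?mulr0 ?addr0// => r /negbTE rx.
        by rewrite eq_sym rx mulr0.
      rewrite big_nat big1 ?add0r ?mulr1// => r /andP[_ rB].
      by rewrite gtn_eqF ?mulr0// (leq_trans rB).
    rewrite dsumD; congr (_ + _); rewrite /dsum exchange_big/=.
    by apply: eq_bigr => r _; rewrite -mulr_sumr.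
  have hN : \sum_(m <= r < B) f r * Nr r k g = \sum_(m <= r < B) f r * Zr r k g +
      f m * tfrac k + k%:R / mR * \sum_(m <= r < B) plim m d r * f r.
    transitivity (\sum_(m <= r < B) (f r * Zr r k g + f r * ((r == m)%:R * tfrac k)
        + k%:R / mR * (plim m d r * f r))).
      by apply: eq_bigr => r _; rewrite /Zr; ring.
    rewrite !big_split/= -mulr_sumr; congr (_ + _ + _).
    rewrite (bigD1_seq m) ?iota_uniq ?mem_index_iota ?leqnn ?mB//= eqxx mul1r.
    by rewrite big1 ?addr0// => r /negbTE ->; rewrite mul0r mulr0.
  have /andP[u1 u2] := tfrac_bounds k.
  have hrest : `|dsum (fun x => f x * (B <= x)%:R) (tt k) g| <= eps / 4 * (2 * (k%:R + 1)).
    apply: le_trans (_ : (tt k)%:R * (eps / 4) <= _); last first.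
      by rewrite mulrC ler_wpM2l ?(ltW e4)// tt_ub.
    rewrite -(dsum_cst _ _ g) /dsum (le_trans (ler_norm_sum _ _ _))//.
    apply: ler_sum => v _; have [Bx|xB] := leqP B (deg g v).
      by rewrite mulr1 hB1.
    by rewrite mulr0 normr0 ltW.
  have hm0 : mR != 0 by rewrite gt_eqF.
  have -> : dsum f (tt k) g - (tt k)%:R * F = \sum_(m <= r < B) f r * Zr r k g +
     (f m * tfrac k - tfrac k * F +
      k%:R / mR * (\sum_(m <= r < B) plim m d r * f r - F) +
      dsum (fun x => f x * (B <= x)%:R) (tt k) g).
    have -> : (tt k)%:R = tfrac k + k%:R / mR by rewrite /tfrac subrK.
    by rewrite hsplit hN; ring.
  rewrite (le_trans (ler_normD _ _))// lerD//.
    rewrite (le_trans (ler_norm_sum _ _ _))//.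
    by apply: ler_sum => r _; rewrite normrM.
  have k1 : 0 <= k%:R / mR <= k%:R + 1.
    rewrite divr_ge0 ?(ltW m0)//= ler_pdivrMr//.
    by have := ler0n R k; have := m1; nra.
  have h1 : `|f m * tfrac k| <= 2 * `|f m|.
    rewrite normrM mulrC ler_wpM2r// ger0_norm//; lra.
  have h2 : `|tfrac k * F| <= 2 * `|F|.
    by rewrite normrM ler_wpM2r// ger0_norm//; lra.
  have h3 : `|k%:R / mR * (\sum_(m <= r < B) plim m d r * f r - F)| <=
      (k%:R + 1) * (eps / 4).
    rewrite normrM (ger0_norm (_ : 0 <= k%:R / mR)); last by case/andP: k1.
    by apply: ler_pM => //; case/andP: k1.
  apply: le_trans (ler_normD _ _) _; rewrite /A.
  have h4 := ler_normD (f m * tfrac k - tfrac k * F)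
     (k%:R / mR * (\sum_(m <= r < B) plim m d r * f r - F)).
  have h5 := ler_normB (f m * tfrac k) (tfrac k * F).
  have k10 : 0 <= eps * (k%:R + 1) by rewrite mulr_ge0// ltW.
  lra.
exists (C1 + A) => [|dl K hdl hK k]; first exact: addr_ge0.
apply: (le_trans (ler_Ex hm hdl (ptw k))).
rewrite ExD Ex_cst// Ex_sum.
have hs : \sum_(m <= r < B) Ex (flaw m dl k) (fun g => `|f r| * `|Zr r k g|) <=
    C1 * Num.sqrt (k%:R + 1) + C1 * (k - K)%:R.
  rewrite /C1 !mulr_suml -big_split/=; apply: ler_sum => r _.
  by rewrite ExZ -!mulrA -mulrDr ler_wpM2l//; case: (hCz r) => _; exact.
have s1 : 1 <= Num.sqrt (k%:R + 1) :> R.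
  by rewrite -[leLHS]sqrtr1 ler_wsqrtr// lerDr.
have h6 : A <= A * Num.sqrt (k%:R + 1) by rewrite ler_peMr.
have h7 : 0 <= A * (k - K)%:R by rewrite mulr_ge0.
lra.
Qed.

End Concentration.

(** * The normal distribution and Lindeberg's method *)

Section NormalTail.
Variable R : realType.
Local Notation mu := (@lebesgue_measure R).

Definition npdf (x : R) : R := (Num.sqrt (2 * pi))^-1 * expR (- x ^+ 2 / 2).

Definition Phi (r : R) : R := \int[mu]_(x in `]-oo, r]) npdf x.

Lemma npdfE : npdf = normal_pdf 0 1.
Proof.
rewrite normal_pdfE ?oner_neq0//; apply/funext => x.
rewrite /npdf /normal_peak /normal_fun subr0 expr1n mul1r.
by rewrite -[pi *+ 2]mulr_natl -[1 *+ 2]/(2%:R).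
Qed.

Lemma npdf_ge0 x : 0 <= npdf x.
Proof. by rewrite npdfE normal_pdf_ge0. Qed.

Lemma npdf_continuous : continuous npdf.
Proof. by rewrite npdfE; apply: continuous_normal_pdf; rewrite oner_neq0. Qed.

Lemma npdfN x : npdf (- x) = npdf x.
Proof. by rewrite /npdf sqrrN. Qed.

Lemma npdf_integrable (A : set R) : measurable A -> mu.-integrable A (EFin \o npdf).
Proof.
move=> mA; rewrite npdfE; apply: (@integrableS _ _ _ _ setT) => //.
exact: (integrable_normal_pdf 0 1).
Qed.

Lemma PhiE r : Phi r = fine (normal_prob 0 1 `]-oo, r]).
Proof. by rewrite /Phi /Rintegral /normal_prob npdfE. Qed.

(** [Phi] is read as the distribution function of the identity under the standard normal law, which
    yields its monotonicity, its bounds and its limit at [-oo]. *)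
Let idTR : measurableTypeR R -> R := idfun.
#[local] HB.instance Definition _ :=
  @isMeasurableFun.Build _ _ _ _ idTR (@measurable_id _ _ setT).
Let X : {RV (normal_prob 0 1 : probability _ R) >-> R} := idTR.

Let Phi_cdf : Phi = fine \o cdf X.
Proof. by apply/funext => r; rewrite PhiE. Qed.

Lemma Phi_cvgNy : Phi @ -oo --> (0 : R).
Proof. by rewrite Phi_cdf; exact/fine_cvg/cvg_cdfNy0. Qed.

Lemma Phi_nd : {homo Phi : x y / x <= y}.
Proof.
move=> x y xy; rewrite Phi_cdf; apply: fine_le; rewrite ?fin_num_measure//.
exact: (cdf_nondecreasing X).
Qed.

Lemma Phi_ge0 x : 0 <= Phi x.
Proof. by rewrite Phi_cdf /= fine_ge0. Qed.

Lemma Phi_le1 x : Phi x <= 1.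
Proof.
rewrite Phi_cdf -[leRHS]/(fine 1%E); apply: fine_le; rewrite ?fin_num_measure//.
exact: (cdf_le1 X).
Qed.

Lemma Phi_derive (x : R) : is_derive x 1 Phi (npdf x).
Proof.
have x1 : x < x + 1 by rewrite ltrDl.
have [h1 h2] := @continuous_FTC1 R npdf -oo%O x (x + 1) x1
  (npdf_integrable (measurable_itv _)) (ltNyr _) (@npdf_continuous x).
by apply: DeriveDef => //; rewrite -derive1E.
Qed.

(** By symmetry of the density. It brings the quantile condition, given by an upper tail, to a value
    of [Phi]. *)
Lemma tail_Phi z : \int[mu]_(x in `[z, +oo[) npdf x = Phi (- z).
Proof.
rewrite /Phi /Rintegral ge0_integration_by_substitutionNy.
- by congr fine; apply: eq_integral => x _ /=; rewrite npdfN.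
- by apply: continuous_subspaceT => x; exact: npdf_continuous.
- by move=> x _; exact: npdf_ge0.
Qed.

Lemma PhiN z : Phi (- z) = 1 - Phi z.
Proof.
apply/eqP; rewrite eq_sym subr_eq; apply/eqP.
rewrite -tail_Phi -Rintegral_itv_obnd_cbnd; last exact: npdf_integrable.
rewrite addrC -Rintegral_setU//=.
- rewrite -setCitvl setUv.
  by rewrite /Rintegral -[LHS]/(fine 1%E) npdfE integral_normal_pdf.
- apply: npdf_integrable; exact: measurableU.
- by rewrite -setCitvl; apply/disj_setPCl.
Qed.

End NormalTail.

(** * Taylor bounds and the heat equation for [Phi (x / sqrt s)] *)

Section HeatKernel.
Variable R : realType.
Implicit Types x y s h a b : R.

(** Phrased with [Num.min] and [Num.max] because the increments of the chain have either sign. *)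
Lemma mvt_between (f df : R -> R) a b :
  (forall x, Num.min a b <= x <= Num.max a b -> is_derive x 1 f (df x)) ->
  exists2 c, Num.min a b <= c <= Num.max a b & f b - f a = df c * (b - a).
Proof.
have aux (a' b' : R) : a' <= b' -> (forall x, a' <= x <= b' -> is_derive x 1 f (df x)) ->
    exists2 c, a' <= c <= b' & f b' - f a' = df c * (b' - a').
  move=> ab hd.
  have hder x : x \in `]a', b'[ -> is_derive x 1 f (df x).
    by rewrite in_itv/= => /andP[/ltW ax /ltW xb]; apply: hd; rewrite ax xb.
  have hcont : {within `[a', b'], continuous f}.
    apply: continuous_in_subspaceT => x; rewrite inE /= in_itv/= => /hd hx.
    by apply: differentiable_continuous; apply/derivable1_diffP; exact: ex_derive.
  have [c] := MVT_segment ab hder hcont.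
  by rewrite in_itv/= => ? ?; exists c.
have [ab|/ltW ba] := leP a b => hd; first exact: aux.
have [c hc e] := aux b a ba hd; exists c => //.
by rewrite -opprB e -mulrN opprB.
Qed.

Lemma mvt_norm_le (f df : R -> R) a b K :
  (forall x, Num.min a b <= x <= Num.max a b -> is_derive x 1 f (df x)) ->
  (forall x, Num.min a b <= x <= Num.max a b -> `|df x| <= K) ->
  `|f b - f a| <= K * `|b - a|.
Proof.
move=> hd hK; have [c hc ->] := mvt_between hd.
by rewrite normrM ler_wpM2r// hK.
Qed.

Lemma between_le_norm a h x : Num.min a (a + h) <= x <= Num.max a (a + h) ->
  `|x - a| <= `|h|.
Proof.
have [h0|h0] := leP 0 h.
  rewrite min_l ?max_r ?lerDl// => /andP[h1 h2].
  by rewrite (ger0_norm h0) ger0_norm ?subr_ge0// lerBlDl.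
rewrite min_r ?max_l ?gerDl ?(ltW h0)// => /andP[h1 h2].
by rewrite (ltr0_norm h0) ler0_norm ?subr_le0//; lra.
Qed.

Lemma taylor_order1 (f f1 : R -> R) a h K :
  (forall x, Num.min a (a + h) <= x <= Num.max a (a + h) -> is_derive x 1 f (f1 x)) ->
  (forall x, Num.min a (a + h) <= x <= Num.max a (a + h) -> `|f1 x - f1 a| <= K) ->
  `|f (a + h) - f a - h * f1 a| <= K * `|h|.
Proof.
move=> hd hK; have [c hc e] := mvt_between hd.
rewrite e (_ : a + h - a = h); last by ring.
by rewrite mulrC -mulrBr normrM mulrC ler_wpM2r// hK.
Qed.

(** Three mean value bounds in a row, the last one applied to [f] minus its Taylor polynomial; this
    gives the constant [K], coarser than the [K / 6] of the integral remainder. *)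
Lemma taylor_order2 (f f1 f2 f3 : R -> R) a h K :
  (forall x, is_derive x 1 f (f1 x)) -> (forall x, is_derive x 1 f1 (f2 x)) ->
  (forall x, is_derive x 1 f2 (f3 x)) -> (forall x, `|f3 x| <= K) ->
  `|f (a + h) - f a - h * f1 a - h ^+ 2 / 2 * f2 a| <= K * `|h| ^+ 3.
Proof.
move=> d1 d2 d3 hK.
pose G x := f x - (x - a) * f1 a - (x - a) ^+ 2 / 2 * f2 a.
have dG x : is_derive x 1 G (f1 x - f1 a - (x - a) * f2 a).
  have hx := d1 x; apply: is_derive_eq; by rewrite /GRing.scale /=; field.
have K0 : 0 <= K by exact: le_trans (hK 0).
have hG x : Num.min a (a + h) <= x <= Num.max a (a + h) ->
    `|f1 x - f1 a - (x - a) * f2 a| <= K * `|h| * `|h|.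
  move=> /between_le_norm hx.
  have e : x = a + (x - a) by ring.
  rewrite {1}e; apply: le_trans (_ : K * `|x - a| * `|x - a| <= _).
    apply: (@taylor_order1 f1 f2) => y /between_le_norm hy.
    apply: le_trans (_ : K * `|y - a| <= _); last by rewrite ler_wpM2l.
    by apply: (@mvt_norm_le f2 f3) => z _; exact: hK.
  by apply: ler_pM => //; rewrite ?mulr_ge0// ler_wpM2l.
have := mvt_norm_le (fun x _ => dG x) hG.
rewrite /G (_ : a + h - a = h); last by ring.
rewrite subrr mul0r expr0n /= mul0r mul0r !subr0.
have -> : K * `|h| * `|h| * `|h| = K * `|h| ^+ 3 by ring.
by congr (`| _ | <= _); ring.
Qed.

Let npdf_derive x : is_derive x 1 (@npdf R) (- (x * npdf x)).
Proof.
rewrite /npdf.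
by apply: is_derive_eq; rewrite /GRing.scale /=; field; rewrite gt_eqF// sqrtr_gt0 mulr_gt0// pi_gt0.
Qed.

Let exp_le1 (t : R) : 0 <= t -> t * expR (- t) <= 1.
Proof.
move=> t0; rewrite expRN ler_pdivrMr ?expR_gt0// mul1r.
by apply: le_trans (expR_ge1Dx t); rewrite lerDr.
Qed.

Let npdf_exp x : npdf x <= expR (- x ^+ 2 / 2).
Proof.
rewrite /npdf ler_piMl ?expR_ge0// invf_le1.
  rewrite -[leLHS]sqrtr1 ler_wsqrtr//; have := pi_ge2 R; lra.
by rewrite sqrtr_gt0 mulr_gt0// pi_gt0.
Qed.

Lemma npdf_le1 x : npdf x <= 1.
Proof.
apply: (le_trans (npdf_exp x)); rewrite -[leRHS]expR0 ler_expR mulNr oppr_le0.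
by rewrite divr_ge0// sqr_ge0.
Qed.

Lemma npdf_sqr_le x : x ^+ 2 * npdf x <= 2.
Proof.
have h := exp_le1 (_ : 0 <= x ^+ 2 / 2); have := h _; rewrite divr_ge0 ?sqr_ge0// => /(_ isT).
rewrite -mulNr => h1; apply: (@le_trans _ _ (x ^+ 2 * expR (- x ^+ 2 / 2))).
  by rewrite ler_wpM2l ?sqr_ge0// npdf_exp.
lra.
Qed.

Lemma npdf_expr4_le x : x ^+ 4 * npdf x <= 16.
Proof.
have h0 : 0 <= x ^+ 2 / 4 by rewrite divr_ge0 ?sqr_ge0.
have h := exp_le1 h0.
apply: (@le_trans _ _ (x ^+ 4 * expR (- x ^+ 2 / 2))).
  by rewrite ler_wpM2l ?npdf_exp// (_ : 4%N = (2 * 2)%N)// exprM sqr_ge0.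
have -> : x ^+ 4 * expR (- x ^+ 2 / 2) = 16 * (x ^+ 2 / 4 * expR (- (x ^+ 2 / 4))) ^+ 2.
  have -> : - x ^+ 2 / 2 = - (x ^+ 2 / 4) + - (x ^+ 2 / 4) by field.
  by rewrite expRD; field.
rewrite -[leRHS]mulr1 ler_wpM2l// expr_le1// mulr_ge0 ?expR_ge0//.
Qed.

(** Minus the derivative of [npdf]. Both sides of the heat equation for [Phi (x / sqrt s)] are
    [- gslope (x / sqrt s) / (2 s)]. *)
Definition gslope y : R := y * npdf y.

Let gslope_derive y : is_derive y 1 gslope ((1 - y ^+ 2) * npdf y).
Proof.
have h := npdf_derive y.
by rewrite /gslope; apply: is_derive_eq; rewrite /GRing.scale /=; ring.
Qed.

Lemma gslope_le y : `|gslope y| <= 2.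
Proof.
rewrite /gslope normrM (ger0_norm (npdf_ge0 y)).
have h1 := npdf_le1 y; have h2 := npdf_sqr_le y; have h0 := npdf_ge0 y.
have h3 : `|y| <= (1 + y ^+ 2) / 2.
  by rewrite -(real_normK (num_real y)); have := sqr_ge0 (`|y| - 1); nra.
have := ler_wpM2r h0 h3; lra.
Qed.

Let Phi_taylor y h : `|Phi (y + h) - Phi y - h * npdf y + h ^+ 2 / 2 * gslope y| <= 3 * `|h| ^+ 3.
Proof.
have := @taylor_order2 (@Phi R) (@npdf R) (fun x => - gslope x)
  (fun x => - ((1 - x ^+ 2) * npdf x)) y h 3.
rewrite mulrN opprK; apply => x.
- exact: Phi_derive.
- exact: npdf_derive.
- by apply: is_deriveN.
- rewrite normrN; have := npdf_ge0 x; have := npdf_le1 x; have := npdf_sqr_le x.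
  rewrite mulrBl mul1r => h1 h2 h3.
  have h4 : 0 <= x ^+ 2 * npdf x by apply: mulr_ge0 => //; exact: sqr_ge0.
  by apply: (le_trans (ler_normB _ _)); rewrite (ger0_norm h3) (ger0_norm h4); lra.
Qed.

Let sq_derive b s : 0 < s -> is_derive s 1 (fun s => b / Num.sqrt s) (- (b / Num.sqrt s / s / 2)).
Proof.
move=> s0; have q0 : 0 < Num.sqrt s by rewrite sqrtr_gt0.
have h := is_derive1_sqrt s0.
have h2 : is_derive s 1 (fun s => (Num.sqrt s)^-1) (- (Num.sqrt s) ^- 2 *: (2 * Num.sqrt s)^-1).
  by apply: is_deriveV => //; rewrite gt_eqF.
apply: is_derive_eq; rewrite /GRing.scale /=.
have -> : b / Num.sqrt s / s / 2 = b / Num.sqrt s / Num.sqrt s ^+ 2 / 2.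
  by rewrite sqr_sqrtr// ltW.
by field; rewrite gt_eqF.
Qed.

Let vt_derive b s : 0 < s ->
  is_derive s 1 (fun s => Phi (b / Num.sqrt s)) (- (gslope (b / Num.sqrt s) / s / 2)).
Proof.
move=> s0; have h := sq_derive b s0; have h1 := Phi_derive (b / Num.sqrt s).
have := @is_derive1_comp R (@Phi R) (fun s => b / Num.sqrt s) s _ _ h1 h.
by move=> h2; apply: (is_derive_eq h2); rewrite /gslope; ring.
Qed.

Let vt1_derive b s (y := b / Num.sqrt s) : 0 < s ->
  is_derive s 1 (fun s => - (gslope (b / Num.sqrt s) / s / 2))
    ((y / 2 * (1 - y ^+ 2) * npdf y + y * npdf y) / s ^+ 2 / 2).
Proof.
move=> s0; have h := sq_derive b s0; have h1 := gslope_derive (b / Num.sqrt s).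
have h2 := @is_derive1_comp R gslope (fun s => b / Num.sqrt s) s _ _ h1 h.
have hV : is_derive s 1 (fun s => s^-1) (- s ^- 2 *: 1).
  by apply: is_deriveV => //; rewrite gt_eqF.
have := @is_deriveM _ _ _ _ _ _ _ _ h2 hV.
move=> h3.
have h4 : is_derive s 1 (fun s => (- 2^-1) * ((gslope (b / Num.sqrt s)) * s^-1)) _ :=
  @is_deriveZ _ _ _ _ (- 2^-1) s 1 _ h3.
rewrite (_ : (fun s => - (gslope (b / Num.sqrt s) / s / 2)) =
  (fun s => (- 2^-1) * ((gslope (b / Num.sqrt s)) * s^-1))); last first.
  by apply/funext => t; rewrite mulNr [2^-1 * _]mulrC.
apply: (is_derive_eq h4); rewrite /GRing.scale /= /gslope -/y.
by field; rewrite gt_eqF.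
Qed.

Let vt2_le (e s y : R) : 0 < e -> e <= s ->
  `|(y / 2 * (1 - y ^+ 2) * npdf y + y * npdf y) / s ^+ 2 / 2| <= 20 / e ^+ 2.
Proof.
move=> e0 es; have s0 : 0 < s by exact: lt_le_trans es.
have h0 := npdf_ge0 y; have h1 := npdf_le1 y; have h2 := npdf_sqr_le y.
have h4 := npdf_expr4_le y.
have hb : `|y / 2 * (1 - y ^+ 2) * npdf y + y * npdf y| <= 20.
  have h5 : `|y| <= (1 + y ^+ 2) / 2.
    by rewrite -(real_normK (num_real y)); have := sqr_ge0 (`|y| - 1); nra.
  have h6 : `|y| ^+ 3 <= (y ^+ 2 + y ^+ 4) / 2.
    have -> : y ^+ 4 = `|y| ^+ 4 by rewrite -normrX ger0_norm// (_ : 4%N = (2 * 2)%N)// exprM sqr_ge0.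
    rewrite -(real_normK (num_real y)); have := sqr_ge0 (`|y| ^+ 2 - `|y|); nra.
  have -> : y / 2 * (1 - y ^+ 2) * npdf y + y * npdf y =
     (3 / 2 * y - y ^+ 3 / 2) * npdf y by field.
  rewrite normrM (ger0_norm h0).
  have h7 : `|3 / 2 * y - y ^+ 3 / 2| <= 3 / 2 * `|y| + `|y| ^+ 3 / 2.
    apply: (le_trans (ler_normB _ _)).
    rewrite (normrM (3 / 2)) (normrM (y ^+ 3)) normrX (ger0_norm (_ : 0 <= 3 / 2)) ?divr_ge0//.
    by rewrite (ger0_norm (_ : 0 <= 2^-1)) ?invr_ge0.
  have h8 : `|3 / 2 * y - y ^+ 3 / 2| <= 3 / 2 * ((1 + y ^+ 2) / 2) + (y ^+ 2 + y ^+ 4) / 2 / 2.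
    by lra.
  have := ler_wpM2r h0 h8; lra.
rewrite !normrM (ger0_norm (_ : 0 <= 2^-1)) ?invr_ge0//.
rewrite (ger0_norm (_ : 0 <= (s ^+ 2)^-1)) ?invr_ge0 ?sqr_ge0//.
have hs : (s ^+ 2)^-1 <= (e ^+ 2)^-1.
  by rewrite lef_pV2 ?posrE ?exprn_gt0// lerXn2r ?nnegrE ?(ltW e0) ?(ltW s0).
have hs0 : 0 <= (s ^+ 2)^-1 by rewrite invr_ge0 sqr_ge0.
have : `|y / 2 * (1 - y ^+ 2) * npdf y + y * npdf y| / s ^+ 2 <= 20 / e ^+ 2.
  by apply: ler_pM.
have : 0 <= `|y / 2 * (1 - y ^+ 2) * npdf y + y * npdf y| / s ^+ 2 by rewrite mulr_ge0.
lra.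
Qed.

Let Phi_time b s' s (e : R) : 0 < e -> e <= s' -> s' <= s ->
  `|Phi (b / Num.sqrt s) - Phi (b / Num.sqrt s') +
    (s - s') * (gslope (b / Num.sqrt s') / s' / 2)| <= 20 / e ^+ 2 * (s - s') ^+ 2.
Proof.
move=> e0 es ss; pose v1 t := - (gslope (b / Num.sqrt t) / t / 2).
have pos x : Num.min s' (s' + (s - s')) <= x <= Num.max s' (s' + (s - s')) ->
   e <= x /\ s' <= x <= s.
  by rewrite (_ : s' + (s - s') = s) ?min_l ?max_r//; [move=> /andP[h1 h2]; rewrite (le_trans es) ?h1 ?h2|ring].
pose f t := Phi (b / Num.sqrt t).
suff : `|f (s' + (s - s')) - f s' - (s - s') * v1 s'| <=
    20 / e ^+ 2 * (s - s') * `|s - s'|.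
  rewrite (_ : s' + (s - s') = s); last by ring.
  have -> : 20 / e ^+ 2 * (s - s') ^+ 2 = 20 / e ^+ 2 * (s - s') * `|s - s'|.
    by rewrite (ger0_norm (_ : 0 <= s - s')) ?subr_ge0//; ring.
  by rewrite /v1 mulrN opprK.
apply: taylor_order1 => x.
  move=> /pos[h1 _]; have x0 : 0 < x by exact: lt_le_trans h1.
  exact: (vt_derive b x0).
move=> /pos[h1 /andP[h2 h3]].
apply: (@le_trans _ _ (20 / e ^+ 2 * `|x - s'|)).
  apply: (@mvt_norm_le v1 (fun t => let y := b / Num.sqrt t in
     (y / 2 * (1 - y ^+ 2) * npdf y + y * npdf y) / t ^+ 2 / 2)) => t.
    rewrite (min_l h2) (max_r h2) => /andP[h4 _].
    have t0 : 0 < t by apply: (lt_le_trans e0); exact: le_trans h4.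
    exact: (vt1_derive b t0).
  rewrite (min_l h2) (max_r h2) => /andP[h4 _]; apply: (vt2_le _ e0).
  exact: le_trans h4.
rewrite (ger0_norm (_ : 0 <= x - s')) ?subr_ge0// ler_wpM2l//.
  by rewrite divr_ge0// sqr_ge0.
by rewrite lerB.
Qed.

(* [Phi (x / sqrt s)] solves the heat equation [u_s = u_xx / 2], so that a
   centred step of variance [s - s'] is compensated by the passage from time
   [s] to time [s'] up to third order terms. *)
Lemma heat_step (e : R) : 0 < e -> exists2 C, 0 <= C & forall s' s x h,
  e <= s' -> s' <= s ->
  `|Phi ((x + h) / Num.sqrt s') - Phi (x / Num.sqrt s)
    - h * (npdf (x / Num.sqrt s') / Num.sqrt s')
    + (h ^+ 2 - (s - s')) * (gslope (x / Num.sqrt s') / s' / 2)| <=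
  C * (`|h| ^+ 3 + (s - s') ^+ 2).
Proof.
move=> e0; have q0 : 0 < Num.sqrt e by rewrite sqrtr_gt0.
pose C := 20 / e ^+ 2 + 3 / Num.sqrt e ^+ 3.
have c1 : 0 <= 20 / e ^+ 2 by rewrite divr_ge0// sqr_ge0.
have c2 : 0 <= 3 / Num.sqrt e ^+ 3 by rewrite divr_ge0// exprn_ge0// ltW.
exists C => [|s' s x h es ss]; first exact: addr_ge0.
have s'0 : 0 < s' by exact: lt_le_trans es.
set r := Num.sqrt s'; have r0 : 0 < r by rewrite sqrtr_gt0.
have er : Num.sqrt e <= r by rewrite ler_wsqrtr.
have h1 := Phi_taylor (x / r) (h / r).
have h2 := Phi_time x e0 es ss.
rewrite -/r in h2.
have rr : s' = r ^+ 2 by rewrite sqr_sqrtr// ltW.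
have -> : Phi ((x + h) / r) - Phi (x / Num.sqrt s) - h * (npdf (x / r) / r)
    + (h ^+ 2 - (s - s')) * (gslope (x / r) / s' / 2) =
  (Phi (x / r + h / r) - Phi (x / r) - h / r * npdf (x / r) +
     (h / r) ^+ 2 / 2 * gslope (x / r)) -
  (Phi (x / Num.sqrt s) - Phi (x / r) + (s - s') * (gslope (x / r) / s' / 2)).
  rewrite (mulrDl x h) rr; field; rewrite gt_eqF//.
apply: (le_trans (ler_normB _ _)).  apply: (le_trans (lerD h1 h2)); rewrite /C.
have h3 : 3 * `|h / r| ^+ 3 <= 3 / Num.sqrt e ^+ 3 * `|h| ^+ 3.
  rewrite normrM (ger0_norm (_ : 0 <= r^-1)) ?invr_ge0 ?(ltW r0)// exprMn.
  rewrite -mulrA ler_wpM2l// mulrC ler_wpM2r ?exprn_ge0//.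
  by rewrite -exprVn lerXn2r ?nnegrE ?invr_ge0 ?(ltW r0) ?(ltW q0)// lef_pV2 ?posrE.
have h5 : 0 <= 20 / e ^+ 2 * `|h| ^+ 3 by rewrite mulr_ge0// exprn_ge0.
have h6 : 0 <= 3 / Num.sqrt e ^+ 3 * (s - s') ^+ 2 by rewrite mulr_ge0// sqr_ge0.
have aux (p q u v w : R) : 3 * w <= q * u -> 0 <= p * u -> 0 <= q * v ->
    3 * w + p * v <= (p + q) * (u + v) by lra.
exact: (aux _ _ _ _ _ h3 h5 h6).
Qed.

End HeatKernel.

(** * Lindeberg replacement along the chain *)

Section Lindeberg.
Variables (R : realType) (m : nat).
Hypothesis hm : (0 < m)%N.
Local Notation tt := (tt m).
Local Notation reach := (reach m).

(** [s k] is the variance of the Gaussian noise still to be added to [Y k]: each step of the chain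
    trades the variance [s k - s k.+1] of noise for one increment [X k]. The floor [e] keeps the
    kernel smooth, and [C] depends on [e] alone, so that the bound applies to triangular arrays. *)
Lemma lindeberg (e : R) : 0 < e -> exists2 C : R, 0 <= C &
  forall (dl : nat -> R) (K : nat) (Y : nat -> mgraph -> R)
    (X : nat -> mgraph -> nat -> R) (s : nat -> R) (B : R),
  (forall t, - m%:R < dl t) ->
  (forall k g v, (k < K)%N -> reach k g -> (v < tt k)%N ->
     Y k.+1 ((v, tt k) :: g) = Y k g + X k g v) ->
  (forall k g, (k < K)%N -> reach k g -> cond m dl k g (X k g) = 0) ->
  (forall k g v, (k < K)%N -> reach k g -> (v < tt k)%N -> `|X k g v| <= B) ->
  (forall k, (k <= K)%N -> e <= s k) ->
  (forall k, (k < K)%N -> s k.+1 <= s k) ->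
  `|Ex (flaw m dl K) (fun g => Phi (Y K g / Num.sqrt (s K))) -
    Ex (flaw m dl 0) (fun g => Phi (Y 0%N g / Num.sqrt (s 0%N)))| <=
  C * \sum_(0 <= k < K)
    (Ex (flaw m dl k) (fun g => `|cond m dl k g (fun v => X k g v ^+ 2) - (s k - s k.+1)|)
     + B ^+ 3 + (s k - s k.+1) ^+ 2).
Proof.
move=> e0; have [C1 C10 hC] := heat_step e0.
have C0 : 0 <= C1 + e^-1 by rewrite addr_ge0// invr_ge0 ltW.
exists (C1 + e^-1) => // dl K Y X s B hdl.
elim: K => [|K IH] hY hX hB hs hd; first by rewrite big_geq// mulr0 subrr normr0.
have {}IH := IH (fun k g v kK => hY k g v (ltnW kK)) (fun k g kK => hX k g (ltnW kK))
  (fun k g v kK => hB k g v (ltnW kK)) (fun k kK => hs k (leqW kK))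
  (fun k kK => hd k (ltnW kK)).
rewrite big_nat_recr//= mulrDr -(subrKA (Ex (flaw m dl K) (fun g => Phi (Y K g / Num.sqrt (s K))))).
rewrite (le_trans (ler_normD _ _))// addrC lerD//.
rewrite Ex_flawS -ExB (le_trans (ler_norm_Ex hm hdl _ _))//.
set D := s K - s K.+1.
have -> : (C1 + e^-1) * (Ex (flaw m dl K) (fun g =>
    `|cond m dl K g (fun v => X K g v ^+ 2) - D|) + B ^+ 3 + D ^+ 2) =
  Ex (flaw m dl K) (fun g => (C1 + e^-1) * (`|cond m dl K g (fun v => X K g v ^+ 2) - D| +
     B ^+ 3 + D ^+ 2)).
  by rewrite ExZ !ExD !Ex_cst.
apply: (ler_Ex hm hdl) => g hg.
set x := Y K g; set s' := s K.+1; set s0 := s K.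
have es' : e <= s' by exact: hs.
have s's : s' <= s0 by exact: hd.
have s'0 : 0 < s' by exact: lt_le_trans es'.
pose A := npdf (x / Num.sqrt s') / Num.sqrt s'.
pose G := gslope (x / Num.sqrt s') / s' / 2.
pose err v := Phi ((x + X K g v) / Num.sqrt s') - Phi (x / Num.sqrt s0) - X K g v * A +
   (X K g v ^+ 2 - D) * G.
have hG : `|G| <= e^-1.
  rewrite /G normrM (ger0_norm (_ : 0 <= 2^-1)) ?invr_ge0// normrM.
  rewrite (ger0_norm (_ : 0 <= s'^-1)) ?invr_ge0 ?(ltW s'0)//.
  have h1 := gslope_le (x / Num.sqrt s').
  have h2 : s'^-1 <= e^-1 by rewrite lef_pV2 ?posrE.
  have h3 : 0 <= s'^-1 by rewrite invr_ge0 ltW.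
  have := ler_pM (normr_ge0 _) h3 h1 h2; lra.
(* The first-order term vanishes because [X] is centred; the second-order one survives only through
   the gap between the conditional variance and [D]. *)
have -> : cond m dl K g (fun v => Phi (Y K.+1 ((v, tt K) :: g) / Num.sqrt s')) -
    Phi (x / Num.sqrt s0) =
  cond m dl K g err - G * (cond m dl K g (fun v => X K g v ^+ 2) - D).
  rewrite (@eq_cond _ _ hm _ hdl _ _ _ (fun v => (err v + A * X K g v - G * (X K g v ^+ 2)) +
     (Phi (x / Num.sqrt s0) + G * D)) hg); last first.
    by move=> v vt; rewrite hY// /err; ring.
  rewrite condD cond_cst// condB condD !condZ hX//; ring.
apply: (le_trans (ler_normB _ _)).
have h1 : `|cond m dl K g err| <= C1 * (B ^+ 3 + D ^+ 2).
  apply: (le_trans (ler_norm_cond hm hdl _ hg)).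
  rewrite -[leRHS](cond_cst hm hdl _ hg); apply: (ler_cond hm hdl hg) => v vt.
  apply: (le_trans (hC s' s0 x (X K g v) es' s's)).
  by rewrite ler_wpM2l// lerD2r lerXn2r ?nnegrE ?(le_trans _ (hB _ _ _ _ hg vt))// hB.
have h2 : `|G * (cond m dl K g (fun v => X K g v ^+ 2) - D)| <=
   e^-1 * `|cond m dl K g (fun v => X K g v ^+ 2) - D|.
  by rewrite normrM ler_wpM2r.
have B0 : 0 <= B ^+ 3.
  have vt : (0 < tt K)%N by [].
  by rewrite exprn_ge0// (le_trans _ (hB _ _ _ _ hg vt)).
have D0 : 0 <= D ^+ 2 by exact: sqr_ge0.
have ei0 : 0 <= e^-1 by rewrite invr_ge0 ltW.
move: h1 h2 B0 D0; move: (`|_ - D|) (normr_ge0 (cond m dl K g (fun v => X K g v ^+ 2) - D)).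
move=> p p0 h1 h2 B0 D0; apply: (le_trans (lerD h1 h2)).
have q1 : 0 <= C1 * p by rewrite mulr_ge0.
have q2 : 0 <= e^-1 * (B ^+ 3 + D ^+ 2) by rewrite mulr_ge0// addr_ge0.
have -> : (C1 + e^-1) * (p + B ^+ 3 + D ^+ 2) =
  C1 * (B ^+ 3 + D ^+ 2) + e^-1 * p + (C1 * p + e^-1 * (B ^+ 3 + D ^+ 2)) by ring.
by rewrite lerDl addr_ge0.
Qed.

End Lindeberg.

(** * Central limit theorem *)

Section Averages.
Variable R : realType.

(** For an arbitrary filter, as it serves both for sequences and for convergence in probability
    along [whp]. *)
Lemma squeeze_norm0 (T : Type) (F : set_system T) {FF : Filter F} (f h : T -> R) :
  h @ F --> (0 : R) -> (\forall x \near F, `|f x| <= h x) -> f @ F --> (0 : R).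
Proof.
move=> /cvgrPdist_le hh hf; apply/cvgrPdist_le => e e0.
move: (hh e e0) hf; apply: filterS2 => x; rewrite !sub0r !normrN => h1 h2.
by rewrite (le_trans h2)// (le_trans (ler_norm _)).
Qed.

Implicit Types (u b c x : nat -> R).

Lemma cvg_ext (T : Type) (F : set_system T) (f h : T -> R) (l : R) :
  f @ F --> l -> f =1 h -> h @ F --> l.
Proof. by move=> hf /funext <-. Qed.

Lemma cesaro_sum u (l : R) : u @ \oo --> l ->
  (fun K => (\sum_(0 <= i < K) u i) / K%:R) @ \oo --> l.
Proof.
move=> /cesaro h; rewrite -cvg_shiftS; apply: cvg_trans h.
apply: near_eq_cvg; apply: nearW => n.
by rewrite /arithmetic_mean /series /= mulrC.
Qed.

Lemma cvg_bigO_harmonic (C : R) u :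
  (forall k, `|u k| <= C / (k%:R + 1)) -> u @ \oo --> (0 : R).
Proof.
move=> h; apply: (@squeeze_norm0 _ _ _ u (fun k => C * (k.+1%:R)^-1)); last first.
  by apply: nearW => k; rewrite (le_trans (h k))// natr1.
rewrite -(mulr0 C); apply: cvgM; first exact: cvg_cst.
exact: cvg_harmonic.
Qed.

Lemma cvg_inv_sqrtn : (fun k : nat => (Num.sqrt (k%:R : R))^-1) @ \oo --> (0 : R).
Proof.
have h : (fun k : nat => (k%:R : R)^-1) @ \oo --> (0 : R).
  by rewrite -cvg_shiftS; exact: cvg_harmonic.
have := cvg_comp _ _ h (@sqrt_continuous R 0); rewrite sqrtr0.
by apply: cvg_trans; apply: near_eq_cvg; apply: nearW => k /=; rewrite sqrtrV.
Qed.

(** The line [k * lam], with [l - lam - beta * lam = 0], solves the recursion up to a vanishing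
    forcing [e]. The difference [y] is never expanded since [0 <= b k <= 1], so it is at most
    [|y 0|] plus the sum of the [|e i|], which is [o(K)] by Cesaro. *)
Lemma linear_recursion_mean b c x (beta l : R) :
  (forall k, x k.+1 = (1 - b k) * x k + c k) ->
  (forall k, 0 <= b k <= 1) -> 0 <= beta ->
  (fun k => k%:R * b k) @ \oo --> beta -> c @ \oo --> l ->
  (fun k => x k / k%:R) @ \oo --> l / (1 + beta).
Proof.
move=> hx hb beta0 hbeta hc; set lam := l / (1 + beta).
pose y k := x k - k%:R * lam.
pose e k := c k - lam - k%:R * b k * lam.
have he : e @ \oo --> (0 : R).
  have -> : 0 = l - lam - beta * lam.
    by rewrite /lam; field; rewrite gt_eqF// ltr_pwDl.
  apply: cvgB; last by apply: cvgM => //; exact: cvg_cst.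
  by apply: cvgB => //; exact: cvg_cst.
have hy k : `|y k.+1| <= `|y k| + `|e k|.
  have -> : y k.+1 = (1 - b k) * y k + e k by rewrite /y /e hx -natr1; ring.
  rewrite (le_trans (ler_normD _ _))// lerD2r normrM ler_piMl// ger0_norm.
    by have /andP[h1 h2] := hb k; lra.
  by have /andP[h1 h2] := hb k; lra.
have hyK K : `|y K| <= `|y 0%N| + \sum_(0 <= i < K) `|e i|.
  elim: K => [|K IH]; first by rewrite big_geq// addr0.
  by rewrite big_nat_recr//= addrA (le_trans (hy K))// lerD2r.
have h0 : (fun K => `|y 0%N| / K%:R + (\sum_(0 <= i < K) `|e i|) / K%:R) @ \oo --> (0 : R).
  rewrite -[X in _ --> X]addr0; apply: cvgD; last first.
    by apply: cesaro_sum; rewrite -(normr0 R); exact: cvg_norm.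
  rewrite -(mulr0 `|y 0%N|); apply: cvgM; first exact: cvg_cst.
  by rewrite -cvg_shiftS; exact: cvg_harmonic.
have h1 : (fun K => y K / K%:R) @ \oo --> (0 : R).
  apply: (squeeze_norm0 h0); apply: nearW => K.
  by rewrite normrM (ger0_norm (_ : 0 <= K%:R^-1)) ?invr_ge0// -mulrDl ler_wpM2r// invr_ge0.
have := cvgD h1 (cvg_cst lam); rewrite add0r => h2.
rewrite -cvg_shiftS in h2; rewrite -cvg_shiftS.
suff -> : [sequence x n.+1 / n.+1%:R]_n = [sequence y n.+1 / n.+1%:R + lam]_n by exact: h2.
apply/funext => K; rewrite /= /y mulrBl mulrAC divff ?pnatr_eq0// mul1r; ring.
Qed.

End Averages.

(** * Laws of large numbers in [L^1] under a constant parameter *)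

Section L1Convergence.
Variables (R : realType) (m : nat).
Hypothesis hm : (0 < m)%N.
Variable d : R.
Hypothesis hd : - m%:R < d.
Local Notation mR := (m%:R : R).
Local Notation tt := (tt m).
Local Notation reach := (reach m).
Let dl : nat -> R := fun=> d.
Let hdl t : - mR < dl t. Proof. exact: hd. Qed.
Local Notation E k := (Ex (flaw m (fun=> d) k)).
Implicit Types (X Y : nat -> mgraph -> R) (l : R).

Definition L1cvg X l := (fun k => E k (fun g => `|X k g - l|)) @ \oo --> (0 : R).

Lemma L1cvg_le X l (u : nat -> R) :
  (forall k, E k (fun g => `|X k g - l|) <= u k) -> u @ \oo --> (0 : R) -> L1cvg X l.
Proof.
move=> h hu; apply: (squeeze_norm0 hu); apply: nearW => k.
rewrite ger0_norm//; apply: (Ex_ge0 hm hdl) => g _; exact: normr_ge0.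
Qed.

Lemma L1cvg_Ex X l : L1cvg X l -> (fun k => E k (X k)) @ \oo --> l.
Proof.
move=> h; apply/subr_cvg0.
apply: (squeeze_norm0 h); apply: nearW => k.
rewrite -[X in `|_ - X|](Ex_cst hm hdl k l) -ExB.
exact: (ler_norm_Ex hm hdl).
Qed.

Lemma L1cvg_det (u : nat -> R) l : u @ \oo --> l -> L1cvg (fun k _ => u k) l.
Proof.
move=> hu; have h : (fun k => `|u k - l|) @ \oo --> (0 : R).
  rewrite -(normr0 R) -(subrr l); apply: cvg_norm; apply: cvgB => //; exact: cvg_cst.
by apply: (L1cvg_le _ h) => k; rewrite (Ex_cst hm hdl).
Qed.

Lemma L1cvgD X Y l l' : L1cvg X l -> L1cvg Y l' ->
  L1cvg (fun k g => X k g + Y k g) (l + l').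
Proof.
move=> hX hY.
have h : (fun k => E k (fun g => `|X k g - l|) + E k (fun g => `|Y k g - l'|))
    @ \oo --> (0 : R).
  by rewrite -[X in _ --> X](addr0 0); exact: cvgD.
apply: (L1cvg_le _ h) => k; rewrite -ExD; apply: (ler_Ex hm hdl) => g _.
by rewrite opprD addrACA ler_normD.
Qed.

Lemma L1cvgM X Y l l' (B : R) : (forall k g, reach k g -> `|X k g| <= B) ->
  L1cvg X l -> L1cvg Y l' -> L1cvg (fun k g => X k g * Y k g) (l * l').
Proof.
move=> hB hX hY.
have h : (fun k => B * E k (fun g => `|Y k g - l'|) + `|l'| * E k (fun g => `|X k g - l|))
    @ \oo --> (0 : R).
  rewrite -[X in _ --> X](addr0 0); apply: cvgD.
    by rewrite -(mulr0 B); apply: cvgM => //; exact: cvg_cst.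
  by rewrite -(mulr0 `|l'|); apply: cvgM => //; exact: cvg_cst.
apply: (L1cvg_le _ h) => k; rewrite -!ExZ -ExD; apply: (ler_Ex hm hdl) => g hg.
have -> : X k g * Y k g - l * l' = X k g * (Y k g - l') + l' * (X k g - l) by ring.
rewrite (le_trans (ler_normD _ _))// !normrM lerD2r ler_wpM2r//; exact: hB.
Qed.

Lemma L1cvgZ c X l : L1cvg X l -> L1cvg (fun k g => c * X k g) (c * l).
Proof.
move=> hX; apply: (@L1cvgM (fun _ _ => c) X c l `|c|) => //.
by apply: L1cvg_det; exact: cvg_cst.
Qed.

Lemma L1cvgB X Y l l' : L1cvg X l -> L1cvg Y l' ->
  L1cvg (fun k g => X k g - Y k g) (l - l').
Proof.
move=> hX /(L1cvgZ (- 1)) hY; rewrite -mulN1r.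
have := L1cvgD hX hY; congr (L1cvg _ _).
by apply/funext => k; apply/funext => g; rewrite mulN1r.
Qed.

Let md0 : 0 < mR + d. Proof. by have := hd; lra. Qed.
Let m0 : 0 < mR := natm_gt0 R hm.
Ltac facts := have ? := m0; have ? := md0.

Lemma tt_Stot_le : exists2 C : R, 0 <= C & forall k,
  `|(tt k)%:R / Stot m k d - (2 * mR + d)^-1| <= C / (k%:R + 1).
Proof.
facts; pose s0 := (mR + d) / (1 + mR + d).
have s00 : 0 < s0 by rewrite divr_gt0//; lra.
have h2 : 0 < 2 * mR + d by lra.
exists (2 * mR / (2 * mR + d) / s0) => [|k].
  by rewrite divr_ge0 ?(ltW s00)// divr_ge0 ?(ltW h2)// mulr_ge0// ltW.
have S0 := Stot_gt0 k hd.
have Slb : s0 * (k%:R + 1) <= Stot m k d by exact: Stot_lb.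
have k1 : 0 < k%:R + 1 :> R by rewrite ltr_wpDl.
have -> : (tt k)%:R / Stot m k d - (2 * mR + d)^-1 =
    mR * tfrac R m k / (2 * mR + d) * (Stot m k d)^-1.
  have -> : mR * tfrac R m k = (2 * mR + d) * (tt k)%:R - Stot m k d.
    by rewrite /tfrac /Stot; field; rewrite gt_eqF.
  by field; rewrite !gt_eqF.
have /andP[u1 u2] := tfrac_bounds R hm k.
rewrite ger0_norm; last first.
  by rewrite mulr_ge0 ?invr_ge0 ?(ltW S0)// divr_ge0 ?(ltW h2)// mulr_ge0 ?(ltW m0)//; lra.
have -> : 2 * mR / (2 * mR + d) / s0 / (k%:R + 1) =
  2 * mR / (2 * mR + d) * (s0 * (k%:R + 1))^-1 by field; rewrite !gt_eqF.
apply: ler_pM.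
- by rewrite divr_ge0 ?(ltW h2)// mulr_ge0 ?(ltW m0)//; lra.
- by rewrite invr_ge0 ltW.
- by rewrite ler_wpM2r ?invr_ge0 ?(ltW h2)// mulrC ler_wpM2r// ltW.
- by rewrite lef_pV2 ?posrE// mulr_gt0.
Qed.

Lemma cvg_tt_Stot : (fun k => (tt k)%:R / Stot m k d) @ \oo --> (2 * mR + d)^-1.
Proof.
have [C C0 hC] := tt_Stot_le; apply/subr_cvg0.
exact: cvg_bigO_harmonic hC.
Qed.

Lemma cvg_k_Stot : (fun k => k%:R / Stot m k d) @ \oo --> mR / (2 * mR + d).
Proof.
facts; have h2 : 2 * mR + d != 0 by rewrite gt_eqF//; lra.
have -> : mR / (2 * mR + d) = 1 - (mR + d) * (2 * mR + d)^-1 by field.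
have -> : (fun k => k%:R / Stot m k d) = (fun k => 1 - (mR + d) * ((tt k)%:R / Stot m k d)).
  apply/funext => k; have S0 : Stot m k d != 0 by rewrite gt_eqF// Stot_gt0.
  apply: (mulIf S0); rewrite divfK// mulrBl mul1r -!mulrA mulVf// /Stot; ring.
apply: cvgB; first exact: cvg_cst.
by apply: cvgM; [exact: cvg_cst|exact: cvg_tt_Stot].
Qed.

(** [dsum_le] with no late step. The sum is taken per unit of [Stot] because conditional means have
    this form by [condE]. *)
Lemma L1cvg_dsum (f : nat -> R) (F : R) :
  f r @[r --> \oo] --> 0 ->
  (\sum_(m <= r < K) plim m d r * f r) @[K --> \oo] --> F ->
  L1cvg (fun k g => dsum f (tt k) g / Stot m k d) (F / (2 * mR + d)).
Proof.
move=> f0 hF.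
pose X k g : R := (dsum f (tt k) g - (tt k)%:R * F) / Stot m k d.
have h1 : L1cvg X 0.
  facts; pose s0 := (mR + d) / (1 + mR + d).
  have s00 : 0 < s0 by rewrite divr_gt0//; lra.
  apply/cvgrPdist_le => eps e0.
  have e1 : 0 < eps * s0 / 2 by rewrite divr_gt0// mulr_gt0.
  have [C C0 hC] := dsum_le hm hd f0 hF e1.
  have hlim : (fun k : nat => C / s0 * (Num.sqrt (k.+1%:R : R))^-1) @ \oo --> (0 : R).
    rewrite -(mulr0 (C / s0)); apply: cvgM; first exact: cvg_cst.
    by have := @cvg_inv_sqrtn R; rewrite -cvg_shiftS.
  have e2 : 0 < eps / 2 by rewrite divr_gt0.
  have /cvgrPdist_le/(_ _ e2) := hlim; apply: filterS => k hk.
  rewrite sub0r normrN ger0_norm; last first.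
    by apply: (Ex_ge0 hm hdl) => g _; exact: normr_ge0.
  have S0 := Stot_gt0 k hd.
  have k1 : 0 < k%:R + 1 :> R by rewrite ltr_wpDl.
  have Slb : s0 * (k%:R + 1) <= Stot m k d by exact: Stot_lb.
  apply: (@le_trans _ _ (E k (fun g => (s0 * (k%:R + 1))^-1 *
      `|dsum f (tt k) g - (tt k)%:R * F|))).
    apply: (ler_Ex hm hdl) => g _; rewrite subr0 /X normrM mulrC ler_wpM2r//.
    rewrite ger0_norm ?invr_ge0 ?(ltW S0)// lef_pV2 ?posrE// mulr_gt0//.
  rewrite ExZ.
  have := hC dl k hdl (fun _ _ => erefl) k; rewrite subnn mulr0 addr0 => h.
  have i0 : 0 <= (s0 * (k%:R + 1))^-1 by rewrite invr_ge0 mulr_ge0 ?(ltW s00) ?(ltW k1).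
  apply: (le_trans (ler_wpM2l i0 h)).
  move: hk; rewrite sub0r normrN => hk.
  have hk' := le_trans (ler_norm _) hk.
  have q0 : 0 < Num.sqrt (k%:R + 1) :> R by rewrite sqrtr_gt0.
  have -> : (s0 * (k%:R + 1))^-1 * (eps * s0 / 2 * (k%:R + 1) + C * Num.sqrt (k%:R + 1)) =
    eps / 2 + C / s0 * (Num.sqrt (k%:R + 1))^-1.
    rewrite -{1 2}(sqr_sqrtr (ltW k1)); field; rewrite !gt_eqF//.
  by rewrite natr1; lra.
have ht : (fun k => F * ((tt k)%:R / Stot m k d)) @ \oo --> F / (2 * mR + d).
  by apply: cvgM; [exact: cvg_cst|exact: cvg_tt_Stot].
have := L1cvgD h1 (L1cvg_det ht); rewrite add0r.
suff -> : (fun k g => X k g + F * ((tt k)%:R / Stot m k d)) =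
   (fun k g => dsum f (tt k) g / Stot m k d) by [].
by apply/funext => k; apply/funext => g; rewrite /X mulrBl; ring.
Qed.

End L1Convergence.

(** * Limit covariances and the linear recursion for [Z] *)

Section CLT.
Variables (R : realType) (m : nat).
Hypothesis hm : (0 < m)%N.
Variable d : R.
Hypothesis hd : - m%:R < d.
Local Notation mR := (m%:R : R).
Local Notation tt := (tt m).
Local Notation reach := (reach m).
Local Notation dl := (fun _ : nat => d).
Let hdl (t : nat) : - mR < d. Proof. exact: hd. Qed.
Local Notation E k := (Ex (flaw m dl k)).
Local Notation cond := (cond m dl).
Local Notation L1 := (L1cvg m d).

Let md0 : 0 < mR + d. Proof. by have := hd; lra. Qed.
Let m0 : 0 < mR := natm_gt0 R hm.
Let m1 : 1 <= mR. Proof. by rewrite ler1n. Qed.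
Let md2 : 0 < 2 * mR + d. Proof. by have := m0; have := md0; lra. Qed.
Ltac facts := have ? := m0; have ? := m1; have ? := md0; have ? := md2.

Definition is_m (r : nat) : R := (r == m)%:R.
Definition invd (r : nat) : R := (r%:R + d)^-1.

Lemma invd_bounds r : (m <= r)%N -> 0 <= invd r <= (mR + d)^-1.
Proof.
move=> mr; have h := natd_gt0 hm hd mr.
rewrite invr_ge0 (ltW h) /= lef_pV2 ?posrE ?md0// lerD2r ler_nat//.
Qed.

Lemma cvg_invd : invd @ \oo --> (0 : R).
Proof.
facts; pose C := 1 + (mR + 1) / (mR + d).
apply: (@squeeze_norm0 _ _ _ _ _ (fun r => C * (r.+1%:R)^-1)).
  rewrite -(mulr0 C); apply: cvgM; first exact: cvg_cst.
  exact: cvg_harmonic.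
exists m => // r /= mr; have h := natd_gt0 hm hd mr.
rewrite /invd ger0_norm ?invr_ge0 ?(ltW h)// -[leLHS]mul1r ler_pdivrMr//.
rewrite mulrAC ler_pdivlMr// mul1r /C mulrDl mul1r -natr1.
have mr' : mR <= r%:R by rewrite ler_nat.
have -> : (mR + 1) / (mR + d) * (r%:R + d) = mR + 1 + (mR + 1) / (mR + d) * (r%:R - mR).
  by field; rewrite gt_eqF.
have : 0 <= (mR + 1) / (mR + d) * (r%:R - mR).
  by rewrite mulr_ge0 ?subr_ge0// divr_ge0 ?(ltW md0)//; lra.
lra.
Qed.

Lemma plim_invd_cvg : cvgn (fun K => \sum_(m <= r < K) plim m d r * invd r).
Proof.
have pos r : (m <= r)%N -> 0 <= plim m d r * invd r.
  by move=> mr; rewrite mulr_ge0 ?plim_ge0//; case/andP: (invd_bounds mr).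
apply: nondecreasing_is_cvgn.
  apply/nondecreasing_seqP => n; have [mn|nm] := leqP m n.
    by rewrite big_nat_recr//= lerDl pos.
  by rewrite !big_geq// ltnW.
exists (mR + d)^-1 => _ [K _ <-].
apply: (@le_trans _ _ (\sum_(m <= r < K) plim m d r * (mR + d)^-1)).
  rewrite big_nat [leRHS]big_nat; apply: ler_sum => r /andP[mr _].
  by rewrite ler_wpM2l ?plim_ge0//; case/andP: (invd_bounds mr).
rewrite -mulr_suml -[leRHS]mul1r ler_wpM2r ?invr_ge0 ?(ltW md0)//.
exact: sum_plim_le1.
Qed.

(* [Vxx], [Vxy], [Vyy] are the limits of the conditional covariances of [1{D = m}]
   and [1 / (D + d)], where [D] is the degree of the vertex that receives an edge. *)
Definition Hlim : R := limn (fun K => \sum_(m <= r < K) plim m d r * invd r).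

(** The limiting probability that an edge falls on a vertex of degree [m]. *)
Definition qlim : R := (mR + d) * plim m d m / (2 * mR + d).
Definition Vxx : R := qlim - qlim * qlim.
Definition Vxy : R := plim m d m / (2 * mR + d) - qlim * (2 * mR + d)^-1.
Definition Vyy : R := Hlim / (2 * mR + d) - (2 * mR + d)^-1 * (2 * mR + d)^-1.

Lemma eq_L1 (X Y : nat -> mgraph -> R) l :
  (forall k g, reach k g -> X k g = Y k g) -> L1 X l -> L1 Y l.
Proof.
move=> h; apply: cvg_trans; apply: near_eq_cvg; apply: nearW => k.
by apply: (eq_Ex hm hdl) => g hg; rewrite h.
Qed.

Lemma L1_Nr : L1 (fun k g => Nr R m m k g / Stot m k d) (plim m d m / (2 * mR + d)).
Proof.
apply: (L1cvg_dsum hm hd).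
  apply: (@squeeze_norm0 _ _ _ _ _ (fun=> 0)); first exact: cvg_cst.
  by exists m.+1 => // r /= mr; rewrite gtn_eqF// normr0.
apply: cvg_trans (_ : (fun _ : nat => plim m d m) @ \oo `=>` _); last exact: cvg_cst.
apply: near_eq_cvg; exists m.+1 => // K /= mK.
rewrite (bigD1_seq m) ?iota_uniq ?mem_index_iota ?leqnn ?mK//= eqxx mulr1.
by rewrite big1 ?addr0// => r /negbTE ->; rewrite mulr0.
Qed.

Lemma L1_h : L1 (fun k g => dsum invd (tt k) g / Stot m k d) (Hlim / (2 * mR + d)).
Proof. by apply: (L1cvg_dsum hm hd); [exact: cvg_invd|exact: plim_invd_cvg]. Qed.

Lemma cond_is_m k g : reach k g ->
  cond k g (fun v => is_m (deg g v)) = (mR + d) * (Nr R m m k g / Stot m k d).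
Proof.
move=> hg; rewrite (condE hm dl is_m hg) mulrA; congr (_ / _).
rewrite /Nr -dsumZ; apply: eq_bigr => v _.
by rewrite /is_m; case: eqP => [->|]; rewrite ?mulr0.
Qed.

Lemma cond_is_m_invd k g : reach k g ->
  cond k g (fun v => is_m (deg g v) * invd (deg g v)) = Nr R m m k g / Stot m k d.
Proof.
move=> hg; rewrite (condE hm dl (fun r => is_m r * invd r) hg); congr (_ / _).
apply: (eq_dsum hm hg) => r mr; have h := natd_gt0 hm hd mr.
by rewrite mulrCA /invd mulfV ?mulr1 ?(gt_eqF h).
Qed.

Lemma cond_invd k g : reach k g ->
  cond k g (fun v => invd (deg g v)) = (tt k)%:R / Stot m k d.
Proof.
move=> hg; rewrite (condE hm dl invd hg); congr (_ / _).
rewrite -[RHS]mulr1 -(dsum_cst _ _ g); apply: (eq_dsum hm hg) => r mr.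
by have h := natd_gt0 hm hd mr; rewrite /invd divff ?gt_eqF.
Qed.

Lemma cond_invd2 k g : reach k g ->
  cond k g (fun v => invd (deg g v) * invd (deg g v)) = dsum invd (tt k) g / Stot m k d.
Proof.
move=> hg; rewrite (condE hm dl (fun r => invd r * invd r) hg); congr (_ / _).
apply: (eq_dsum hm hg) => r mr; have h := natd_gt0 hm hd mr.
by rewrite mulrA /invd divff ?gt_eqF// mul1r.
Qed.

Lemma cond_is_m_bound k g : reach k g -> `|cond k g (fun v => is_m (deg g v))| <= 1.
Proof.
move=> hg; apply: (le_trans (ler_norm_cond hm hdl _ hg)).
rewrite -[leRHS](cond_cst hm hdl _ hg); apply: (ler_cond hm hdl hg) => v _.
by rewrite /is_m; case: eqP => _; rewrite ?normr1 ?normr0.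
Qed.

Lemma cond_invd_bound k g : reach k g ->
  `|cond k g (fun v => invd (deg g v))| <= (mR + d)^-1.
Proof.
move=> hg; apply: (le_trans (ler_norm_cond hm hdl _ hg)).
rewrite -[leRHS](cond_cst hm hdl _ hg); apply: (ler_cond hm hdl hg) => v vt.
by have /andP[h1 h2] := invd_bounds (reach_deg hm hg vt); rewrite ger0_norm.
Qed.

Let L1_is_m : L1 (fun k g => cond k g (fun v => is_m (deg g v))) qlim.
Proof.
apply: (@eq_L1 (fun k g => (mR + d) * (Nr R m m k g / Stot m k d))) => [k g hg|].
  by rewrite cond_is_m.
by rewrite /qlim -mulrA; apply: (L1cvgZ hm hd); exact: L1_Nr.
Qed.

Let L1_invd : L1 (fun k g => cond k g (fun v => invd (deg g v))) (2 * mR + d)^-1.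
Proof.
apply: (@eq_L1 (fun k g => (tt k)%:R / Stot m k d)) => [k g hg|].
  by rewrite cond_invd.
by apply: (L1cvg_det hm hd); exact: cvg_tt_Stot.
Qed.

Local Notation xi := (cen m dl is_m).
Local Notation eta := (cen m dl invd).

Lemma L1_xx : L1 (fun k g => cond k g (fun v => xi k g v * xi k g v)) Vxx.
Proof.
apply: (eq_L1 (fun k g hg => esym (cond_cenM hm hdl is_m is_m hg))).
apply: (L1cvgB hm hd).
  apply: (eq_L1 _ L1_is_m) => k g hg; apply: (congr1 (cond k g)).
  by apply/funext => v; rewrite /is_m; case: eqP => _; rewrite ?mulr1 ?mulr0.
exact: (L1cvgM hm hd cond_is_m_bound L1_is_m L1_is_m).
Qed.

Lemma L1_xy : L1 (fun k g => cond k g (fun v => xi k g v * eta k g v)) Vxy.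
Proof.
apply: (eq_L1 (fun k g hg => esym (cond_cenM hm hdl is_m invd hg))).
apply: (L1cvgB hm hd).
  by apply: (eq_L1 _ L1_Nr) => k g hg; rewrite cond_is_m_invd.
exact: (L1cvgM hm hd cond_is_m_bound L1_is_m L1_invd).
Qed.

Lemma L1_yy : L1 (fun k g => cond k g (fun v => eta k g v * eta k g v)) Vyy.
Proof.
apply: (eq_L1 (fun k g hg => esym (cond_cenM hm hdl invd invd hg))).
apply: (L1cvgB hm hd).
  by apply: (eq_L1 _ L1_h) => k g hg; rewrite cond_invd2.
exact: (L1cvgM hm hd cond_invd_bound L1_invd L1_invd).
Qed.

Lemma cond_quad k g (u v : R) :
  cond k g (fun w => (u * xi k g w + v * eta k g w) ^+ 2) =
  u ^+ 2 * cond k g (fun w => xi k g w * xi k g w) +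
  2 * u * v * cond k g (fun w => xi k g w * eta k g w) +
  v ^+ 2 * cond k g (fun w => eta k g w * eta k g w).
Proof.
rewrite -!condZ -!condD; apply: (congr1 (cond k g)).
by apply/funext => w; ring.
Qed.

Definition quad (u v : R) : R := u ^+ 2 * Vxx + 2 * u * v * Vxy + v ^+ 2 * Vyy.

(** A limit of means of conditional second moments. The positivity of the limit variances, in
    [Vyy_gt0] and [sig2_gt0], is drawn from it. *)
Lemma quad_ge0 u v : 0 <= quad u v.
Proof.
have h : L1 (fun k g => u ^+ 2 * cond k g (fun w => xi k g w * xi k g w) +
  2 * u * v * cond k g (fun w => xi k g w * eta k g w) +
  v ^+ 2 * cond k g (fun w => eta k g w * eta k g w)) (quad u v).
  apply: (L1cvgD hm hd); last exact: (L1cvgZ hm hd _ L1_yy).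
  by apply: (L1cvgD hm hd); apply: (L1cvgZ hm hd); [exact: L1_xx|exact: L1_xy].
have hE := L1cvg_Ex hm hd h.
rewrite -(cvg_lim (@Rhausdorff R) hE); apply: limr_ge.
  by apply/cvg_ex; exists (quad u v).
apply: nearW => k.
apply: (Ex_ge0 hm hdl) => g hg; rewrite -cond_quad.
rewrite -(cond_cst hm hdl 0 hg); apply: (ler_cond hm hdl hg) => w _.
exact: sqr_ge0.
Qed.

(* The conditional mean of [Z] is multiplied by [1 - wdec k] at step [k], hence the
   weights [wprod] that turn [Z] into a martingale. *)
Definition wdec (k : nat) : R := (mR + d) / Stot m k d.

Definition wrate : R := mR * (mR + d) / (2 * mR + d).

Definition wprod (K k : nat) : R := \prod_(k <= i < K) (1 - wdec i).

Lemma wdec_bounds k : 0 <= wdec k <= 1.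
Proof.
have S0 := Stot_gt0 k hd; rewrite /wdec divr_ge0 ?(ltW md0) ?(ltW S0)//=.
rewrite ler_pdivrMr// mul1r /Stot.
have : (mR + d) * 1 <= (mR + d) * (tt k)%:R by rewrite ler_wpM2l ?(ltW md0)// ler1n.
by have := ler0n R k; rewrite mulr1 [(mR + d) * _]mulrC => h1 h2; lra.
Qed.

Lemma cvg_k_wdec : (fun k => k%:R * wdec k) @ \oo --> wrate.
Proof.
have h := cvg_k_Stot hm hd.
have -> : wrate = (mR + d) * (mR / (2 * mR + d)) by rewrite /wrate; ring.
by apply: (cvg_ext (cvgM (cvg_cst (mR + d)) h)) => k; rewrite /wdec /=; ring.
Qed.

Lemma wrate_ge0 : 0 <= wrate.
Proof. by rewrite divr_ge0 ?mulr_ge0 ?(ltW m0) ?(ltW md0) ?(ltW md2). Qed.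

Lemma wprod_bounds K k : 0 <= wprod K k <= 1.
Proof.
rewrite /wprod; elim/big_ind : _ => [|x y /andP[x0 x1] /andP[y0 y1]|i _].
- by rewrite ler01 lexx.
- by rewrite mulr_ge0// mulr_ile1.
- by have /andP[h1 h2] := wdec_bounds i; apply/andP; split; lra.
Qed.

Lemma wprodl K k : (k < K)%N -> wprod K k = (1 - wdec k) * wprod K k.+1.
Proof. by move=> kK; rewrite /wprod big_ltn. Qed.

Lemma wprodr K k : (k <= K)%N -> wprod K.+1 k = (1 - wdec K) * wprod K k.
Proof. by move=> kK; rewrite /wprod big_nat_recr//= mulrC. Qed.

Lemma wprod_id K : wprod K K = 1.
Proof. by rewrite /wprod big_geq. Qed.

(** The sum over [k] at horizon [K.+1] is [1 - wdec K] times the sum at horizon [K], plus 1: an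
    instance of [linear_recursion_mean]. Squaring the weights doubles the rate. *)
Lemma cvg_sum_wprod :
  (fun K => (\sum_(0 <= k < K) wprod K k.+1) / K%:R) @ \oo --> 1 / (1 + wrate).
Proof.
apply: (@linear_recursion_mean _ wdec (fun=> 1) (fun K => \sum_(0 <= k < K) wprod K k.+1)).
- move=> K; rewrite big_nat_recr//= wprod_id mulr_sumr; congr (_ + _).
  by rewrite big_nat [RHS]big_nat; apply: eq_bigr => k /andP[_ kK]; rewrite wprodr.
- exact: wdec_bounds.
- exact: wrate_ge0.
- exact: cvg_k_wdec.
- exact: cvg_cst.
Qed.

Lemma cvg_sum_wprod_sqr :
  (fun K => (\sum_(0 <= k < K) wprod K k.+1 ^+ 2) / K%:R) @ \oo --> 1 / (1 + 2 * wrate).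
Proof.
apply: (@linear_recursion_mean _ (fun k => 2 * wdec k - wdec k ^+ 2) (fun=> 1)
  (fun K => \sum_(0 <= k < K) wprod K k.+1 ^+ 2)).
- move=> K; rewrite big_nat_recr//= wprod_id expr1n mulr_sumr; congr (_ + _).
  rewrite big_nat [RHS]big_nat; apply: eq_bigr => k /andP[_ kK]; rewrite wprodr//.
  ring.
- by move=> k; have /andP[h1 h2] := wdec_bounds k; apply/andP; split; nra.
- by have := wrate_ge0; lra.
- have h := cvg_k_wdec.
  have hw : wdec @ \oo --> (0 : R).
    have h0 : (fun k => k.+1%:R * wdec k.+1 * k.+1%:R^-1) @ \oo --> wrate * 0.
      by apply: cvgM; [by move: h; rewrite -cvg_shiftS|exact: cvg_harmonic].
    rewrite mulr0 in h0; rewrite -cvg_shiftS; apply: (cvg_ext h0) => k /=.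
    by rewrite mulrAC divff ?mul1r.
  have -> : 2 * wrate = 2 * wrate - wrate * 0 by ring.
  have h2 : (fun k => 2 * (k%:R * wdec k) - k%:R * wdec k * wdec k) @ \oo -->
      2 * wrate - wrate * 0.
    by apply: cvgB; apply: cvgM => //; exact: cvg_cst.
  by apply: (cvg_ext h2) => k /=; ring.
- exact: cvg_cst.
Qed.

(** The deterministic part of the count, [Nr m = Zr m + theta]. Then [zdrift] is the part of the
    conditional mean of the step of [Zr m] that does not depend on [Zr m], and [zmean] follows the
    resulting recursion for its mean. *)
Definition theta (k : nat) : R := tfrac R m k + k%:R / mR * plim m d m.

Definition zdrift (k : nat) : R := (1 - plim m d m) / mR - wdec k * theta k.

Fixpoint zmean (k : nat) : R :=
  if k is k'.+1 then (1 - wdec k') * zmean k' + zdrift k'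
  else Zr m d m 0 (nseq m (0%N, 1%N)).

(** The terms of order 1 cancel because [(1 - plim m) / m = (m + d) * plim m / (2 m + d)], the
    balance at degree [m]; a multiple of [tfrac k / Stot k] is left. *)
Lemma zdrift_le : exists2 C : R, 0 <= C & forall k, `|zdrift k| <= C / (k%:R + 1).
Proof.
facts; pose s0 := (mR + d) / (1 + mR + d).
have s00 : 0 < s0 by rewrite divr_gt0//; lra.
pose c0 : R := (1 - plim m d m) / mR.
exists (2 * ((mR + d) * `|c0 - 1|) / s0) => [|k].
  by rewrite divr_ge0 ?(ltW s00)// !mulr_ge0 ?(ltW md0).
have S0 := Stot_gt0 k hd.
have k1 : 0 < k%:R + 1 :> R by rewrite ltr_wpDl.
have Slb : s0 * (k%:R + 1) <= Stot m k d by exact: Stot_lb.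
have hB := Bden_gt0 hm hd.
have hc0 : c0 * (2 * mR + d) = (mR + d) * plim m d m.
  rewrite /c0 plimm; move: hB; rewrite /Bden => hB.
  by field; rewrite !gt_eqF.
have -> : zdrift k = tfrac R m k * ((mR + d) * (c0 - 1)) * (Stot m k d)^-1.
  apply: (mulIf (lt0r_neq0 S0)); rewrite mulfVK ?gt_eqF//.
  have hw : wdec k * Stot m k d = mR + d by rewrite /wdec divfK// gt_eqF.
  rewrite /zdrift -/c0 mulrBl [wdec k * _ * _]mulrAC hw.
  have -> : c0 * Stot m k d = c0 * (2 * mR + d) * (k%:R / mR) + c0 * ((mR + d) * tfrac R m k).
    by rewrite /Stot /tfrac; field; rewrite gt_eqF.
  by rewrite hc0 /theta; ring.
have /andP[u1 u2] := tfrac_bounds R hm k.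
rewrite !normrM (ger0_norm (_ : 0 <= (Stot m k d)^-1)) ?invr_ge0 ?(ltW S0)//.
rewrite (ger0_norm (ltW md0)) (ger0_norm (_ : 0 <= tfrac R m k)); last by lra.
have -> : 2 * ((mR + d) * `|c0 - 1|) / s0 / (k%:R + 1) =
  2 * ((mR + d) * `|c0 - 1|) * (s0 * (k%:R + 1))^-1 by field; rewrite !gt_eqF.
apply: ler_pM.
- by rewrite !mulr_ge0 ?(ltW md0)//; lra.
- by rewrite invr_ge0 ltW.
- by rewrite ler_wpM2r// mulr_ge0 ?(ltW md0).
- by rewrite lef_pV2 ?posrE// mulr_gt0.
Qed.

(** The contraction [wdec k] and the drift [zdrift k] are both of order [1 / k], so a level [M] at
    which the first compensates the second is never exceeded. *)
Lemma zmean_bounded : exists C : R, forall k, `|zmean k| <= C.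
Proof.
facts; have [C C0 hC] := zdrift_le.
pose s1 := 2 * (mR + d) + 1.
have s10 : 0 < s1 by rewrite /s1; lra.
pose M := Num.max `|zmean 0| (C * s1 / (mR + d)).
exists M; elim=> [|k IH]; first by rewrite le_max lexx.
have S0 := Stot_gt0 k hd.
have k1 : 0 < k%:R + 1 :> R by rewrite ltr_wpDl.
have Sub := Stot_ub hm k hd.
have /andP[w0 w1] := wdec_bounds k.
rewrite [zmean _]/= (le_trans (ler_normD _ _))// normrM ger0_norm ?subr_ge0//.
have h1 : (1 - wdec k) * `|zmean k| <= (1 - wdec k) * M by rewrite ler_wpM2l ?subr_ge0.
have h2 : C / (k%:R + 1) <= wdec k * M.
  apply: (@le_trans _ _ (wdec k * (C * s1 / (mR + d)))); last first.
    by rewrite ler_wpM2l// le_max lexx orbT.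
  have -> : wdec k * (C * s1 / (mR + d)) = C * s1 / Stot m k d.
    by rewrite /wdec; field; rewrite !gt_eqF.
  rewrite ler_pdivlMr// mulrAC ler_pdivrMr// -mulrA ler_wpM2l//.
have := hC k; lra.
Qed.

End CLT.

(** * Central limit theorem with Gaussian smoothing *)

Section SmoothCLT.
Variables (R : realType) (m : nat).
Hypothesis hm : (0 < m)%N.
Variable d : R.
Hypothesis hd : - m%:R < d.
Local Notation mR := (m%:R : R).
Local Notation tt := (tt m).
Local Notation reach := (reach m).
Local Notation dl := (fun _ : nat => d).
Let hdl (t : nat) : - mR < d. Proof. exact: hd. Qed.
Local Notation E k := (Ex (flaw m dl k)).
Local Notation cond := (cond m dl).
Local Notation is_m := (is_m R m).
Local Notation invd := (invd d).
Local Notation xi := (cen m dl is_m).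
Local Notation eta := (cen m dl invd).
Local Notation wprod := (wprod m d).
Local Notation zmean := (zmean m d).
Local Notation Vxx := (Vxx m d).
Local Notation Vxy := (Vxy m d).
Local Notation Vyy := (Vyy m d).
Local Notation quad := (quad m d).

Variables x y : R.

Definition Ystat (K : nat) (g : mgraph) : R :=
  (x * Zr m d m K g + y * psum m eta g) / Num.sqrt K%:R.

(** An edge falling on a vertex of degree [m] lowers [Z], hence the sign of [- x]; the two fractions
    are the limit means of [wprod] and of its square. *)
Definition sig2 : R :=
  x ^+ 2 * Vxx * (1 / (1 + 2 * wrate m d)) +
  2 * (- x) * y * Vxy * (1 / (1 + wrate m d)) + y ^+ 2 * Vyy.

Let Vstep (K k : nat) : R := quad (- x * wprod K k.+1) y / K%:R.

Let Vstep_ge0 K k : 0 <= Vstep K k.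
Proof. by rewrite divr_ge0// quad_ge0. Qed.

Lemma cvg_sum_Vstep : (fun K => \sum_(0 <= k < K) Vstep K k) @ \oo --> sig2.
Proof.
have h1 := cvg_sum_wprod_sqr hm hd; have h2 := cvg_sum_wprod hm hd.
have h3 : (fun K : nat => x ^+ 2 * Vxx * ((\sum_(0 <= k < K) wprod K k.+1 ^+ 2) / K%:R)
   + 2 * (- x) * y * Vxy * ((\sum_(0 <= k < K) wprod K k.+1) / K%:R)
   + y ^+ 2 * Vyy * (K%:R / K%:R)) @ \oo --> sig2.
  apply: cvgD; first apply: cvgD.
  - by apply: cvgM => //; exact: cvg_cst.
  - by apply: cvgM => //; exact: cvg_cst.
  rewrite -[X in _ --> X]mulr1; apply: cvgM; first exact: cvg_cst.
  apply: cvg_trans (_ : (fun _ : nat => (1 : R)) @ \oo `=>` _); last exact: cvg_cst.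
  by apply: near_eq_cvg; exists 1%N => // K /= K0; rewrite divff// pnatr_eq0 -lt0n.
apply: (cvg_ext h3) => K.
rewrite /Vstep -mulr_suml.
transitivity ((x ^+ 2 * Vxx * (\sum_(0 <= k < K) wprod K k.+1 ^+ 2) +
   2 * (- x) * y * Vxy * (\sum_(0 <= k < K) wprod K k.+1) + y ^+ 2 * Vyy * K%:R) / K%:R).
  by ring.
congr (_ / _); rewrite !mulr_sumr.
have -> : y ^+ 2 * Vyy * K%:R = \sum_(0 <= k < K) y ^+ 2 * Vyy.
  by rewrite sumr_const_nat subn0 mulr_natr.
rewrite -!big_split/=; apply: eq_bigr => k _; rewrite /quad; ring.
Qed.

Lemma sig2_ge0 : 0 <= sig2.
Proof.
rewrite -(cvg_lim (@Rhausdorff R) cvg_sum_Vstep); apply: limr_ge.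
  by apply/cvg_ex; exists sig2; exact: cvg_sum_Vstep.
by apply: nearW => K; apply: sumr_ge0 => k _; exact: Vstep_ge0.
Qed.

Let Xbound : R := `|x| * 2 + `|y| * (2 * (mR + d)^-1).

Let cen_bound (f : nat -> R) c k g v : reach k g -> (v < tt k)%N ->
  (forall r, (m <= r)%N -> `|f r| <= c) -> `|cen m dl f k g v| <= 2 * c.
Proof.
move=> hg vt hf; rewrite /cen mulrDl mul1r (le_trans (ler_normB _ _))//.
apply: lerD; first by apply: hf; exact: (reach_deg hm hg).
apply: (le_trans (ler_norm_cond hm hdl _ hg)).
rewrite -[leRHS](cond_cst hm hdl _ hg); apply: (ler_cond hm hdl hg) => u ut.
by apply: hf; exact: (reach_deg hm hg).
Qed.

Lemma quad_le (u v B : R) : `|u| <= B -> `|v| <= B ->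
  quad u v <= B ^+ 2 * (`|Vxx| + 2 * `|Vxy| + `|Vyy|).
Proof.
move=> hu hv; have B0 : 0 <= B by exact: le_trans hu.
have h1 : u ^+ 2 * Vxx <= B ^+ 2 * `|Vxx|.
  apply: (le_trans (ler_norm _)); rewrite normrM ler_wpM2r// normrX lerXn2r//.
have h2 : 2 * u * v * Vxy <= 2 * (B ^+ 2 * `|Vxy|).
  have -> : 2 * u * v * Vxy = 2 * (u * v * Vxy) by ring.
  rewrite ler_wpM2l// (le_trans (ler_norm _))// normrM ler_wpM2r// normrM.
  by rewrite expr2 ler_pM.
have h3 : v ^+ 2 * Vyy <= B ^+ 2 * `|Vyy|.
  apply: (le_trans (ler_norm _)); rewrite normrM ler_wpM2r// normrX lerXn2r//.
rewrite /quad; lra.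
Qed.

(** [Phi ((y - a) / sqrt e)] is the probability that [y] plus an independent centred Gaussian of
    variance [e] is at least [a]. For each horizon [K] the recentred statistic is the end of a
    martingale with weights [wprod K k], to which [lindeberg] applies. *)
Lemma clt_smooth (e a : R) : 0 < e ->
  (fun K => E K (fun g => Phi ((Ystat K g - a) / Num.sqrt e))) @ \oo -->
  Phi (- a / Num.sqrt (e + sig2)).
Proof.
move=> e0; have [C C0 hC] := lindeberg hm e0.
(* Centring [Zr] by [zmean] is paid for by a shift of the threshold, which vanishes as [zmean] is
   bounded. Thus [Yp K] starts at the constant [- aK K] and, as [wprod K K = 1], ends at
   [Ystat K - a]. *)
pose aK (K : nat) : R := a - x * zmean K / Num.sqrt K%:R.
pose Yp (K k : nat) g : R :=
  (x * (wprod K k * (Zr m d m k g - zmean k)) + y * psum m eta g) / Num.sqrt K%:R - aK K.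
pose Xp (K k : nat) g v : R :=
  (- x * wprod K k.+1 * xi k g v + y * eta k g v) / Num.sqrt K%:R.
pose sp (K k : nat) : R := e + \sum_(k <= i < K) Vstep K i.
pose e1 k := E k (fun g => `|cond k g (fun v => xi k g v * xi k g v) - Vxx|).
pose e2 k := E k (fun g => `|cond k g (fun v => xi k g v * eta k g v) - Vxy|).
pose e3 k := E k (fun g => `|cond k g (fun v => eta k g v * eta k g v) - Vyy|).
pose ee k := x ^+ 2 * e1 k + 2 * `|x * y| * e2 k + y ^+ 2 * e3 k.
pose D := (`|x| + `|y|) ^+ 2 * (`|Vxx| + 2 * `|Vxy| + `|Vyy|).
have hstep K k : (k < K)%N -> sp K k - sp K k.+1 = Vstep K k.
  by move=> kK; rewrite /sp big_ltn//; ring.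
(* The error terms come from the conditional variances, from the cubes of increments of size
   [Xbound / sqrt K], and from the squares of the variance steps, each at most [D / K]. *)
have main K : (0 < K)%N ->
  `|E K (fun g => Phi ((Ystat K g - a) / Num.sqrt e)) - Phi (- aK K / Num.sqrt (sp K 0%N))| <=
  C * ((\sum_(0 <= k < K) ee k) / K%:R + Xbound ^+ 3 * (Num.sqrt K%:R)^-1 + D ^+ 2 * K%:R^-1).
  move=> K0; have K0' : 0 < K%:R :> R by rewrite ltr0n.
  have q0 : 0 < Num.sqrt K%:R :> R by rewrite sqrtr_gt0.
  have qq : Num.sqrt K%:R ^+ 2 = K%:R :> R by rewrite sqr_sqrtr// ltW.
  have hY k g v : (k < K)%N -> reach k g -> (v < tt k)%N ->
      Yp K k.+1 ((v, tt k) :: g) = Yp K k g + Xp K k g v.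
    move=> kK hg vt; rewrite /Yp /Xp (psumS hm _ _ _ hg) (Zr_step hm d m hg vt).
    have mD := reach_deg hm hg vt.
    have hxi : xi k g v = (deg g v == m)%:R - wdec m d k * (Zr m d m k g + theta m d k).
      rewrite /cen (cond_is_m hm _ hg) /wdec /theta /Zr eqxx [true%:R]/= mulr1n /is_m; ring.
    have hU : Uinc m d m (deg g v) = (1 - plim m d m) / m%:R - (deg g v == m)%:R.
      by rewrite /Uinc gtn_eqF// eqxx [true%:R]/= [false%:R]/= mulr1n mulr0n; ring.
    rewrite hU hxi (wprodl m d kK) [zmean k.+1]/= /zdrift; ring.
  have hX k g : (k < K)%N -> reach k g -> cond k g (Xp K k g) = 0.
    move=> kK hg; have -> : Xp K k g = (fun v => (Num.sqrt K%:R)^-1 *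
        (- x * wprod K k.+1 * xi k g v + y * eta k g v)).
      by apply/funext => v; rewrite /Xp mulrC.
    by rewrite condZ condD !condZ !(cond_cen hm hdl _ hg) !mulr0 addr0 mulr0.
  have hB k g v : (k < K)%N -> reach k g -> (v < tt k)%N ->
      `|Xp K k g v| <= Xbound / Num.sqrt K%:R.
    move=> kK hg vt; rewrite /Xp normrM (ger0_norm (_ : 0 <= (Num.sqrt K%:R)^-1)) ?invr_ge0 ?(ltW q0)//.
    rewrite ler_wpM2r ?invr_ge0 ?(ltW q0)// (le_trans (ler_normD _ _))// /Xbound.
    have /andP[w0 w1] := wprod_bounds hd K k.+1.
    apply: lerD; rewrite normrM; last first.
      rewrite ler_wpM2l//; apply: (cen_bound hg vt) => r mr.
      by have /andP[h1 h2] := invd_bounds hm hd mr; rewrite ger0_norm.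
    rewrite normrM normrN (ger0_norm w0); apply: ler_pM; rewrite ?mulr_ge0//.
      by rewrite ler_piMr.
    rewrite -[2]mulr1; apply: (cen_bound hg vt) => r _.
    by rewrite /is_m; case: eqP => _; rewrite ?normr1 ?normr0.
  have hs k : (k <= K)%N -> e <= sp K k.
    by move=> _; rewrite /sp lerDl; apply: sumr_ge0 => i _; exact: Vstep_ge0.
  have hd' k : (k < K)%N -> sp K k.+1 <= sp K k.
    by move=> kK; rewrite -subr_ge0 hstep// Vstep_ge0.
  have := hC dl K (Yp K) (Xp K) (sp K) (Xbound / Num.sqrt K%:R) hdl hY hX hB hs hd'.
  have -> : sp K K = e by rewrite /sp big_geq// addr0.
  have -> : (fun g => Phi (Yp K K g / Num.sqrt e)) =
      (fun g => Phi ((Ystat K g - a) / Num.sqrt e)).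
    have hYK g : Yp K K g = Ystat K g - a.
      by rewrite /Yp /aK /Ystat (wprod_id m d K); ring.
    by apply/funext => g; rewrite hYK.
  rewrite Ex0; have -> : Yp K 0%N (nseq m (0%N, 1%N)) = - aK K.
    by rewrite /Yp psum0 /= subrr !mulr0 addr0 mul0r sub0r.
  move=> h; apply: (le_trans h); rewrite ler_wpM2l//.
  rewrite mulr_suml.
  have -> : Xbound ^+ 3 * (Num.sqrt K%:R)^-1 = \sum_(0 <= k < K) (Xbound / Num.sqrt K%:R) ^+ 3.
    have aux (b q : R) : 0 < q -> b ^+ 3 * q^-1 = q ^+ 2 * (b / q) ^+ 3.
      by move=> hq; field; rewrite gt_eqF.
    by rewrite sumr_const_nat subn0 -[RHS]mulr_natl (aux _ _ q0) qq.
  have -> : D ^+ 2 * K%:R^-1 = \sum_(0 <= k < K) (D / K%:R) ^+ 2.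
    have aux (b q : R) : 0 < q -> b ^+ 2 * q^-1 = q * (b / q) ^+ 2.
      by move=> hq; field; rewrite gt_eqF.
    by rewrite sumr_const_nat subn0 -[RHS]mulr_natl (aux _ _ K0').
  rewrite -!big_split/= big_nat [leRHS]big_nat; apply: ler_sum => k /andP[_ kK].
  rewrite hstep//; apply: lerD; first (apply: lerD => //); last first.
    rewrite lerXn2r ?nnegrE ?Vstep_ge0 ?divr_ge0 ?mulr_ge0 ?sqr_ge0 ?addr_ge0 ?mulr_ge0//.
    rewrite /Vstep ler_wpM2r ?invr_ge0//; apply: quad_le; last by rewrite lerDr.
    have /andP[w0 w1] := wprod_bounds hd K k.+1.
    by rewrite normrM normrN (ger0_norm w0) (@le_trans _ _ `|x|)// ?ler_piMr// lerDl.
  rewrite /ee mulrDl mulrDl -![_ * _ / K%:R]mulrAC -!ExZ -!ExD.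
  apply: (ler_Ex hm hdl) => g hg.
  have -> : cond k g (fun v => Xp K k g v ^+ 2) =
     cond k g (fun v => (- x * wprod K k.+1 * xi k g v + y * eta k g v) ^+ 2) / K%:R.
    rewrite mulrC -condZ; apply: (congr1 (cond k g)); apply/funext => v.
    by rewrite /Xp exprMn exprVn qq mulrC.
  rewrite cond_quad /Vstep -mulrBl normrM (ger0_norm (_ : 0 <= K%:R^-1)) ?invr_ge0//.
  have /andP[w0 w1] := wprod_bounds hd K k.+1.
  set A1 := cond k g _; set A2 := cond k g _; set A3 := cond k g _.
  rewrite [leRHS](_ : _ = (x ^+ 2 * `|A1 - Vxx| + 2 * `|x * y| * `|A2 - Vxy| +
     y ^+ 2 * `|A3 - Vyy|) / K%:R); last by ring.
  rewrite ler_wpM2r ?invr_ge0// /quad.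
  set w := wprod K k.+1 in w0 w1 *.
  have -> : (- x * w) ^+ 2 * A1 + 2 * (- x * w) * y * A2 + y ^+ 2 * A3 -
     ((- x * w) ^+ 2 * Vxx + 2 * (- x * w) * y * Vxy + y ^+ 2 * Vyy) =
     w ^+ 2 * (x ^+ 2 * (A1 - Vxx)) + w * (2 * (- (x * y)) * (A2 - Vxy)) + y ^+ 2 * (A3 - Vyy).
    by ring.
  apply: (le_trans (ler_normD _ _)); apply: lerD; last first.
    by rewrite normrM (ger0_norm (sqr_ge0 y)).
  apply: (le_trans (ler_normD _ _)); apply: lerD.
    rewrite (normrM (w ^+ 2)) (normrM (x ^+ 2)) (ger0_norm (sqr_ge0 x)) (ger0_norm (sqr_ge0 w)).
    by apply: ler_piMl; [rewrite mulr_ge0 ?sqr_ge0|rewrite expr_le1].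
  rewrite normrM (ger0_norm w0) 2!normrM normrN (ger0_norm (_ : 0 <= 2))//.
  by rewrite ler_piMl// !mulr_ge0.
have hee : ee @ \oo --> (0 : R).
  have -> : (0 : R) = x ^+ 2 * 0 + 2 * `|x * y| * 0 + y ^+ 2 * 0 by rewrite !mulr0 !addr0.
  apply: cvgD; first apply: cvgD.
  - by apply: cvgM; [exact: cvg_cst|exact: (L1_xx hm hd)].
  - by apply: cvgM; [exact: cvg_cst|exact: (L1_xy hm hd)].
  - by apply: cvgM; [exact: cvg_cst|exact: (L1_yy hm hd)].
have hiq := @cvg_inv_sqrtn R.
have hiK : (fun K : nat => (K%:R : R)^-1) @ \oo --> (0 : R).
  by rewrite -cvg_shiftS; exact: cvg_harmonic.
have hbound : (fun K : nat => C * ((\sum_(0 <= k < K) ee k) / K%:R +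
    Xbound ^+ 3 * (Num.sqrt K%:R)^-1 + D ^+ 2 * K%:R^-1)) @ \oo -->
    C * (0 + Xbound ^+ 3 * 0 + D ^+ 2 * 0).
  apply: cvgM; first exact: cvg_cst.
  apply: cvgD; first apply: cvgD.
  - exact: (cesaro_sum hee).
  - by apply: cvgM => //; exact: cvg_cst.
  - by apply: cvgM => //; exact: cvg_cst.
rewrite !mulr0 !addr0 mulr0 in hbound.
have haK : aK @ \oo --> a.
  have [Cz hCz] := zmean_bounded hm hd.
  have h0 : (fun K : nat => x * zmean K / Num.sqrt K%:R) @ \oo --> (0 : R).
    apply: (@squeeze_norm0 _ _ _ _ _ (fun K : nat => `|x| * Cz * (Num.sqrt K%:R)^-1)).
      by rewrite -(mulr0 (`|x| * Cz)); apply: cvgM => //; exact: cvg_cst.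
    apply: nearW => K; rewrite !normrM (ger0_norm (_ : 0 <= (Num.sqrt K%:R)^-1)).
      by rewrite ler_wpM2r ?invr_ge0 ?sqrtr_ge0// ler_wpM2l.
    by rewrite invr_ge0 sqrtr_ge0.
  by rewrite -[X in _ --> X]subr0; apply: cvgB => //; exact: cvg_cst.
have hsp : (fun K => sp K 0%N) @ \oo --> e + sig2.
  by apply: cvgD; [exact: cvg_cst|exact: cvg_sum_Vstep].
have hq : (fun K => Num.sqrt (sp K 0%N)) @ \oo --> Num.sqrt (e + sig2).
  exact: (cvg_comp _ _ hsp (@sqrt_continuous R _)).
have hphi : (fun K => Phi (- aK K / Num.sqrt (sp K 0%N))) @ \oo --> Phi (- a / Num.sqrt (e + sig2)).
  have hc : {for - a / Num.sqrt (e + sig2), continuous (@Phi R)}.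
    have h := Phi_derive (- a / Num.sqrt (e + sig2)).
    by apply: differentiable_continuous; apply/derivable1_diffP; exact: ex_derive.
  have harg : (fun K => - aK K / Num.sqrt (sp K 0%N)) @ \oo --> - a / Num.sqrt (e + sig2).
    apply: cvgM; first exact: cvgN.
    by apply: cvgV => //; rewrite gt_eqF// sqrtr_gt0 ltr_pwDl// sig2_ge0.
  exact: (cvg_comp _ _ harg hc).
have hdiff : (fun K => E K (fun g => Phi ((Ystat K g - a) / Num.sqrt e)) -
    Phi (- aK K / Num.sqrt (sp K 0%N))) @ \oo --> (0 : R).
  apply: (squeeze_norm0 hbound); exists 1%N => // K /= K0; exact: main.
have h : (fun K => E K (fun g => Phi ((Ystat K g - a) / Num.sqrt e)) -
    Phi (- aK K / Num.sqrt (sp K 0%N)) + Phi (- aK K / Num.sqrt (sp K 0%N))) @ \oo -->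
    0 + Phi (- a / Num.sqrt (e + sig2)) by apply: cvgD.
rewrite add0r in h.
by apply: (cvg_ext h) => K /=; rewrite subrK.
Qed.

End SmoothCLT.

(** * From smoothed means to probabilities *)

Section CLTProbability.
Variables (R : realType) (m : nat).
Hypothesis hm : (0 < m)%N.
Variable d : R.
Hypothesis hd : - m%:R < d.
Local Notation dl := (fun _ : nat => d).
Let hdl (t : nat) : - m%:R < d. Proof. exact: hd. Qed.
Variables x y : R.
Local Notation Y := (Ystat m d x y).
Local Notation s2 := (sig2 m d x y).

Lemma Phi_continuous : continuous (@Phi R).
Proof.
move=> z; have h := Phi_derive z.
by apply: differentiable_continuous; apply/derivable1_diffP; exact: ex_derive.
Qed.

(** The indicator of [[a, +oo[] lies between the smoothed functions with thresholds [a + h] and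
    [a - h], up to the tail [tl]. *)
Lemma clt (a : R) : 0 < s2 ->
  (fun K => Pr (flaw m dl K) (fun g => a <= Y K g)) @ \oo --> Phi (- a / Num.sqrt s2).
Proof.
move=> s20; set L := Phi _.
pose h (j : nat) : R := j.+1%:R^-1.
(* Then [Num.sqrt e = h ^+ 2], so a shift by [h] amounts to [1 / h] standard deviations of the
   smoothing: noise and tail vanish together. *)
pose e (j : nat) : R := h j ^+ 4.
have hpos j : 0 < h j by rewrite invr_gt0.
have epos j : 0 < e j by rewrite exprn_gt0.
have hcv : h @ \oo --> (0 : R) by exact: cvg_harmonic.
have ecv : e @ \oo --> (0 : R).
  have he : e @ \oo --> (0 * 0 * (0 * 0) : R).
    apply: (@cvg_ext _ _ _ (fun j => h j * h j * (h j * h j))) => [|j].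
      by apply: cvgM; apply: cvgM.
    by rewrite /e; ring.
  by rewrite !mulr0 in he.
have sqe j : Num.sqrt (e j) = h j ^+ 2.
  by rewrite /e (_ : 4%N = (2 * 2)%N)// exprM sqrtr_sqr ger0_norm// sqr_ge0.
have hdiv j : h j / Num.sqrt (e j) = j.+1%:R.
  by rewrite sqe /h; field; rewrite addrC natr1 pnatr_eq0.
pose tl (j : nat) : R := Phi (- j.+1%:R).
have tlcv : tl @ \oo --> (0 : R).
  have hj : (fun j : nat => - j.+1%:R : R) @ \oo --> -oo.
    apply/cvgrNyPle => A; exists (Num.truncn `|A|) => // j /= hj.
    rewrite lerNl (le_trans (ler_norm _))// normrN ltW// (lt_le_trans (truncnS_gt _))//.
    by rewrite ler_nat.
  exact: (cvg_comp _ _ hj (@Phi_cvgNy R)).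
have limcv (s : R) : (fun j => Phi (- (a + s * h j) / Num.sqrt (e j + s2))) @ \oo --> L.
  have harg : (fun j => - (a + s * h j) / Num.sqrt (e j + s2)) @ \oo -->
      - (a + s * 0) / Num.sqrt (0 + s2).
    apply: cvgM.
      apply: cvgN; apply: cvgD; first exact: cvg_cst.
      by apply: cvgM => //; exact: cvg_cst.
    apply: cvgV; first by rewrite add0r gt_eqF// sqrtr_gt0.
    have hes : (fun j => e j + s2) @ \oo --> 0 + s2.
      by apply: cvgD => //; exact: cvg_cst.
    exact: (cvg_comp _ _ hes (@sqrt_continuous R _)).
  rewrite mulr0 addr0 add0r in harg.
  exact: (cvg_comp _ _ harg (@Phi_continuous _)).
have up j K : Pr (flaw m dl K) (fun g => a <= Y K g) <=
    Ex (flaw m dl K) (fun g => Phi ((Y K g - (a + -1 * h j)) / Num.sqrt (e j))) + tl j.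
  rewrite PrE -(Ex_cst hm hdl K (tl j)) -ExD; apply: (ler_Ex hm hdl) => g _.
  case: (boolP (a <= Y K g)) => [aY|_]; last by rewrite addr_ge0 ?Phi_ge0.
  have h1 : Phi j.+1%:R <= Phi ((Y K g - (a + -1 * h j)) / Num.sqrt (e j)).
    apply: Phi_nd; rewrite -hdiv ler_wpM2r ?invr_ge0 ?sqrtr_ge0//; lra.
  by rewrite /tl PhiN /= mulr1n; lra.
have lo j K : Ex (flaw m dl K) (fun g => Phi ((Y K g - (a + 1 * h j)) / Num.sqrt (e j))) - tl j <=
    Pr (flaw m dl K) (fun g => a <= Y K g).
  rewrite PrE -(Ex_cst hm hdl K (tl j)) -ExB; apply: (ler_Ex hm hdl) => g _.
  case: (boolP (a <= Y K g)) => [aY|].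
    by rewrite /= mulr1n lerBlDr (le_trans (Phi_le1 _))// lerDl Phi_ge0.
  rewrite -ltNge => aY; rewrite /= mulr0n subr_le0 /tl; apply: Phi_nd.
  have -> : - j.+1%:R = - h j / Num.sqrt (e j) by rewrite mulNr hdiv.
  rewrite ler_wpM2r ?invr_ge0 ?sqrtr_ge0//; lra.
apply/cvgrPdist_le => eps eps0; have e4 : 0 < eps / 4 by rewrite divr_gt0.
have /cvgrPdist_le/(_ _ e4)[j1 _ hj1] := limcv 1.
have /cvgrPdist_le/(_ _ e4)[j2 _ hj2] := limcv (-1).
have /cvgrPdist_le/(_ _ e4)[j3 _ hj3] := tlcv.
pose j := maxn j1 (maxn j2 j3).
have {}hj1 := hj1 j (leq_maxl _ _).
have {}hj2 := hj2 j (leq_trans (leq_maxl _ _) (leq_maxr _ _)).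
have {}hj3 := hj3 j (leq_trans (leq_maxr _ _) (leq_maxr _ _)).
have /cvgrPdist_le/(_ _ e4) k1 := @clt_smooth _ _ hm _ hd x y (e j) (a + 1 * h j) (epos j).
have /cvgrPdist_le/(_ _ e4) k2 := @clt_smooth _ _ hm _ hd x y (e j) (a + -1 * h j) (epos j).
move: k1 k2; apply: filterS2 => K k1 k2.
have := up j K; have := lo j K; move: hj1 hj2 hj3 k1 k2.
rewrite /tl /= sub0r normrN (ger0_norm (Phi_ge0 _)).
set u1 := Ex _ _; set u2 := Ex _ _; set p := Pr _ _.
rewrite !ler_norml => /andP[? ?] /andP[? ?] ? /andP[? ?] /andP[? ?] ? ?.
by apply/andP; split; lra.
Qed.

End CLTProbability.

(** * The Gamma function *)

Section GammaFunction.
Variable R : realType.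
Local Notation mu := (@lebesgue_measure R).

Implicit Types x y s : R.

Definition gamma_fun (x s : R) : R := s `^ (x - 1) * expR (- s).

(** Compact intervals exhausting the half-line: the integrand may be singular at 0, so integration
    by parts is done on these and passed to the limit. *)
Let itvn (n : nat) : set R := `[n.+1%:R^-1, n.+1%:R].

Lemma gamma_fun_ge0 x s : 0 <= gamma_fun x s.
Proof. by rewrite mulr_ge0 ?powR_ge0 ?expR_ge0. Qed.

Lemma powR_continuous_at (y s : R) : 0 < s -> {for s, continuous (fun u : R => u `^ y)}.
Proof.
move=> s0; apply: differentiable_continuous; apply/derivable1_diffP.
by apply: derivable_powR; rewrite in_itv/= s0.
Qed.

Lemma expRN_continuous : continuous (fun s : R => expR (- s)).
Proof. by move=> s; apply: continuous_comp; [exact: continuousN|exact: continuous_expR]. Qed.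

Lemma gamma_fun_continuous_at x s : 0 < s -> {for s, continuous (gamma_fun x)}.
Proof. by move=> s0; apply: cvgM; [exact: powR_continuous_at|exact: expRN_continuous]. Qed.

Lemma measurable_gamma_fun x (A : set R) : measurable_fun A (gamma_fun x).
Proof.
apply: measurable_funTS; apply: measurable_funM => //=.
apply: measurableT_comp => //.
Qed.

Let itvn_gt0 n s : itvn n s -> 0 < s.
Proof. by rewrite /itvn /= in_itv/= => /andP[h _]; apply: lt_le_trans h; rewrite invr_gt0. Qed.

Let itvn_nd : nondecreasing_seq itvn.
Proof.
move=> n p np; apply/subsetPset => s; rewrite /itvn /= !in_itv/= => /andP[h1 h2].
apply/andP; split.
  by apply: le_trans h1; rewrite lef_pV2 ?posrE// ler_nat ltnS.
by apply: (le_trans h2); rewrite ler_nat ltnS.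
Qed.

Let itvn_bigcup : \bigcup_n itvn n = `]0, +oo[%classic.
Proof.
apply/seteqP; split => s; first by move=> [n _ /itvn_gt0 s0]; rewrite /= in_itv/= s0.
rewrite /= in_itv/= andbT => s0.
have [n1 h1] : exists n, s <= n.+1%:R.
  by exists (Num.truncn s); apply: ltW; rewrite truncnS_gt.
have [n2 h2] : exists n, s^-1 <= n.+1%:R.
  by exists (Num.truncn s^-1); apply: ltW; rewrite truncnS_gt.
exists (maxn n1 n2) => //; rewrite /itvn /= in_itv/=; apply/andP; split.
  rewrite invf_ple ?posrE//; apply: (le_trans h2).
  by rewrite ler_nat ltnS leq_maxr.
by apply: (le_trans h1); rewrite ler_nat ltnS leq_maxl.
Qed.

Let gamma_cvge x : (\int[mu]_(s in itvn n) (gamma_fun x s)%:E)%E @[n --> \oo] -->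
  (\int[mu]_(s in `]0%R, +oo[) (gamma_fun x s)%:E)%E.
Proof.
rewrite -itvn_bigcup; apply: ge0_nondecreasing_set_cvg_integral.
- exact: itvn_nd.
- by move=> i; exact: measurable_itv.
- by move=> i; apply/measurable_EFinP; exact: measurable_gamma_fun.
- by move=> i s _; rewrite lee_fin gamma_fun_ge0.
Qed.

Let gamma_le x n : (\int[mu]_(s in itvn n) (gamma_fun x s)%:E <=
  \int[mu]_(s in `]0%R, +oo[) (gamma_fun x s)%:E)%E.
Proof.
apply: ge0_subset_integral => //=.
- exact: measurable_itv.
- by apply/measurable_EFinP; exact: measurable_gamma_fun.
- by move=> s _; rewrite lee_fin gamma_fun_ge0.
- by move=> s /itvn_gt0 s0; rewrite /= in_itv/= s0.
Qed.

Let gamma_integrable x n : mu.-integrable (itvn n) (EFin \o gamma_fun x).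
Proof.
apply: continuous_compact_integrable; first exact: segment_compact.
apply: continuous_in_subspaceT => s; rewrite inE => /itvn_gt0.
exact: gamma_fun_continuous_at.
Qed.

Let expRh_int : (\int[mu]_(s in `[0%R, +oo[) (expR (- s / 2))%:E = 2%:E)%E.
Proof.
have hd (x : R) : is_derive x 1 (fun s => - (2 * expR (- s / 2))) (expR (- x / 2)).
  by apply: is_derive_eq; rewrite /GRing.scale /=; field.
rewrite (@ge0_continuous_FTC2y _ _ (fun s => - (2 * expR (- s / 2))) _ 0).
- by rewrite oppr0 mul0r expR0 mulr1 -EFinB sub0r opprK.
- by move=> x _; exact: expR_ge0.
- apply: continuous_subspaceT => x.
  apply: continuous_comp; last exact: continuous_expR.
  by apply: cvgM; [exact: continuousN|exact: cvg_cst].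
- rewrite -oppr0; apply: cvgN; rewrite -(mulr0 2); apply: cvgM; first exact: cvg_cst.
  under eq_fun do rewrite mulNr.
  apply: (@cvg_comp _ _ _ (fun s => s / 2) (fun s => expR (- s)) _ +oo).
    by apply: gt0_cvgMly => //; rewrite invr_gt0.
  exact: cvgr_expR.
- by move=> x _; exact: ex_derive.
- apply: cvg_at_right_filter.
  have /derivable1_diffP/differentiable_continuous h := @ex_derive _ _ _ _ _ _ _ (hd 0).
  exact: h.
- by move=> x _; rewrite derive1E derive_val.
Qed.

Let powR_exp_le (y : R) : 0 <= y -> exists C : R, 0 < C /\
  forall s : R, 0 < s -> s `^ y * expR (- s) <= C * expR (- s / 2).
Proof.
move=> y0; pose n := Num.truncn y.
have yN : y <= n.+1%:R by rewrite ltW// truncnS_gt.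
exists (1 + 2 ^+ n.+1 * n.+1`!%:R); split; first by rewrite ltr_wpDr.
move=> s s0; have s20 : 0 <= s / 2 by rewrite divr_ge0// ltW.
have h1 : s `^ y <= 1 + s ^+ n.+1.
  have [s1|s1] := leP s 1.
    rewrite (@le_trans _ _ (s `^ 0))//; first by rewrite ger_powR// s0.
    by rewrite powRr0 lerDl exprn_ge0// ltW.
  rewrite (@le_trans _ _ (s `^ n.+1%:R))//; first by rewrite ler_powR// ltW.
  by rewrite powR_mulrn ?(ltW s0)// lerDr.
have h2 : s ^+ n.+1 <= 2 ^+ n.+1 * n.+1`!%:R * expR (s / 2).
  have f0 : 0 < n.+1`!%:R :> R by rewrite ltr0n fact_gt0.
  have : (s / 2) ^+ n.+1 <= n.+1`!%:R * expR (s / 2).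
    have := expR_ge1Dxn n s20; rewrite -ler_pdivrMl// mulrC; lra.
  by rewrite expr_div_n ler_pdivrMr ?exprn_gt0// mulrC mulrA.
have -> : expR (- s) = expR (- s / 2) * expR (- s / 2).
  by rewrite -expRD; congr expR; field.
rewrite mulrA ler_wpM2r ?expR_ge0//.
apply: (@le_trans _ _ ((1 + 2 ^+ n.+1 * n.+1`!%:R * expR (s / 2)) * expR (- s / 2))).
  by rewrite ler_wpM2r ?expR_ge0// (le_trans h1)// lerD2l.
rewrite mulrDl mul1r -mulrA -expRD -mulrDl subrr mul0r expR0 mulr1 lerD2r.
by rewrite -[leRHS]expR0 ler_expR mulNr oppr_le0.
Qed.

Let gammae_lt1 x : 1 <= x ->
  (\int[mu]_(s in `]0%R, +oo[) (gamma_fun x s)%:E < +oo)%E.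
Proof.
move=> x1; have x10 : 0 <= x - 1 by rewrite subr_ge0.
have [C [C0 hC]] := powR_exp_le x10.
have mexp : measurable_fun [set: R] (fun s : R => expR (- s / 2)).
  by apply: measurableT_comp => //; apply: measurable_funM => //; exact: oppr_measurable.
apply: (@le_lt_trans _ _ (\int[mu]_(s in `]0%R, +oo[) (C * expR (- s / 2))%:E)%E).
  apply: ge0_le_integral => //=.
  - by move=> s _; rewrite lee_fin gamma_fun_ge0.
  - by apply/measurable_EFinP; exact: measurable_gamma_fun.
  - by apply/measurable_EFinP; apply: measurable_funTS; apply: measurable_funM.
  - by move=> s; rewrite in_itv/= andbT => s0; rewrite lee_fin hC.
under eq_integral do rewrite EFinM.
rewrite ge0_integralZl//=; last 2 first.
- by apply/measurable_EFinP; exact: measurable_funTS.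
- by rewrite lee_fin ltW.
rewrite integral_itv_obnd_cbnd; last by apply/measurable_EFinP; exact: measurable_funTS.
by rewrite expRh_int -EFinM ltry.
Qed.

(** The index is [n.+1] because [itvn 0] is reduced to the point 1, whereas integration by parts is
    applied with [a < b]. *)
Let gamma_parts x n (b := n.+2%:R : R) (a := n.+2%:R^-1 : R) :
  \int[mu]_(s in itvn n.+1) gamma_fun (x + 1) s =
  a `^ x * expR (- a) - b `^ x * expR (- b) + x * \int[mu]_(s in itvn n.+1) gamma_fun x s.
Proof.
have a0 : 0 < a by rewrite /a invr_gt0.
have b1 : 1 < b by rewrite /b ltr1n.
have ab : a < b by rewrite (lt_trans _ b1)// /a invf_lt1.
have hexp (s : R) : is_derive s 1 (fun s => - expR (- s)) (expR (- s)).
  by apply: is_derive_eq; rewrite /GRing.scale /=; ring.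
have := @Rintegration_by_parts R (fun s => s `^ x) (fun s => - expR (- s))
  (fun s => x * s `^ (x - 1)) (fun s => expR (- s)) a b ab.
have h1 : {within `[a, b], continuous (fun s => x * s `^ (x - 1))}.
  apply: continuous_in_subspaceT => s; rewrite inE /= in_itv/= => /andP[sa _].
  apply: cvgM; first exact: cvg_cst.
  exact: powR_continuous_at (lt_le_trans a0 sa).
have dp s : 0 < s -> derivable (fun s => s `^ x) s 1.
  by move=> s0; apply: derivable_powR; rewrite in_itv/= s0.
have h2 : derivable_oo_LRcontinuous (fun s => s `^ x) a b.
  split.
  - by move=> s; rewrite in_itv/= => /andP[sa _]; apply: dp; exact: lt_trans sa.
  - by apply: cvg_at_right_filter; exact: powR_continuous_at.
  - by apply: cvg_at_left_filter; apply: powR_continuous_at; exact: lt_trans ab.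
have h3 : {in `]a, b[, derive1 (fun s => s `^ x) =1 (fun s => x * s `^ (x - 1))}.
  move=> s; rewrite in_itv/= => /andP[sa _]; rewrite powR_derive1//.
  by rewrite in_itv/= andbT (lt_trans a0).
have h4 : {within `[a, b], continuous (fun s : R => expR (- s))}.
  by apply: continuous_subspaceT => s; exact: expRN_continuous.
have h5 : derivable_oo_LRcontinuous (fun s => - expR (- s)) a b.
  have hc s : {for s, continuous (fun s : R => - expR (- s))}.
    by apply: cvgN; exact: expRN_continuous.
  split.
  - by move=> s _; exact: ex_derive.
  - by apply: cvg_at_right_filter; exact: hc.
  - by apply: cvg_at_left_filter; exact: hc.
have h6 : {in `]a, b[, derive1 (fun s => - expR (- s)) =1 (fun s => expR (- s))}.
  by move=> s _; rewrite derive1E derive_val.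
move=> /(_ h1 h2 h3 h4 h5 h6).
rewrite (_ : (fun s => s `^ x * expR (- s)) = gamma_fun (x + 1)); last first.
  by apply/funext => s; rewrite /gamma_fun addrK.
move=> ->; rewrite (_ : (fun s => x * s `^ (x - 1) * - expR (- s)) =
  (fun s => - x * gamma_fun x s)); last first.
  by apply/funext => s; rewrite /gamma_fun; ring.
rewrite RintegralZl//; last exact: gamma_integrable.
rewrite -/(itvn n.+1); ring.
Qed.

Let gamma_bnd (x : R) : 0 < x -> exists2 C : R, 0 < C & forall s : R, 0 < s -> s `^ x * expR (- s) <= C.
Proof.
move=> x0; have [C [C0 hC]] := powR_exp_le (ltW x0).
exists C => // s s0; rewrite (le_trans (hC s s0))// ler_piMr ?(ltW C0)//.
by rewrite -[leRHS]expR0 ler_expR mulNr oppr_le0 divr_ge0// ltW.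
Qed.

(** For [x < 1] the integrand is singular at 0. Integration by parts read backwards bounds its
    integral by [(I + C) / x], where [I] is the integral at [x + 1 >= 1], finite by exponential
    decay, and [C] bounds a boundary term. *)
Lemma gamma_fun_lty x : 0 < x ->
  (\int[mu]_(s in `]0%R, +oo[) (gamma_fun x s)%:E < +oo)%E.
Proof.
move=> x0; have [C C0 hC] := gamma_bnd x0.
set I := (\int[mu]_(s in `]0%R, +oo[) (gamma_fun (x + 1) s)%:E)%E.
have If : (I < +oo)%E by apply: gammae_lt1; rewrite lerDr ltW.
have I0 : (0 <= I)%E by apply: integral_ge0 => s _; rewrite lee_fin gamma_fun_ge0.
have Ifin : I \is a fin_num by rewrite ge0_fin_numE.
apply: (@le_lt_trans _ _ ((fine I + C) / x)%:E); last exact: ltry.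
have hcv := @gamma_cvge x; rewrite -cvg_shiftS in hcv.
apply: (cvge_le _ hcv); apply: nearW => n.
have hA : (\int[mu]_(s in itvn n.+1) (gamma_fun x s)%:E =
    (\int[mu]_(s in itvn n.+1) gamma_fun x s)%:E)%E.
  rewrite /Rintegral fineK// ; apply: integrable_fin_num => //; first exact: measurable_itv.
  exact: gamma_integrable.
rewrite /= hA lee_fin ler_pdivlMr// mulrC.
have aux (A B E1 E2 J K : R) : B = E1 - E2 + A -> B <= J -> 0 <= E1 -> E2 <= K ->
   A <= J + K by lra.
apply: (aux _ _ _ _ _ _ (gamma_parts x n)); last exact: hC.
  rewrite /Rintegral fine_le//.
    apply: integrable_fin_num => //; first exact: measurable_itv.
    exact: gamma_integrable.
by rewrite mulr_ge0 ?powR_ge0 ?expR_ge0.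
Qed.

Lemma Gamma_cvg x : 0 < x -> (\int[mu]_(s in itvn n.+1) gamma_fun x s) @[n --> \oo] --> Gamma x.
Proof.
move=> x0.
have hf : (\int[mu]_(s in `]0%R, +oo[) (gamma_fun x s)%:E)%E \is a fin_num.
  rewrite ge0_fin_numE ?gamma_fun_lty//.
  by apply: integral_ge0 => s _; rewrite lee_fin gamma_fun_ge0.
have : (\int[mu]_(s in itvn n) gamma_fun x s) @[n --> \oo] --> Gamma x.
  apply: fine_cvg; rewrite fineK//; exact: gamma_cvge.
by rewrite -cvg_shiftS.
Qed.

Lemma GammaD1 x : 0 < x -> Gamma (x + 1) = x * Gamma x.
Proof.
move=> x0; have x10 : 0 < x + 1 by rewrite addr_gt0.
apply: (cvg_unique _ (Gamma_cvg x10)) => //.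
have -> : x * Gamma x = 0 - 0 + x * Gamma x by rewrite subrr add0r.
have -> : (fun n => \int[mu]_(s in itvn n.+1) gamma_fun (x + 1) s) =
    (fun n => n.+2%:R^-1 `^ x * expR (- n.+2%:R^-1) - n.+2%:R `^ x * expR (- n.+2%:R) +
              x * \int[mu]_(s in itvn n.+1) gamma_fun x s).
  by apply/funext => n; exact: gamma_parts.
apply: cvgD; last by apply: cvgM; [exact: cvg_cst|exact: Gamma_cvg].
have hinv : n.+2%:R^-1 @[n --> \oo] --> (0 : R).
  by have := @cvg_harmonic R; rewrite -(cvg_shiftS _).
apply: cvgB.
- apply: (@squeeze_cvgr _ _ _ _ (fun=> 0) (fun n => n.+2%:R^-1 `^ x)).
  + apply: nearW => n; rewrite mulr_ge0 ?powR_ge0 ?expR_ge0//=.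
    by rewrite ler_piMr ?powR_ge0// -[leRHS]expR0 ler_expR oppr_le0 invr_ge0.
  + exact: cvg_cst.
  + have h := powR_cvg0 x0; move/cvg_at_rightP : h; apply; split => // n.
- have [C [C0 hC]] := powR_exp_le (ltW x0).
  apply: (@squeeze_cvgr _ _ _ _ (fun=> 0) (fun n => C * expR (- n.+2%:R / 2))).
  + apply: nearW => n; rewrite mulr_ge0 ?powR_ge0 ?expR_ge0//=.
    exact: hC.
  + exact: cvg_cst.
  + rewrite -(mulr0 C); apply: cvgM; first exact: cvg_cst.
    have -> : (fun n => expR (- n.+2%:R / 2)) =
        (fun s => expR (- s) : R) \o (fun n => n.+2%:R / 2 : R).
      by apply/funext => n /=; rewrite mulNr.
    apply: (@cvg_comp _ _ _ (fun n => n.+2%:R / 2 : R) (fun s => expR (- s)) _ +oo).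
      2: exact: cvgr_expR.
    apply/cvgryPge => A; exists (Num.truncn (2 * `|A|)).+1 => // n /= hn.
    rewrite ler_pdivlMr// mulrC (@le_trans _ _ (2 * `|A|))//.
      by rewrite ler_wpM2l// ler_norm.
    by rewrite (le_trans (ltW (truncnS_gt _)))// ler_nat !leqW.
Qed.

Lemma Gamma_gt0 x : 0 < x -> 0 < Gamma x.
Proof.
move=> x0.
pose c := Num.min 1 (2 `^ (x - 1)) * expR (- 2) : R.
have c0 : 0 < c by rewrite mulr_gt0 ?expR_gt0// lt_min ltr01 powR_gt0.
suff : (c%:E <= \int[mu]_(s in `]0%R, +oo[) (gamma_fun x s)%:E)%E.
  move=> h; apply: (lt_le_trans c0).
  rewrite /Gamma /Rintegral -[leLHS]/(fine c%:E) fine_le//.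
  rewrite ge0_fin_numE ?gamma_fun_lty//.
  by apply: integral_ge0 => s _; rewrite lee_fin gamma_fun_ge0.
apply: (@le_trans _ _ (\int[mu]_(s in `[1%R, 2%R]) (gamma_fun x s)%:E)%E); last first.
  apply: ge0_subset_integral => //=.
  - by apply/measurable_EFinP; exact: measurable_gamma_fun.
  - by move=> s _; rewrite lee_fin gamma_fun_ge0.
  - by move=> s; rewrite /= !in_itv/= => /andP[s1 _]; rewrite (lt_le_trans _ s1).
apply: (@le_trans _ _ (\int[mu]_(s in `[1%R, 2%R]) c%:E)%E).
  rewrite integral_cst//= lebesgue_measure_itv/= lte_fin ltr1n/= -EFinB -EFinM.
  by rewrite lee_fin (_ : 2 - 1 = 1) ?mulr1//; ring.
apply: ge0_le_integral => //=.
- by move=> s _; rewrite lee_fin ltW.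
- by apply/measurable_EFinP; exact: measurable_gamma_fun.
- move=> s; rewrite in_itv/= => /andP[s1 s2]; rewrite lee_fin /c /gamma_fun.
  apply: ler_pM; rewrite ?expR_ge0 ?le_min ?ler01 ?powR_ge0//; last first.
    by rewrite ler_expR lerN2.
  rewrite ge_min; have [x1|x1] := leP 1 x.
    by apply/orP; left; rewrite -[leLHS](powRr0 s) ler_powR ?subr_ge0.
  apply/orP; right; have -> : x - 1 = - (1 - x) by ring.
  have s0 : 0 < s by rewrite (lt_le_trans _ s1).
  rewrite !powRN lef_pV2 ?posrE ?powR_gt0//.
  by rewrite ge0_ler_powR// ?nnegrE ?(ltW s0)// subr_ge0 ltW.
Qed.

End GammaFunction.

(** * Likelihood and score *)

Section Likelihood.
Variables (R : realType) (m : nat).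
Hypothesis hm : (0 < m)%N.
Local Notation mR := (m%:R : R).
Local Notation tt := (tt m).
Local Notation reach := (reach m).
Implicit Types (g : mgraph) (k n : nat) (d : R).

Lemma deg_size g v : (deg g v <= 2 * size g)%N.
Proof. by rewrite /deg mul2n -addnn leq_add// count_size. Qed.

Lemma lim_near_cst (u : nat -> R) (l : R) : (\forall n \near \oo, u n = l) -> limn u = l.
Proof.
move=> h; apply: (cvg_lim (@Rhausdorff R)).
apply: cvg_trans (_ : (fun _ : nat => l) @ \oo `=>` _); last exact: cvg_cst.
by apply: near_eq_cvg; apply: filterS h => n ->.
Qed.

Lemma NcountE n g j : (Ncount n g j)%:R = \sum_(0 <= v < n.+1) (deg g v == j)%:R :> R.
Proof.
rewrite /Ncount big_mkord -sum1_card natr_sum big_mkcond/=.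
by apply: eq_bigr => v _; rewrite finset.in_set; case: eqP.
Qed.

Lemma NgtE n g k : Ngt R n g k = \sum_(0 <= v < n.+1) (k < deg g v)%:R.
Proof.
apply: lim_near_cst; exists (2 * size g).+1 => // K /= hK.
under eq_bigr do rewrite NcountE.
rewrite exchange_big/=; apply: eq_bigr => v _.
have dK : (deg g v < K)%N by apply: leq_trans hK; rewrite ltnS deg_size.
have [kd|dk] := ltnP k (deg g v).
  rewrite (bigD1_seq (deg g v)) ?iota_uniq ?mem_index_iota ?kd ?dK//= eqxx.
  by rewrite big1 ?addr0// => j /negbTE; rewrite eq_sym => ->.
rewrite big_nat big1// => j /andP[kj _].
by rewrite ltn_eqF// (leq_ltn_trans dk).
Qed.

Definition cumul (f : nat -> R) (r : nat) : R := \sum_(m <= k < r) f k.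

(** A vertex of degree [r] has received edges while at degrees [m, ..., r - 1]. A statistic of the
    final degrees, such as the likelihood, thereby becomes a sum along the path. *)
Lemma dsum_cumul (f : nat -> R) k g : reach k g ->
  dsum (cumul f) (tt k) g = psum m (fun _ h v => f (deg h v)) g.
Proof.
elim: k g => [|k IH] g.
  by move=> ->; rewrite dsum0// psum0 /cumul big_geq// mulr0.
move=> [g' [v [hg vt ->]]]; rewrite dsum_step// IH// (psumS hm _ _ _ hg).
rewrite {3}/cumul big_geq// mulr0 addr0 /cumul big_nat_recr/=; last exact: (reach_deg hm hg).
by ring.
Qed.

Lemma tt_last n : (0 < n)%N -> tt (m * n.-1) = n.+1.
Proof. by case: n => // n _; rewrite /= -[(m * n)%N]addn0 tt_mulD. Qed.

Lemma sum_Ngt n g (f : nat -> R) : (0 < n)%N -> reach (m * n.-1) g ->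
  limn (fun K => \sum_(m <= k < K) (f k * Ngt R n g k)) =
  psum m (fun _ h v => f (deg h v)) g.
Proof.
move=> n0 hg; rewrite -(dsum_cumul f hg); apply: lim_near_cst.
exists (maxn m (2 * size g).+1) => // K /=; rewrite geq_max => /andP[mK hK].
under eq_bigr do rewrite NgtE mulr_sumr.
rewrite exchange_big/= /dsum (tt_last n0) big_nat [RHS]big_nat; apply: eq_bigr => v /andP[_ vn].
have dK : (deg g v < K)%N by apply: leq_trans hK; rewrite ltnS deg_size.
have md : (m <= deg g v)%N by apply: (reach_deg hm hg); rewrite (tt_last n0).
rewrite (big_cat_nat md (ltnW dK))/= [X in _ + X]big_nat [X in _ + X]big1; last first.
  by move=> k /andP[dk _]; rewrite ltnNge dk mulr0.
rewrite addr0 /cumul big_nat [RHS]big_nat; apply: eq_bigr => k /andP[_ kd].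
by rewrite kd mulr1.
Qed.

Lemma big_mul_nat (F : nat -> R) N :
  \sum_(0 <= k < m * N) F k = \sum_(0 <= t < N) \sum_(0 <= i < m) F (m * t + i)%N.
Proof.
elim: N => [|N IH]; first by rewrite muln0 !big_geq.
rewrite big_nat_recr//= -IH mulnS addnC (@big_cat_nat _ _ _ (m * N))//= ?leq_addr//.
congr (_ + _); rewrite -{1}[(m * N)%N]add0n big_addn addKn.
by apply: eq_bigr => i _; rewrite addnC.
Qed.

Lemma Snorm_Stot t i d : (i < m)%N -> Snorm m t.+2 i.+1 d = Stot m (m * t + i) d.
Proof.
move=> im; rewrite /Snorm /Stot tt_mulD// natrD natrM -!natr1; ring.
Qed.

Lemma sum_Snorm (F : R -> R) n d : (0 < n)%N ->
  \sum_(2 <= t < n.+1) \sum_(1 <= i < m.+1) F (Snorm m t i d) =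
  \sum_(0 <= k < m * n.-1) F (Stot m k d).
Proof.
case: n => // n _; rewrite big_mul_nat big_add1 big_add1/=.
by apply: eq_bigr => t _; rewrite big_add1/= big_nat [RHS]big_nat; apply: eq_bigr => i /andP[_ im]; rewrite Snorm_Stot.
Qed.

Definition loglik n g d : R :=
  psum m (fun _ h v => ln ((deg h v)%:R + d)) g - \sum_(0 <= k < m * n.-1) ln (Stot m k d).

Lemma iota_loglik n g d : (0 < n)%N -> reach (m * n.-1) g ->
  iota_n m n g d = n.+1%:R^-1 * loglik n g d.
Proof.
move=> n0 hg; rewrite /iota_n (sum_Ngt (fun k => ln (k%:R + d)) n0 hg).
by rewrite (sum_Snorm (@ln R))// /loglik mulrBr.
Qed.

Definition score n g d : R :=
  psum m (fun _ h v => invd d (deg h v)) g - \sum_(0 <= k < m * n.-1) (tt k)%:R / Stot m k d.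

Lemma psum_ln_derive k g d : reach k g -> - mR < d ->
  is_derive d 1 (fun d => psum m (fun _ h v => ln ((deg h v)%:R + d)) g)
    (psum m (fun _ h v => invd d (deg h v)) g).
Proof.
move=> + hd; elim: k g => [|k IH] g.
  move=> ->; rewrite psum0.
  have -> : (fun d => psum m (fun _ h v => ln ((deg h v)%:R + d)) (nseq m (0%N, 1%N))) = cst 0.
    by apply/funext => d'; rewrite psum0.
  exact: is_derive_cst.
move=> [g' [v [hg vt ->]]]; rewrite (psumS hm _ _ _ hg).
have -> : (fun d => psum m (fun _ h v => ln ((deg h v)%:R + d)) ((v, tt k) :: g')) =
  (fun d => psum m (fun _ h v => ln ((deg h v)%:R + d)) g' + ln ((deg g' v)%:R + d)).
  by apply/funext => d'; rewrite (psumS hm _ _ _ hg).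
have h1 := IH _ hg.
have pos : 0 < (deg g' v)%:R + d by apply: (natd_gt0 hm hd); exact: (reach_deg hm hg).
have h2 := is_derive1_ln pos.
have h3 : is_derive d 1 (fun d => (deg g' v)%:R + d) 1.
  by rewrite -[X in is_derive _ _ _ X]add0r; apply: is_deriveD.
have h4 := @is_derive1_comp R (@ln R) (fun d => (deg g' v)%:R + d) d _ _ h2 h3.
rewrite /invd -[((deg g' v)%:R + d)^-1]mulr1.
exact: is_deriveD.
Qed.

Lemma sum_lnS_derive N d : - mR < d ->
  is_derive d 1 (fun d => \sum_(0 <= k < N) ln (Stot m k d))
    (\sum_(0 <= k < N) (tt k)%:R / Stot m k d).
Proof.
move=> hd; elim: N => [|N IH].
  rewrite big_geq//; have -> : (fun d => \sum_(0 <= k < 0) ln (Stot m k d)) = cst 0.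
    by apply/funext => d'; rewrite big_geq.
  exact: is_derive_cst.
rewrite big_nat_recr//=.
have -> : (fun d => \sum_(0 <= k < N.+1) ln (Stot m k d)) =
   (fun d => \sum_(0 <= k < N) ln (Stot m k d) + ln (Stot m N d)).
  by apply/funext => d'; rewrite big_nat_recr.
have h2 := is_derive1_ln (Stot_gt0 N hd).
have h3 : is_derive d 1 (fun d => Stot m N d) (tt N)%:R.
  rewrite /Stot; apply: is_derive_eq; rewrite /GRing.scale /=; ring.
have h4 := @is_derive1_comp R (@ln R) (fun d => Stot m N d) d _ _ h2 h3.
rewrite mulrC; exact: is_deriveD.
Qed.

Lemma loglik_derive n g d : reach (m * n.-1) g -> - mR < d ->
  is_derive d 1 (loglik n g) (score n g d).
Proof.
move=> hg hd; rewrite /loglik /score.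
have h1 := psum_ln_derive hg hd; have h2 := sum_lnS_derive (m * n.-1) hd.
exact: is_deriveB.
Qed.

End Likelihood.

(** * The score as a martingale plus weighted variances, uniformly in the parameter *)

Section ScoreDecomposition.
Variables (R : realType) (m : nat).
Hypothesis hm : (0 < m)%N.
Local Notation mR := (m%:R : R).
Local Notation tt := (tt m).
Local Notation reach := (reach m).
Implicit Types (g : mgraph) (k n : nat) (d : R).
Variables (dmin dmax : R).
Hypothesis hmin : - mR < dmin.
Let ep : R := mR + dmin.
Let ep0 : 0 < ep. Proof. by have := hmin; rewrite /ep; lra. Qed.
Let m0 : 0 < mR := natm_gt0 R hm.

(* The conditional mean of the score increment at step [k] is
   [(dl (tt k) - d) * rho dl d k]; by [rho_variance] it is a weighted variance of the
   degrees. *)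
Definition rho (dl : nat -> R) (d : R) (k : nat) (g : mgraph) : R :=
  dsum (invd d) (tt k) g / Stot m k (dl (tt k)) -
  (tt k)%:R ^+ 2 / (Stot m k (dl (tt k)) * Stot m k d).

Lemma tt_gt0 k : 0 < (tt k)%:R :> R. Proof. by rewrite ltr0n. Qed.

Lemma Stot_ge k d : dmin <= d -> (tt k)%:R * ep <= Stot m k d.
Proof.
move=> hd; rewrite /Stot -[leLHS]addr0 lerD// ler_wpM2l// lerD2l//.
Qed.

Lemma invd_le d r : dmin <= d -> (m <= r)%N -> 0 <= invd d r <= (r%:R + dmin)^-1.
Proof.
move=> hd mr; have h0 := natd_gt0 hm hmin mr.
have h1 : 0 < r%:R + d by apply: (lt_le_trans h0); rewrite lerD2l.
by rewrite /invd invr_ge0 (ltW h1) /= lef_pV2 ?posrE// lerD2l.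
Qed.

Lemma invd_le_ep d r : dmin <= d -> (m <= r)%N -> 0 <= invd d r <= ep^-1.
Proof.
move=> hd mr; have /andP[-> h2] := invd_le hd mr; apply: (le_trans h2).
have h0 := natd_gt0 hm hmin mr.
by rewrite lef_pV2 ?posrE// /ep lerD2r ler_nat.
Qed.

Lemma invdB d d' r : dmin <= d -> dmin <= d' -> (m <= r)%N ->
  invd d r - invd d' r = - (d - d') * (invd d r * invd d' r).
Proof.
move=> hd hd' mr; have h0 := natd_gt0 hm hmin mr.
have h1 : 0 < r%:R + d by apply: (lt_le_trans h0); rewrite lerD2l.
have h2 : 0 < r%:R + d' by apply: (lt_le_trans h0); rewrite lerD2l.
by rewrite /invd; field; rewrite !gt_eqF.
Qed.

Section WithLaw.
Variable dl : nat -> R.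
Hypothesis hdl : forall t, dmin <= dl t.
Let hdl' t : - mR < dl t. Proof. exact: lt_le_trans (hdl t). Qed.
Local Notation cond := (cond m dl).
Local Notation E k := (Ex (flaw m dl k)).

Lemma cond_invd_rho d k g : dmin <= d -> reach k g ->
  cond k g (fun v => invd d (deg g v)) - (tt k)%:R / Stot m k d =
  (dl (tt k) - d) * rho dl d k g.
Proof.
move=> hd hg; have hd' : - mR < d by exact: lt_le_trans hd.
rewrite (condE hm dl (invd d) hg).
have -> : dsum (fun r => (r%:R + dl (tt k)) * invd d r) (tt k) g =
    (tt k)%:R + (dl (tt k) - d) * dsum (invd d) (tt k) g.
  rewrite -[(tt k)%:R]mulr1 -(dsum_cst _ _ g) -dsumZ -dsumD; apply: (eq_dsum hm hg) => r mr.
  have h := natd_gt0 hm hd' mr; rewrite /invd; field; rewrite gt_eqF//.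
have S1 := Stot_gt0 k (hdl' (tt k)); have S2 := Stot_gt0 k hd'.
have hS : Stot m k d - Stot m k (dl (tt k)) = (tt k)%:R * (d - dl (tt k)).
  by rewrite /Stot; ring.
rewrite /rho; set S := Stot m k d in S2 hS *; set S' := Stot m k _ in S1 hS *.
have -> : (tt k)%:R / S = (tt k)%:R / S' - (tt k)%:R * (S - S') / (S' * S).
  by field; rewrite !gt_eqF.
by rewrite hS; ring.
Qed.

(** Doob decomposition of the score at an arbitrary [d] under the true parameters [dl]; the
    conditional means carry the discrepancy [dl - d]. *)
Lemma score_decomp n g d : dmin <= d -> reach (m * n.-1) g ->
  score m n g d = psum m (cen m dl (invd d)) g +
     psum m (fun i h _ => (dl (tt i) - d) * rho dl d i h) g.
Proof.
move=> hd hg; rewrite /score -(psum_det hm (fun k => (tt k)%:R / Stot m k d) hg).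
rewrite -psumB -psumD; apply: (psum_eq hm hg) => i h v _ hi vt.
by rewrite -cond_invd_rho// /cen; ring.
Qed.

Definition degmean (k : nat) : R := mR + k%:R / (tt k)%:R.

(** With [a = Stot k d / tt k] one has [r - degmean k = (r + d) - a]; expanding the square against
    [1 / (r + d)] recovers the difference defining [rho]. In this form its sign and its comparison
    between two values of [d] are visible. *)
Lemma rho_variance d k g : dmin <= d -> reach k g ->
  rho dl d k g = (tt k)%:R ^+ 2 / (Stot m k (dl (tt k)) * Stot m k d ^+ 2) *
    dsum (fun r => (r%:R - degmean k) ^+ 2 * invd d r) (tt k) g.
Proof.
move=> hd hg; have hd' : - mR < d by exact: lt_le_trans hd.
have S1 := Stot_gt0 k (hdl' (tt k)); have S2 := Stot_gt0 k hd'.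
have t0 := tt_gt0 k.
pose a := Stot m k d / (tt k)%:R.
have ha : degmean k = a - d by rewrite /a /degmean /Stot; field; rewrite gt_eqF.
have -> : dsum (fun r => (r%:R - degmean k) ^+ 2 * invd d r) (tt k) g =
    Stot m k d - 2 * a * (tt k)%:R + a ^+ 2 * dsum (invd d) (tt k) g.
  rewrite (eq_dsum hm hg (f2 := fun r => (r%:R + d) + (- (2 * a) + a ^+ 2 * invd d r))).
    by rewrite dsumD (dsum_deg hm d hg) dsumD dsumZ dsum_cst; ring.
  move=> r mr; have h := natd_gt0 hm hd' mr; rewrite ha /invd; field; rewrite gt_eqF//.
by rewrite /rho /a; field; rewrite !gt_eqF.
Qed.

Lemma rho_ge0 d k g : dmin <= d -> reach k g -> 0 <= rho dl d k g.
Proof.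
move=> hd hg; have hd' : - mR < d by exact: lt_le_trans hd.
rewrite rho_variance// mulr_ge0//.
  by rewrite divr_ge0 ?sqr_ge0// mulr_ge0 ?sqr_ge0// ltW// Stot_gt0.
rewrite -(mulr0 (tt k)%:R) -(dsum_cst _ _ g); apply: (ler_dsum hm hg) => r mr.
by rewrite mulr_ge0 ?sqr_ge0//; case/andP: (invd_le hd mr).
Qed.

Lemma rho_le d k g : dmin <= d -> reach k g -> rho dl d k g <= ep^-1 ^+ 2.
Proof.
move=> hd hg; have hd' : - mR < d by exact: lt_le_trans hd.
have S1 := Stot_gt0 k (hdl' (tt k)); have S2 := Stot_gt0 k hd'.
have t0 := tt_gt0 k.
rewrite /rho lerBlDr -[leLHS]addr0 lerD//; last first.
  by rewrite divr_ge0 ?sqr_ge0// mulr_ge0 ?(ltW S1) ?(ltW S2).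
rewrite ler_pdivrMr//; apply: (@le_trans _ _ ((tt k)%:R * ep^-1)).
  rewrite -(dsum_cst _ _ g); apply: (ler_dsum hm hg) => r mr.
  by case/andP: (invd_le_ep hd mr).
have -> : (tt k)%:R * ep^-1 = ep^-1 ^+ 2 * ((tt k)%:R * ep) by field; rewrite gt_eqF.
by rewrite ler_wpM2l ?sqr_ge0// Stot_ge.
Qed.

Lemma rho_norm_le d k g : dmin <= d -> reach k g -> `|rho dl d k g| <= ep^-1 ^+ 2.
Proof. by move=> hd hg; rewrite ger0_norm ?rho_ge0 ?rho_le. Qed.

Lemma rho_lip d d' k g : dmin <= d -> dmin <= d' -> reach k g ->
  `|rho dl d k g - rho dl d' k g| <= 2 * ep^-1 ^+ 3 * `|d - d'|.
Proof.
move=> hd hd' hg.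
have hd1 : - mR < d by exact: lt_le_trans hd.
have hd2 : - mR < d' by exact: lt_le_trans hd'.
have S1 := Stot_gt0 k (hdl' (tt k)); have S2 := Stot_gt0 k hd1; have S3 := Stot_gt0 k hd2.
have t0 := tt_gt0 k.
have g1 := Stot_ge k (hdl (tt k)); have g2 := Stot_ge k hd; have g3 := Stot_ge k hd'.
have te0 : 0 < (tt k)%:R * ep by rewrite mulr_gt0.
have iV S : 0 < S -> (tt k)%:R * ep <= S -> 0 <= S^-1 <= ((tt k)%:R * ep)^-1.
  by move=> S0 h; rewrite invr_ge0 (ltW S0) /= lef_pV2 ?posrE.
have /andP[i1 j1] := iV _ S1 g1; have /andP[i2 j2] := iV _ S2 g2; have /andP[i3 j3] := iV _ S3 g3.
pose P := dsum (fun r => invd d r * invd d' r) (tt k) g.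
have hP : 0 <= P <= (tt k)%:R * ep^-1 ^+ 2.
  apply/andP; split.
    rewrite /P -(mulr0 (tt k)%:R) -(dsum_cst _ _ g); apply: (ler_dsum hm hg) => r mr.
    by rewrite mulr_ge0//; [case/andP: (invd_le hd mr)|case/andP: (invd_le hd' mr)].
  rewrite /P -(dsum_cst _ _ g); apply: (ler_dsum hm hg) => r mr; rewrite expr2.
  have /andP[a1 b1] := invd_le_ep hd mr; have /andP[a2 b2] := invd_le_ep hd' mr.
  by apply: ler_pM.
have -> : rho dl d k g - rho dl d' k g = - (d - d') * (P * (Stot m k (dl (tt k)))^-1 -
    (tt k)%:R ^+ 3 * ((Stot m k (dl (tt k)))^-1 * (Stot m k d)^-1 * (Stot m k d')^-1)).
  have hh : dsum (invd d) (tt k) g - dsum (invd d') (tt k) g = - (d - d') * P.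
    rewrite /P -dsumZ -[- dsum _ _ _]mulN1r -dsumZ -dsumD; apply: (eq_dsum hm hg) => r mr.
    by rewrite mulN1r invdB.
  have hS : Stot m k d - Stot m k d' = (tt k)%:R * (d - d') by rewrite /Stot; ring.
  rewrite mulrBr [X in _ = X - _]mulrA -hh /rho.
  have -> : - (d - d') * ((tt k)%:R ^+ 3 * ((Stot m k (dl (tt k)))^-1 * (Stot m k d)^-1 *
     (Stot m k d')^-1)) = - (tt k)%:R ^+ 2 * (Stot m k d - Stot m k d') *
     ((Stot m k (dl (tt k)))^-1 * (Stot m k d)^-1 * (Stot m k d')^-1) by rewrite hS; ring.
  by field; rewrite !gt_eqF.
rewrite normrM normrN mulrC ler_wpM2r//.
apply: (le_trans (ler_normB _ _)).
have /andP[P0 P1] := hP.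
have q1 : `|P * (Stot m k (dl (tt k)))^-1| <= ep^-1 ^+ 3.
  rewrite ger0_norm ?mulr_ge0//.
  apply: (le_trans (ler_pM P0 i1 P1 j1)).
  have -> : (tt k)%:R * ep^-1 ^+ 2 * ((tt k)%:R * ep)^-1 = ep^-1 ^+ 3 by field; rewrite !gt_eqF.
  exact: lexx.
have q2 : `|(tt k)%:R ^+ 3 * ((Stot m k (dl (tt k)))^-1 * (Stot m k d)^-1 * (Stot m k d')^-1)|
    <= ep^-1 ^+ 3.
  rewrite ger0_norm ?mulr_ge0 ?exprn_ge0//.
  have -> : ep^-1 ^+ 3 = (tt k)%:R ^+ 3 * (((tt k)%:R * ep)^-1 * ((tt k)%:R * ep)^-1 * ((tt k)%:R * ep)^-1).
    by field; rewrite !gt_eqF.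
  rewrite ler_wpM2l ?exprn_ge0 ?(ltW t0)//; apply: ler_pM => //; first exact: mulr_ge0.
  exact: ler_pM.
lra.
Qed.

(** [C] bounds both [(r + d) / (r + d0)] and the ratio of the two [Stot]; the exponent 3 counts
    [invd] once and [Stot] twice. It keeps the slope of the score away from 0 for all [d]
    simultaneously. *)
Lemma rho_compare d d0 k g : dmin <= d <= dmax -> dmin <= d0 <= dmax -> reach k g ->
  (1 + (dmax - dmin) / ep) ^- 3 * rho dl d0 k g <= rho dl d k g.
Proof.
move=> /andP[hd hd'] /andP[h0 h0'] hg; set C := 1 + _.
have hd1 : - mR < d by exact: lt_le_trans hd.
have hd2 : - mR < d0 by exact: lt_le_trans h0.
have mm : dmin <= dmax by exact: le_trans hd'.
have C1 : 1 <= C by rewrite lerDl divr_ge0 ?subr_ge0 ?(ltW ep0).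
have C0 : 0 < C by exact: lt_le_trans C1.
have cmp u : ep <= u + d0 -> u + d <= C * (u + d0).
  move=> hu; rewrite /C mulrDl mul1r.
  have : dmax - dmin <= (dmax - dmin) / ep * (u + d0).
    by rewrite mulrAC ler_pdivlMr// ler_wpM2l ?subr_ge0.
  lra.
have S1 := Stot_gt0 k (hdl' (tt k)); have S2 := Stot_gt0 k hd1; have S3 := Stot_gt0 k hd2.
have hS : Stot m k d <= C * Stot m k d0.
  rewrite /Stot [leRHS]mulrDr; apply: lerD; last by rewrite ler_peMl.
  by rewrite mulrCA ler_wpM2l// cmp// /ep lerD2l.
rewrite !rho_variance//.
have hV : C^-1 * dsum (fun r => (r%:R - degmean k) ^+ 2 * invd d0 r) (tt k) g <=
   dsum (fun r => (r%:R - degmean k) ^+ 2 * invd d r) (tt k) g.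
  rewrite -dsumZ; apply: (ler_dsum hm hg) => r mr; rewrite mulrCA ler_wpM2l ?sqr_ge0//.
  have p1 := natd_gt0 hm hd1 mr; have p2 := natd_gt0 hm hd2 mr.
  rewrite /invd -invfM lef_pV2 ?posrE ?mulr_gt0// cmp// /ep lerD// ler_nat//.
have hV0 : 0 <= dsum (fun r => (r%:R - degmean k) ^+ 2 * invd d0 r) (tt k) g.
  rewrite -(mulr0 (tt k)%:R) -(dsum_cst _ _ g); apply: (ler_dsum hm hg) => r mr.
  by rewrite mulr_ge0 ?sqr_ge0//; case/andP: (invd_le h0 mr).
set V := dsum _ _ _ in hV hV0 *; set V' := dsum _ _ _ in hV *.
have -> : C ^- 3 * ((tt k)%:R ^+ 2 / (Stot m k (dl (tt k)) * Stot m k d0 ^+ 2) * V) =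
  (tt k)%:R ^+ 2 / (Stot m k (dl (tt k)) * (C * Stot m k d0) ^+ 2) * (C^-1 * V).
  by field; rewrite !gt_eqF.
apply: ler_pM => //.
- by rewrite divr_ge0 ?sqr_ge0// mulr_ge0 ?sqr_ge0// ltW.
- by rewrite mulr_ge0// invr_ge0 ltW.
- rewrite ler_wpM2l ?sqr_ge0// lef_pV2 ?posrE ?mulr_gt0 ?exprn_gt0 ?mulr_gt0//.
  by rewrite ler_wpM2l ?(ltW S1)// lerXn2r ?nnegrE ?mulr_ge0 ?(ltW C0) ?(ltW S3) ?(ltW S2).
Qed.

Definition mart (f : nat -> R) (g : mgraph) : R := psum m (cen m dl f) g.

Lemma martE (f1 f2 : nat -> R) k g : reach k g ->
  (forall r, (m <= r < (2 * (k + m)).+1)%N -> f1 r = f2 r) -> mart f1 g = mart f2 g.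
Proof.
move=> hg hf; apply: (psum_eq hm hg) => i h v ik hi vt.
have hr u : (u < tt i)%N -> f1 (deg h u) = f2 (deg h u).
  move=> ut; apply: hf; rewrite (reach_deg hm hi ut) ltnS (leq_trans (deg_size _ _))//.
  by have [-> _ _ _] := reach_inv hm hi; rewrite leq_mul2l /= leq_add2r ltnW.
by rewrite /cen hr//; congr (_ - _); apply: (eq_cond hm hdl' hi).
Qed.

Lemma martZ c (f : nat -> R) g : mart (fun r => c * f r) g = c * mart f g.
Proof.
rewrite /mart -psumZ; congr (psum m _ g).
by apply/funext => i; apply/funext => h; apply/funext => v; rewrite /cen condZ mulrBr.
Qed.

Lemma martD (f1 f2 : nat -> R) g : mart (fun r => f1 r + f2 r) g = mart f1 g + mart f2 g.
Proof.
rewrite /mart -psumD; congr (psum m _ g).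
by apply/funext => i; apply/funext => h; apply/funext => v; rewrite /cen condD; ring.
Qed.

Lemma mart_sum (s : seq nat) (c : nat -> R) (F : nat -> nat -> R) g :
  mart (fun r => \sum_(j <- s) c j * F j r) g = \sum_(j <- s) c j * mart (F j) g.
Proof.
elim: s => [|a s IH].
  have := martZ 0 (fun=> 0) g; rewrite (mul0r (mart _ _)) big_nil => h; apply: etrans h; congr (mart _ g).
  by apply/funext => r; rewrite big_nil mul0r.
rewrite big_cons -IH -martZ -martD; congr (mart _ g).
by apply/funext => r; rewrite big_cons.
Qed.

Lemma mart_invdB d d' k g : dmin <= d -> dmin <= d' -> reach k g ->
  mart (invd d) g = mart (invd d') g - (d - d') * mart (fun r => invd d r * invd d' r) g.
Proof.
move=> hd hd' hg; rewrite -mulNr -martZ -martD; apply: (martE hg) => r /andP[mr _].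
by rewrite -invdB//; ring.
Qed.

(* The estimator depends on the whole graph, so the martingale with increments [f D]
   has to be bounded uniformly in [f]: it is the combination with coefficients [f r]
   of the martingales counting the degrees [r]. *)
Definition mart_env (k : nat) (g : mgraph) : R :=
  \sum_(m <= r < (2 * (k + m)).+1) (r%:R + dmin)^-1 ^+ 2 * `|mart (fun x => (x == r)%:R) g|.

Lemma mart_le_env (f : nat -> R) k g : reach k g ->
  (forall r, (m <= r)%N -> `|f r| <= (r%:R + dmin)^-1 ^+ 2) -> `|mart f g| <= mart_env k g.
Proof.
move=> hg hf.
rewrite (@martE f (fun x => \sum_(m <= r < (2 * (k + m)).+1) f r * (x == r)%:R) k g hg).
  rewrite mart_sum (le_trans (ler_norm_sum _ _ _))// /mart_env.
  rewrite big_nat [leRHS]big_nat; apply: ler_sum => r /andP[mr _].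
  by rewrite normrM ler_wpM2r// hf.
move=> r hr; rewrite (bigD1_seq r) ?iota_uniq ?mem_index_iota//= eqxx mulr1.
by rewrite big1 ?addr0// => j /negbTE; rewrite eq_sym => ->; rewrite mulr0.
Qed.

(** Telescoping of [1 / (u (u + 1))]. As the bound is independent of [B], [mart_env] stays of order
    [sqrt k] in mean although its range of degrees grows with [k]. *)
Lemma sum_inv_sqr_le B : \sum_(m <= r < B) (r%:R + dmin)^-1 ^+ 2 <= ep^-1 ^+ 2 + ep^-1.
Proof.
have h i : \sum_(m <= r < (m + i).+1) (r%:R + dmin)^-1 ^+ 2 <=
    ep^-1 ^+ 2 + ep^-1 - ((m + i)%:R + dmin)^-1.
  elim: i => [|i IH]; first by rewrite addn0 big_nat1 -/ep addrK.
  rewrite addnS big_nat_recr ?leqW ?leq_addr//=.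
  apply: (le_trans (lerD IH (lexx _))).
  have p := natd_gt0 hm hmin (leq_addr i m).
  set u := (m + i)%:R + dmin in p *.
  have -> : (m + i).+1%:R + dmin = u + 1 by rewrite -natr1 /u; ring.
  have p1 : 0 < u + 1 by lra.
  have : (u + 1)^-1 ^+ 2 <= u^-1 * (u + 1)^-1.
    by rewrite expr2 ler_wpM2r ?invr_ge0 ?(ltW p1)// lef_pV2 ?posrE// lerDl.
  have -> : u^-1 * (u + 1)^-1 = u^-1 - (u + 1)^-1 by field; rewrite !gt_eqF.
  lra.
have e0 : 0 <= ep^-1 by rewrite invr_ge0 ltW.
have [Bm|mB] := leqP B m; first by rewrite big_geq// addr_ge0 ?sqr_ge0.
rewrite -(ltn_predK mB); have mB' : (m <= B.-1)%N by rewrite -ltnS (ltn_predK mB).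
rewrite -(subnKC mB') (le_trans (h _))// lerBlDr lerDl invr_ge0 ltW//.
by rewrite subnKC//; exact: (natd_gt0 hm hmin mB').
Qed.

Lemma Ex_mart_sqr_le f c k : (forall r, (m <= r)%N -> `|f r| <= c) ->
  E k (fun g => mart f g ^+ 2) <= k%:R * c ^+ 2.
Proof. by move=> hf; apply: (Ex_mart_sqr hm hdl'). Qed.

Lemma Ex_mart_env k : E k (mart_env k) <= (ep^-1 ^+ 2 + ep^-1) * Num.sqrt k%:R.
Proof.
rewrite /mart_env Ex_sum.
apply: (@le_trans _ _ (\sum_(m <= r < (2 * (k + m)).+1) (r%:R + dmin)^-1 ^+ 2 * Num.sqrt k%:R)).
  apply: ler_sum => r _; rewrite ExZ ler_wpM2l ?sqr_ge0//.
  apply: (Ex_norm_sqrt hm hdl') => //.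
  have := @Ex_mart_sqr_le (fun x => (x == r)%:R) 1 k; rewrite expr1n mulr1; apply => x _.
  by case: eqP => _; rewrite ?normr1 ?normr0.
by rewrite -mulr_suml ler_wpM2r ?sqrtr_ge0// sum_inv_sqr_le.
Qed.

Lemma mart_env_ge0 k g : 0 <= mart_env k g.
Proof. by apply: sumr_ge0 => r _; rewrite mulr_ge0 ?sqr_ge0. Qed.

End WithLaw.
End ScoreDecomposition.

(** * Consistency and linearisation of the estimator *)

Section HighProbability.
Variables (R : realType) (m : nat).
Hypothesis hm : (0 < m)%N.
Local Notation mR := (m%:R : R).
Local Notation reach := (reach m).
Variables (dn : nat -> nat -> R) (kn : nat -> nat).
Hypothesis hdn : forall n t, - mR < dn n t.
Local Notation L n := (flaw m (dn n) (kn n)).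
Local Notation E n := (Ex (flaw m (dn n) (kn n))).
Implicit Types (X Y : nat * mgraph -> R).

(* Convergence in probability along the sequence of laws is convergence along
   this filter, so that the limit calculus of the library applies to it. *)
Definition whp : set_system (nat * mgraph) :=
  [set A | Pr (L n) (fun g => `[< ~ A (n, g) >]) @[n --> \oo] --> (0 : R)].

Lemma Pr_flaw_ge0 n (A : pred mgraph) : 0 <= Pr (L n) A.
Proof. by rewrite PrE; apply: (Ex_ge0 hm (hdn n)). Qed.

Lemma Pr_flaw_leU n (A B C : pred mgraph) :
  (forall g, reach (kn n) g -> A g -> B g || C g) ->
  Pr (L n) A <= Pr (L n) B + Pr (L n) C.
Proof.
move=> h; rewrite !PrE -ExD -PrE; apply: (Pr_le_Ex hm (hdn n)) => g hg.
  by rewrite addr_ge0.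
by move=> /(h _ hg); case: (B g); case: (C g) => //= _; rewrite ?addr0 ?add0r ?lerDl.
Qed.

Lemma whp_le (A : set (nat * mgraph)) (u : nat -> R) :
  (\forall n \near \oo, Pr (L n) (fun g => `[< ~ A (n, g) >]) <= u n) ->
  u @ \oo --> (0 : R) -> whp A.
Proof.
move=> h hu; apply: (squeeze_norm0 hu); apply: filterS h => n h.
by rewrite ger0_norm// Pr_flaw_ge0.
Qed.

Lemma whp_filter : Filter whp.
Proof.
split.
- apply: (@whp_le _ (fun=> 0)); last exact: cvg_cst.
  apply: nearW => n; rewrite -[leRHS](Ex_cst hm (hdn n) (kn n) 0) PrE; apply: (ler_Ex hm (hdn n)) => g _.
  by case: asboolP => // h; case: h.
- move=> A B hA hB; have h : (fun n => Pr (L n) (fun g => `[< ~ A (n, g) >]) +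
      Pr (L n) (fun g => `[< ~ B (n, g) >])) @ \oo --> (0 + 0 : R) by exact: cvgD.
  rewrite addr0 in h; apply: (@whp_le (A `&` B) _ _ h); apply: nearW => n; apply: Pr_flaw_leU => g _.
  move=> /asboolP hAB; apply/orP; have [a|a] := pselect (A (n, g)).
    by right; apply/asboolP => b; apply: hAB.
  by left; apply/asboolP.
- move=> A B sAB hA; apply: (@whp_le B _ _ hA); apply: nearW => n.
  have p0 : Pr (L n) pred0 = 0 by rewrite PrE (Ex_cst hm (hdn n)).
  rewrite -[leRHS]addr0 -[X in _ <= _ + X]p0.
  apply: Pr_flaw_leU => g _ /asboolP h; rewrite orbF; apply/asboolP => hh.
  by apply: h; apply: sAB.
Qed.

Local Instance whp_filter_inst : Filter whp := whp_filter.

Lemma whp_reach : \forall x \near whp, reach (kn x.1) x.2.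
Proof.
apply: (@whp_le _ (fun=> 0)); last exact: cvg_cst.
apply: nearW => n; rewrite -[leRHS](Ex_cst hm (hdn n) (kn n) 0) PrE; apply: (ler_Ex hm (hdn n)) => g hg.
by case: asboolP => // h; case: h.
Qed.

Lemma whp_fst : fst @ whp --> \oo.
Proof.
move=> A hA; apply: (@whp_le _ (fun=> 0)); last exact: cvg_cst.
apply: filterS hA => n hA.
rewrite -[leRHS](Ex_cst hm (hdn n) (kn n) 0) PrE; apply: (ler_Ex hm (hdn n)) => g hg.
by case: asboolP => // h; case: h.
Qed.

Lemma whp_det (u : nat -> R) (l : R) : u @ \oo --> l -> (fun x => u x.1) @ whp --> l.
Proof. by move=> hu; exact: (cvg_comp _ _ whp_fst hu). Qed.

Lemma whp_near (P : nat -> Prop) : (\forall n \near \oo, P n) -> \forall x \near whp, P x.1.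
Proof. exact: whp_fst. Qed.

Lemma whp_L1 X (l : R) (u : nat -> R) :
  (\forall n \near \oo, E n (fun g => `|X (n, g) - l|) <= u n) -> u @ \oo --> (0 : R) ->
  X @ whp --> l.
Proof.
move=> h hu; apply/cvgrPdist_lt => e e0.
apply: (@whp_le _ (fun n => u n / e)).
  apply: filterS h => n h.
  apply: (@le_trans _ _ (E n (fun g => `|X (n, g) - l|) / e)).
    apply: (markov hm (hdn n)) => // g _ /asboolP /negP; rewrite -leNgt distrC //.
  by rewrite ler_pM2r ?invr_gt0.
have h2 : (fun n => u n / e) @ \oo --> 0 / e.
  by apply: cvgM => //; exact: cvg_cst.
by rewrite mul0r in h2.
Qed.

(** Slutsky's principle: Markov's inequality keeps [|X|] below [a] up to probability [eta / 2], and
    there it suffices that [|Y|] be below [e / a]. *)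
Lemma whp_tight0 X Y (C : R) :
  (\forall n \near \oo, E n (fun g => `|X (n, g)|) <= C) -> Y @ whp --> (0 : R) ->
  (fun x => X x * Y x) @ whp --> (0 : R).
Proof.
move=> hX hY; pose D := `|C| + 1.
have D0 : 0 < D by rewrite ltr_wpDl.
have hX' : \forall n \near \oo, E n (fun g => `|X (n, g)|) <= D.
  apply: filterS hX => n /le_trans; apply; rewrite (le_trans (ler_norm _))// lerDl//.
apply/cvgrPdist_lt => e e0; apply/cvgrPdist_lt => eta eta0.
pose a := 2 * D / eta; have a0 : 0 < a by rewrite divr_gt0// mulr_gt0.
have hY1 : \forall x \near whp, `|0 - Y x| < e / a.
  by move/cvgrPdist_lt : hY; apply; rewrite divr_gt0.
move/cvgrPdist_lt : (hY1) => /(_ (eta / 2)); rewrite divr_gt0// => /(_ isT) hY2.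
apply: filterS2 hX' hY2 => n h1 h2.
rewrite sub0r normrN ger0_norm ?Pr_flaw_ge0//.
rewrite sub0r normrN ger0_norm ?Pr_flaw_ge0// in h2.
apply: (@le_lt_trans _ _ (Pr (L n) (fun g => a <= `|X (n, g)|) +
   Pr (L n) (fun g => `[< ~ (`|0 - Y (n, g)| < e / a) >]))).
  apply: Pr_flaw_leU => g _ /asboolP; rewrite !sub0r !normrN normrM => h.
  apply/orP; case: (leP a `|X (n, g)|) => [|ha]; first by left.
  right; apply/asboolP => hy; apply: h.
  have -> : e = a * (e / a) by rewrite mulrCA divff ?mulr1 ?gt_eqF.
  exact: ltr_pM.
have h3 : Pr (L n) (fun g => a <= `|X (n, g)|) <= eta / 2.
  apply: (@le_trans _ _ (E n (fun g => `|X (n, g)|) / a)).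
    exact: (markov hm (hdn n)).
  have -> : eta / 2 = D / a by rewrite /a; field; rewrite !gt_eqF.
  by rewrite ler_pM2r ?invr_gt0.
lra.
Qed.

Lemma whp_Pr_le (A B : nat -> pred mgraph) (a b : R) :
  (\forall x \near whp, A x.1 x.2 -> B x.1 x.2) ->
  (fun n => Pr (L n) (B n)) @ \oo --> b -> b < a ->
  \forall n \near \oo, Pr (L n) (A n) < a.
Proof.
move=> hAB hB ba.
have h : (fun n => Pr (L n) (B n) + Pr (L n) (fun g => `[< ~ (A n g -> B n g) >])) @ \oo --> b + 0.
  exact: cvgD.
rewrite addr0 in h.
have /cvgrPdist_lt := h; move=> /(_ (a - b)); rewrite subr_gt0 => /(_ ba).
apply: filterS => n hn.
apply: (@le_lt_trans _ _ (Pr (L n) (B n) + Pr (L n) (fun g => `[< ~ (A n g -> B n g) >]))).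
  apply: Pr_flaw_leU => g _ hA; apply/orP.
  have [hb|hb] := pselect (B n g); [by left|by right; apply/asboolP => /(_ hA)].
by move: hn; rewrite ltr_norml => /andP[]; lra.
Qed.

End HighProbability.

Lemma flaw_ext (R : realType) (m : nat) (dl dl' : nat -> R) k :
  (forall i, (i < k)%N -> dl (tt m i) = dl' (tt m i)) -> flaw m dl k = flaw m dl' k.
Proof.
elim: k => [//|k IH] h; rewrite /= h// IH// => i ik; apply: h; exact: ltnW.
Qed.

(** * Closed forms and positivity of the limit variances *)

Section LimitCovariance.
Variables (R : realType) (m : nat).
Hypothesis hm : (0 < m)%N.
Variable d : R.
Hypothesis hd : - m%:R < d.
Local Notation mR := (m%:R : R).
Let m0 : 0 < mR := natm_gt0 R hm.
Let B0 : 0 < Bden m d := Bden_gt0 hm hd.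
Let mr0 : 0 < mR + d. Proof. by have := hd; lra. Qed.
Let m2 : 0 < 2 * mR + d. Proof. by have := hd; have := m0; lra. Qed.

Lemma VxyE : Vxy m d = mR / (Bden m d * (2 * mR + d)).
Proof. by rewrite /Vxy /qlim plimm; field; rewrite !gt_eqF. Qed.

Lemma VxxE : Vxx m d = (mR + d) * mR * (1 + mR + d) / Bden m d ^+ 2.
Proof.
rewrite /Vxx /qlim plimm; have -> : 1 + mR + d = 1 + (mR + d) by ring.
have := B0; rewrite /Bden => b; field; rewrite !gt_eqF//.
Qed.

(** If [Vyy] were 0, [quad 1 v] would be affine in [v] with slope [2 * Vxy > 0]; the chosen [v]
    would give it the value -1. *)
Lemma Vyy_gt0 : 0 < Vyy m d.
Proof.
have hxy : 0 < Vxy m d by rewrite VxyE divr_gt0// mulr_gt0.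
have hyy : 0 <= Vyy m d.
  by have := quad_ge0 hm hd 0 1; rewrite /quad; lra.
rewrite lt_neqAle hyy andbT; apply/eqP => h.
have := quad_ge0 hm hd 1 (- (Vxx m d + 1) / (2 * Vxy m d)).
rewrite /quad -h mulr0 addr0.
have -> : 1 ^+ 2 * Vxx m d + 2 * 1 * (- (Vxx m d + 1) / (2 * Vxy m d)) * Vxy m d = -1.
  by field; rewrite gt_eqF.
lra.
Qed.

(** Comparison with [quad] at the mean weight [- 1 / (1 + a)]: the excess is [Vxx] times
    [1 / (1 + 2 a) - 1 / (1 + a)^2], the limiting variance of the weights [wprod], which is
    positive. *)
Lemma sig2_gt0 y : 0 < sig2 m d 1 y.
Proof.
pose a := wrate m d; have a0 : 0 < a by rewrite /a /wrate divr_gt0// mulr_gt0.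
have a1 : 0 < 1 + a by lra.
have a2 : 0 < 1 + 2 * a by lra.
have := quad_ge0 hm hd (- (1 + a)^-1) y; rewrite /quad => h.
have hx : 0 < Vxx m d.
  by rewrite VxxE divr_gt0 ?exprn_gt0// !mulr_gt0//; have := m0; have := mr0; lra.
rewrite /sig2 -/a.
apply: (le_lt_trans h); rewrite ltrD2r -subr_gt0.
set A := Vxx m d in hx *; set W := Vxy m d.
have -> : 1 ^+ 2 * A * (1 / (1 + 2 * a)) + 2 * (- 1) * y * W * (1 / (1 + a)) -
   ((- (1 + a)^-1) ^+ 2 * A + 2 * (- (1 + a)^-1) * y * W) =
   A * (a ^+ 2 / ((1 + 2 * a) * (1 + a) ^+ 2)) by field; rewrite !gt_eqF.
by rewrite mulr_gt0// divr_gt0// ?exprn_gt0// mulr_gt0// exprn_gt0.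
Qed.

End LimitCovariance.

Lemma sum_indicator_geq (R : realType) (a K : nat) :
  \sum_(0 <= i < K) (a <= i)%N%:R = (K - a)%:R :> R.
Proof.
elim: K => [|K IH]; first by rewrite big_geq.
rewrite big_nat_recr//= IH; case: leqP => h; first by rewrite subSn// -natr1.
by rewrite addr0; have -> : (K.+1 - a = K - a)%N by lia.
Qed.

Section Estimation.
Variables (R : realType) (m : nat).
Hypothesis hm : (0 < m)%N.
Local Notation mR := (m%:R : R).
Local Notation tt := (tt m).
Local Notation reach := (reach m).
Variables (dmin dmax d0 d1 : R).
Hypothesis hmin : - mR < dmin.
Hypothesis hd0 : dmin < d0 < dmax.
Hypothesis hd1 : dmin < d1 < dmax.
Variables (dn : nat -> nat -> R) (kt : nat -> nat).
Local Notation kn n := (m * n.-1)%N.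
Hypothesis hdn : forall n t, dn n t = d0 \/ dn n t = d1.
Hypothesis hlo : forall n k, (k < kt n)%N -> dn n (tt k) = d0.
Hypothesis hhi : forall n k, (kt n <= k)%N -> dn n (tt k) = d1.
Local Notation J n := ((kn n - kt n)%N%:R : R).
Local Notation K n := ((kn n)%:R : R).
Hypothesis hJ : (fun n => J n / K n) @ \oo --> (0 : R).
Let ep : R := mR + dmin.
Let ep0 : 0 < ep. Proof. by have := hmin; rewrite /ep; lra. Qed.
Let m0 : 0 < mR := natm_gt0 R hm.
Let ddmin n t : dmin <= dn n t.
Proof. by have /andP[? _] := hd0; have /andP[? _] := hd1; case: (hdn n t) => ->; exact: ltW. Qed.
Let ddlt n t : - mR < dn n t. Proof. exact: lt_le_trans (ddmin n t). Qed.
Let d0m : dmin <= d0. Proof. by case/andP: hd0 => /ltW. Qed.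
Let d0lt : - mR < d0. Proof. exact: lt_le_trans d0m. Qed.
Local Notation E n := (Ex (flaw m (dn n) (kn n))).
Local Notation WP := (whp m dn (fun n => kn n)).
Local Instance whp_filterE : Filter WP := whp_filter hm (fun n => kn n) ddlt.
Implicit Types (x : nat * mgraph) (d : R).

Lemma Ex_psum_dist (dl : nat -> R) (phi : nat -> mgraph -> R) (l : nat -> R) k :
  (forall t, - mR < dl t) ->
  Ex (flaw m dl k) (fun g => `|psum m (fun i h _ => phi i h) g - \sum_(0 <= i < k) l i|) <=
  \sum_(0 <= i < k) Ex (flaw m dl i) (fun g => `|phi i g - l i|).
Proof.
move=> hdl; apply: (@le_trans _ _ (Ex (flaw m dl k) (psum m (fun i h _ => `|phi i h - l i|)))).
  apply: (ler_Ex hm hdl) => g hg; rewrite -(psum_det hm l hg) -psumB.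
  exact: ler_norm_psum.
rewrite (Ex_psum hm hdl); apply: ler_sum => i _; rewrite le_eqVlt; apply/orP; left.
by apply/eqP; apply: (eq_Ex hm hdl) => g hg; rewrite (cond_cst hm hdl).
Qed.

Definition scoreM x := mart m (dn x.1) (invd d0) x.2.
Definition scoreR d x := psum m (fun i h _ => rho m (dn x.1) d i h) x.2.
Definition scoreS d x := psum m (fun i h _ => (dn x.1 (tt i) - d0) * rho m (dn x.1) d i h) x.2.
Definition scoreT d x := mart m (dn x.1) (fun r => invd d r * invd d0 r) x.2.
Definition scoreEnv x := mart_env m dmin (dn x.1) (kn x.1) x.2.

(** The factor [d - d0] has two sources: [mart_invdB] for the martingale, and
    [dl - d = (dl - d0) - (d - d0)] in the conditional means. *)
Lemma score_expand n g d : reach (kn n) g -> dmin <= d ->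
  score m n g d = scoreM (n, g) + scoreS d (n, g) - (d - d0) * (scoreR d (n, g) + scoreT d (n, g)).
Proof.
move=> hg hd; rewrite (score_decomp hm hmin (ddmin n) hd hg).
rewrite -/(mart m (dn n) (invd d) g) (mart_invdB hm hmin (ddmin n) hd d0m hg).
rewrite /scoreM /scoreS /scoreR /scoreT /=.
have -> : psum m (fun (i : nat) (h : mgraph) => fun=> (dn n (tt i) - d) * rho m (dn n) d i h) g =
   psum m (fun i h _ => (dn n (tt i) - d0) * rho m (dn n) d i h) g +
   (d0 - d) * psum m (fun i h _ => rho m (dn n) d i h) g.
  by rewrite -psumZ -psumD; apply: (psum_eq hm hg) => i h v _ _ _; ring.
ring.
Qed.

Lemma scoreT_le n g d : reach (kn n) g -> dmin <= d -> `|scoreT d (n, g)| <= scoreEnv (n, g).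
Proof.
move=> hg hd; apply: (mart_le_env hm hmin (ddmin n) hg) => r mr.
have /andP[a0 a1] := invd_le hm hmin hd mr; have /andP[b0 b1] := invd_le hm hmin d0m mr.
by rewrite ger0_norm ?mulr_ge0// expr2; apply: ler_pM.
Qed.

Lemma psum_le_tail n (phi : nat -> mgraph -> R) (c : R) g : reach (kn n) g -> 0 <= c ->
  (forall i h, reach i h -> `|phi i h| <= (kt n <= i)%N%:R * c) ->
  `|psum m (fun i h _ => phi i h) g| <= J n * c.
Proof.
move=> hg c0 h; apply: (le_trans (ler_norm_psum _ _ _)).
rewrite -sum_indicator_geq mulr_suml -(psum_det hm _ hg).
by apply: (psum_le hm hg) => i h' v _ hi _; exact: h.
Qed.

Lemma scoreS_le n g d : reach (kn n) g -> dmin <= d ->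
  `|scoreS d (n, g)| <= J n * ((dmax - dmin) * ep^-1 ^+ 2).
Proof.
move=> hg hd; have /andP[? ?] := hd0; have /andP[? ?] := hd1.
have mm : 0 <= dmax - dmin by lra.
apply: (psum_le_tail hg); first by rewrite mulr_ge0// sqr_ge0.
move=> i h hi; case: leqP => hk; last by rewrite hlo// subrr !mul0r normr0.
rewrite mul1r hhi// normrM; apply: ler_pM => //; last exact: (rho_norm_le hm hmin (ddmin n)).
by rewrite ler_norml; apply/andP; split; lra.
Qed.

Lemma scoreR_lip n g d d' : reach (kn n) g -> dmin <= d -> dmin <= d' ->
  `|scoreR d (n, g) - scoreR d' (n, g)| <= K n * (2 * ep^-1 ^+ 3 * `|d - d'|).
Proof.
move=> hg hd hd'; rewrite /scoreR /= -psumB.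
apply: (le_trans (ler_norm_psum _ _ _)).
have -> : K n * (2 * ep^-1 ^+ 3 * `|d - d'|) = \sum_(0 <= i < kn n) (2 * ep^-1 ^+ 3 * `|d - d'|).
  by rewrite sumr_const_nat subn0 -[RHS]mulr_natl.
rewrite -(psum_det hm (fun=> 2 * ep^-1 ^+ 3 * `|d - d'|) hg).
by apply: (psum_le hm hg) => i h v _ hi _; exact: (rho_lip hm hmin (ddmin n)).
Qed.

Lemma scoreR_compare n g d : reach (kn n) g -> dmin <= d <= dmax ->
  (1 + (dmax - dmin) / ep) ^- 3 * scoreR d0 (n, g) <= scoreR d (n, g).
Proof.
move=> hg hd; rewrite /scoreR /= -psumZ; apply: (psum_le hm hg) => i h v _ hi _.
apply: (rho_compare hm hmin (ddmin n)) => //.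
by have /andP[? ?] := hd0; rewrite !ltW.
Qed.

Lemma L1_rho : L1cvg m d0 (rho m (fun=> d0) d0) (Vyy m d0).
Proof.
have h : L1cvg m d0 (fun k g => dsum (invd d0) (tt k) g / Stot m k d0 -
    (tt k)%:R / Stot m k d0 * ((tt k)%:R / Stot m k d0)) (Vyy m d0).
  apply: (L1cvgB hm d0lt (L1_h hm d0lt)); apply: (L1cvg_det hm d0lt).
  by apply: cvgM; exact: (cvg_tt_Stot hm d0lt).
rewrite /L1cvg in h *.
apply: (cvg_ext h) => k; apply: (eq_Ex hm) => [//|g hg].
congr (`|_ - _|); rewrite /rho.
by have S0 := Stot_gt0 k d0lt; field; rewrite gt_eqF.
Qed.

Lemma cvg_kn : (fun n => kn n) @ \oo --> \oo.
Proof.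
apply/cvgnyPge => A; exists A.+1 => // n /= hn.
apply: (@leq_trans n.-1); first by case: n hn.
by rewrite leq_pmull.
Qed.

Lemma near_K_gt0 : \forall n \near \oo, 0 < K n.
Proof. by move/cvgnyPge : cvg_kn => /(_ 1%N); apply: filterS => n; rewrite ltr0n. Qed.

(** Before [kt n] the law is that of the constant parameter [d0], and [L1_rho] applies; each later
    step costs at most [c], and there are [J = o(K)] of them. *)
Lemma cvg_scoreR0 : (fun x => scoreR d0 x / K x.1) @ WP --> Vyy m d0.
Proof.
pose e i := Ex (flaw m (fun=> d0) i) (fun g => `|rho m (fun=> d0) d0 i g - Vyy m d0|).
pose c := ep^-1 ^+ 2 + `|Vyy m d0|.
have c0 : 0 <= c by rewrite addr_ge0// sqr_ge0.
apply: (whp_L1 hm ddlt (u := fun n => (\sum_(0 <= i < kn n) e i) / K n + c * (J n / K n))).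
  apply: filterS near_K_gt0 => n Kn.
  apply: (@le_trans _ _ ((K n)^-1 * E n (fun g => `|scoreR d0 (n, g) - \sum_(0 <= i < kn n) Vyy m d0|))).
    rewrite -ExZ; apply: (ler_Ex hm (ddlt n)) => g hg.
    rewrite sumr_const_nat subn0 -[Vyy m d0 *+ _]mulr_natl /=.
    have -> : scoreR d0 (n, g) / K n - Vyy m d0 = (K n)^-1 * (scoreR d0 (n, g) - K n * Vyy m d0).
      by rewrite mulrBr mulrA mulVf ?gt_eqF// mul1r mulrC.
    by rewrite normrM gtr0_norm ?invr_gt0.
  have -> : (\sum_(0 <= i < kn n) e i) / K n + c * (J n / K n) =
     (K n)^-1 * \sum_(0 <= i < kn n) (e i + (kt n <= i)%N%:R * c).
    by rewrite big_split /= -mulr_suml sum_indicator_geq; ring.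
  rewrite ler_wpM2l ?invr_ge0 ?(ltW Kn)//.
  apply: (le_trans (@Ex_psum_dist (dn n) (rho m (dn n) d0) (fun=> Vyy m d0) (kn n) (ddlt n))).
  apply: ler_sum => i _.
  have [hi|hi] := leqP (kt n) i.
    rewrite mul1r -[leLHS]add0r lerD//.
      by apply: (Ex_ge0 hm) => // g hg; exact: normr_ge0.
    apply: (Ex_le_cst hm (ddlt n)) => g hg.
    apply: (le_trans (ler_normB _ _)); rewrite lerD2r.
    exact: (rho_norm_le hm hmin (ddmin n)).
  rewrite mul0r addr0 /e (@flaw_ext _ _ (dn n) (fun=> d0)) => [|j ji].
    by rewrite /rho hlo.
  by apply: hlo; exact: ltn_trans hi.
have h1 : (fun n => (\sum_(0 <= i < kn n) e i) / K n) @ \oo --> (0 : R).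
  exact: (cvg_comp _ _ cvg_kn (cesaro_sum L1_rho)).
have h2 : (fun n => (\sum_(0 <= i < kn n) e i) / K n + c * (J n / K n)) @ \oo --> 0 + c * 0.
  by apply: cvgD => //; apply: cvgM => //; exact: cvg_cst.
by rewrite mulr0 addr0 in h2.
Qed.

Lemma Ex_scoreM n : E n (fun g => `|scoreM (n, g)|) <= ep^-1 * Num.sqrt (K n).
Proof.
have -> : ep^-1 * Num.sqrt (K n) = Num.sqrt (K n * ep^-1 ^+ 2).
  by rewrite sqrtrM ?ler0n// sqrtr_sqr ger0_norm ?invr_ge0 ?(ltW ep0)// mulrC.
apply: (Ex_norm_sqrt hm (ddlt n)); first by rewrite mulr_ge0 ?sqr_ge0.
apply: (Ex_mart_sqr_le hm hmin (ddmin n)) => r mr.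
by have /andP[a0 a1] := invd_le_ep hm hmin d0m mr; rewrite ger0_norm.
Qed.

Lemma cvg_sqrtK_V : (fun n => (Num.sqrt (K n))^-1) @ \oo --> (0 : R).
Proof. exact: (cvg_comp _ _ cvg_kn (@cvg_inv_sqrtn R)). Qed.

Lemma sqrtK_div n : Num.sqrt (K n) / K n = (Num.sqrt (K n))^-1.
Proof.
have [->|h] := eqVneq (K n) 0; first by rewrite sqrtr0 !invr0 mul0r.
have h0 : 0 < K n by rewrite lt_neqAle eq_sym h ler0n.
rewrite -{2}(sqr_sqrtr (ler0n _ (kn n))); field.
by rewrite gt_eqF// sqrtr_gt0.
Qed.

Lemma cvg_L1_sqrt (X : nat * mgraph -> R) (C : R) :
  (forall n, E n (fun g => `|X (n, g)|) <= C * Num.sqrt (K n)) ->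
  (fun x => X x / K x.1) @ WP --> (0 : R).
Proof.
move=> h; apply: (whp_L1 hm ddlt (u := fun n => C * (Num.sqrt (K n))^-1)).
  apply: filterS near_K_gt0 => n Kn.
  rewrite -sqrtK_div mulrA ler_pdivlMr// mulrC -ExZ; apply: (le_trans _ (h n)).
  apply: (ler_Ex hm (ddlt n)) => g hg.
  rewrite subr0 normrM [`|(K n)^-1|]gtr0_norm ?invr_gt0// mulrCA divff ?mulr1// gt_eqF//.
have h2 : (fun n => C * (Num.sqrt (K n))^-1) @ \oo --> C * 0.
  by apply: cvgM; [exact: cvg_cst|exact: cvg_sqrtK_V].
by rewrite mulr0 in h2.
Qed.

Lemma cvg_scoreM : (fun x => scoreM x / K x.1) @ WP --> (0 : R).
Proof. exact: (cvg_L1_sqrt Ex_scoreM). Qed.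

Lemma cvg_scoreEnv : (fun x => scoreEnv x / K x.1) @ WP --> (0 : R).
Proof.
apply: (@cvg_L1_sqrt _ (ep^-1 ^+ 2 + ep^-1)) => n.
rewrite (eq_Ex hm (ddlt n) (f2 := mart_env m dmin (dn n) (kn n))); last first.
  by move=> g hg; rewrite ger0_norm// mart_env_ge0.
exact: (Ex_mart_env hm hmin (ddmin n)).
Qed.

Variable dhat : nat -> mgraph -> R.
Hypothesis hdhat : is_estimator m dmin dmax dhat.
Local Notation dh x := (dhat x.1 x.2).

Lemma dhat_bounds n g : dmin <= dhat n g <= dmax.
Proof. by have [] := hdhat n g. Qed.

Lemma dhat_argmax n g d : (0 < n)%N -> reach (kn n) g -> dmin <= d <= dmax ->
  loglik m n g d <= loglik m n g (dhat n g).
Proof.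
move=> n0 hg hd; have [_ /(_ _ hd)] := hdhat n g.
by rewrite !(iota_loglik hm _ n0 hg) ler_pM2l// invr_gt0 ltr0n.
Qed.

(** A sign condition on the score replaces concavity: on the segment from [d0 + eps] or [d0 - eps]
    to a maximiser lying farther out, the mean value theorem would make the likelihood strictly
    larger at the near end. *)
Lemma dhat_close n g (eps : R) : (0 < n)%N -> reach (kn n) g -> 0 < eps ->
  (forall d, dmin <= d <= dmax -> eps <= `|d - d0| -> (d - d0) * score m n g d < 0) ->
  `|dhat n g - d0| <= eps.
Proof.
move=> n0 hg e0 h; have /andP[b1 b2] := dhat_bounds n g; have /andP[c1 c2] := hd0.
rewrite leNgt; apply/negP => hd.
have mvt b : dmin <= b <= dmax ->
    (forall x : R, Num.min b (dhat n g) <= x <= Num.max b (dhat n g) ->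
      eps <= `|x - d0| /\ 0 < (x - d0) * (dhat n g - b)) -> False.
  move=> hb hx; have /andP[b3 b4] := hb.
  have hr (x : R) : Num.min b (dhat n g) <= x <= Num.max b (dhat n g) -> dmin <= x <= dmax.
    by rewrite ge_min le_max => /andP[/orP[u|u] /orP[v|v]]; apply/andP; split; lra.
  have [|x hxx hE] := @mvt_between _ (loglik m n g) (score m n g) b (dhat n g).
    move=> x /hr /andP[x1 _]; apply: (loglik_derive hm hg).
    exact: lt_le_trans x1.
  have [x1 x2] := hx _ hxx; have x3 := h _ (hr _ hxx) x1.
  have := dhat_argmax n0 hg hb; rewrite -subr_ge0 hE => x4.
  have : 0 < (x - d0) ^+ 2.
    by rewrite exprn_even_gt0//= -normr_gt0; exact: lt_le_trans x1.
  set u := x - d0 in x2 x3 *; set v := dhat n g - b in x2 x4.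
  move=> u2; have : 0 <= u ^+ 2 * (score m n g x * v) by rewrite mulr_ge0// ltW.
  have -> : u ^+ 2 * (score m n g x * v) = (u * v) * (u * score m n g x) by ring.
  by rewrite leNgt pmulr_rlt0// x3.
have [hpos|hneg] := leP d0 (dhat n g).
  rewrite ger0_norm ?subr_ge0// in hd.
  apply: (mvt (d0 + eps)); first by apply/andP; split; lra.
  move=> x; rewrite min_l ?max_r; [|lra|lra] => /andP[x1 x2].
  rewrite ger0_norm; last lra.
  by split; [lra|apply: mulr_gt0; lra].
rewrite ltr0_norm ?subr_lt0// in hd.
apply: (mvt (d0 - eps)); first by apply/andP; split; lra.
move=> x; rewrite min_r ?max_l; [|lra|lra] => /andP[x1 x2].
rewrite ler0_norm; last lra.
by split; [lra|rewrite -mulrNN; apply: mulr_gt0; lra].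
Qed.

Lemma score_dhat0 n g : (0 < n)%N -> reach (kn n) g -> dmin < dhat n g < dmax ->
  score m n g (dhat n g) = 0.
Proof.
move=> n0 hg hd; have /andP[h1 h2] := hd.
have hin t : t \in `]dmin, dmax[ -> - mR < t /\ dmin <= t <= dmax.
  by rewrite in_itv /= => /andP[u v]; split; [exact: lt_trans u|rewrite !ltW].
have hD := @derive1_at_max _ (loglik m n g) dmin dmax (dhat n g) (ltW (lt_trans h1 h2)).
have {}hD : is_derive (dhat n g) 1 (loglik m n g) 0.
  apply: hD.
  - by move=> t /hin[ht _]; have [] := loglik_derive hm hg ht.
  - by rewrite in_itv /= h1.
  - by move=> t /hin[_ ht]; exact: dhat_argmax.
have hS := loglik_derive hm hg (lt_trans hmin h1).
by rewrite -(@derive_val _ _ _ _ _ _ _ hS) (@derive_val _ _ _ _ _ _ _ hD).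
Qed.

Lemma near_n_gt0 : \forall x \near WP, (0 < x.1)%N.
Proof. by apply: (whp_near hm (fun n => kn n) ddlt (P := fun n => (0 < n)%N)); exists 1%N. Qed.

Lemma near_K : \forall x \near WP, 0 < K x.1.
Proof. exact: (whp_near hm (fun n => kn n) ddlt (P := fun n => 0 < K n) near_K_gt0). Qed.

Lemma near_reach : \forall x \near WP, reach (kn x.1) x.2.
Proof. exact: (whp_reach hm (fun n => kn n) ddlt). Qed.

Lemma cvg_dhat : (fun x => dh x) @ WP --> d0.
Proof.
apply/cvgrPdist_le => eps e0.
pose c := (1 + (dmax - dmin) / ep) ^- 3; pose B' := (dmax - dmin) * ep^-1 ^+ 2.
have c0 : 0 < c.
  have /andP[? ?] := hd0.
  by rewrite /c invr_gt0 exprn_gt0// ltr_wpDr// divr_ge0 ?(ltW ep0)//; lra.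
(* [0 < G x] is an event free of [d] on which the sign condition of [dhat_close] holds for all [d]
   at distance at least [eps]; the limit of [G] is [eps * c * Vyy]. *)
pose G x : R := eps * (c * (scoreR d0 x / K x.1) - scoreEnv x / K x.1) -
   `|scoreM x / K x.1| - B' * (J x.1 / K x.1).
have hG : G @ WP --> (eps * (c * Vyy m d0 - 0) - `|0 : R| - B' * 0 : R).
  rewrite /G; apply: cvgB; last first.
    by apply: cvgM; [exact: cvg_cst|exact: (whp_det hm (fun n => kn n) ddlt hJ)].
  apply: cvgB; last by apply: cvg_norm; exact: cvg_scoreM.
  apply: cvgM; first exact: cvg_cst.
  apply: cvgB; last exact: cvg_scoreEnv.
  by apply: cvgM; [exact: cvg_cst|exact: cvg_scoreR0].
have {}hG := cvgr_gt _ hG.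
have {}hG : \forall x \near WP, 0 < G x.
  apply: hG; rewrite normr0 mulr0 !subr0 mulr_gt0// mulr_gt0//.
  exact: Vyy_gt0.
near=> x.
have hg : reach (kn x.1) x.2 by near: x; exact: near_reach.
have n0 : (0 < x.1)%N by near: x; exact: near_n_gt0.
have Kx : 0 < K x.1 by near: x; exact: near_K.
have Gx : 0 < G x by near: x.
rewrite distrC; apply: (dhat_close n0 hg e0) => d hd he.
have /andP[dl du] := hd.
rewrite (score_expand hg dl).
have hS := scoreS_le hg dl; have hT := scoreT_le hg dl.
have hR := scoreR_compare hg hd.
move: Gx; rewrite /G -surjective_pairing in hS hT hR *.
have -> : eps * (c * (scoreR d0 x / K x.1) - scoreEnv x / K x.1) - `|scoreM x / K x.1| -
   B' * (J x.1 / K x.1) = (eps * (c * scoreR d0 x - scoreEnv x) - `|scoreM x| - J x.1 * B') / K x.1.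
  by rewrite normrM [`|(K x.1)^-1|]gtr0_norm ?invr_gt0//; ring.
rewrite pmulr_lgt0 ?invr_gt0// => Gx.
set u := d - d0 in he *.
have hRT : c * scoreR d0 x - scoreEnv x <= scoreR d x + scoreT d x.
  by apply: lerD => //; move: hT; rewrite ler_norml => /andP[].
have hMS : u * (scoreM x + scoreS d x) <= `|u| * (`|scoreM x| + J x.1 * B').
  rewrite (le_trans (ler_norm _))// normrM ler_wpM2l//.
  by rewrite (le_trans (ler_normD _ _))// lerD.
have u2 : u ^+ 2 = `|u| ^+ 2 by rewrite real_normK// num_real.
have -> : u * (scoreM x + scoreS d x - u * (scoreR d x + scoreT d x)) =
  u * (scoreM x + scoreS d x) - u ^+ 2 * (scoreR d x + scoreT d x) by ring.
rewrite subr_lt0; apply: (le_lt_trans hMS).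
have u0 : 0 < `|u| by exact: lt_le_trans he.
rewrite u2 expr2 -mulrA ltr_pM2l//.
have q0 : 0 < c * scoreR d0 x - scoreEnv x.
  have : 0 <= J x.1 * B'.
    have /andP[? ?] := hd0; rewrite mulr_ge0// mulr_ge0 ?sqr_ge0//; lra.
  move=> hj; rewrite -(pmulr_rgt0 _ e0); have := normr_ge0 (scoreM x); lra.
apply: (@lt_le_trans _ _ (eps * (c * scoreR d0 x - scoreEnv x))); first lra.
by apply: ler_pM => //; exact: ltW.
Unshelve. all: by end_near. Qed.

Lemma near_dhat_interior : \forall x \near WP, dmin < dh x < dmax.
Proof.
have /andP[h1 h2] := hd0.
near=> x; apply/andP; split; near: x.
  exact: (cvgr_gt _ cvg_dhat).
exact: (cvgr_lt _ cvg_dhat).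
Unshelve. all: by end_near. Qed.

Definition scoreD x := (scoreR (dh x) x + scoreT (dh x) x) / K x.1.

Lemma cvg_scoreD : scoreD @ WP --> Vyy m d0.
Proof.
have h1 : (fun x => scoreR (dh x) x / K x.1 - scoreR d0 x / K x.1) @ WP --> (0 : R).
  have h : (fun x => 2 * ep^-1 ^+ 3 * `|dh x - d0|) @ WP --> 2 * ep^-1 ^+ 3 * `|d0 - d0|.
    apply: cvgM; first exact: cvg_cst.
    by apply: cvg_norm; apply: cvgB; [exact: cvg_dhat|exact: cvg_cst].
  rewrite subrr normr0 mulr0 in h; apply: (squeeze_norm0 h).
  near=> x.
  have hg : reach (kn x.1) x.2 by near: x; exact: near_reach.
  have Kx : 0 < K x.1 by near: x; exact: near_K.
  have /andP[d1' _] := dhat_bounds x.1 x.2.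
  rewrite -mulrBl normrM [`|(K x.1)^-1|]gtr0_norm ?invr_gt0// ler_pdivrMr// mulrC.
  have := scoreR_lip hg d1' d0m; rewrite -surjective_pairing //.
have h2 : (fun x => scoreT (dh x) x / K x.1) @ WP --> (0 : R).
  apply: (squeeze_norm0 cvg_scoreEnv); near=> x.
  have hg : reach (kn x.1) x.2 by near: x; exact: near_reach.
  have Kx : 0 < K x.1 by near: x; exact: near_K.
  have /andP[d1' _] := dhat_bounds x.1 x.2.
  rewrite normrM [`|(K x.1)^-1|]gtr0_norm ?invr_gt0// ler_pM2r ?invr_gt0//.
  by have := scoreT_le hg d1'; rewrite -surjective_pairing.
have h : (fun x => (scoreR (dh x) x / K x.1 - scoreR d0 x / K x.1) + scoreR d0 x / K x.1 +
   scoreT (dh x) x / K x.1) @ WP --> 0 + Vyy m d0 + 0.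
  by apply: cvgD => //; apply: cvgD => //; exact: cvg_scoreR0.
rewrite add0r addr0 in h; apply: (cvg_ext h) => x.
by rewrite /scoreD subrK mulrDl.
Unshelve. all: by end_near. Qed.

(** An exact equation for the error of the estimator rather than an expansion: [score_expand] at an
    interior zero of the score, the random slope being kept in [scoreD]. *)
Lemma dhat_equation : \forall x \near WP,
  (dh x - d0) * K x.1 * scoreD x = scoreM x + scoreS (dh x) x.
Proof.
near=> x.
have hg : reach (kn x.1) x.2 by near: x; exact: near_reach.
have n0 : (0 < x.1)%N by near: x; exact: near_n_gt0.
have Kx : 0 < K x.1 by near: x; exact: near_K.
have hi : dmin < dh x < dmax by near: x; exact: near_dhat_interior.
have h := score_dhat0 n0 hg hi; have /andP[i1 i2] := hi.
rewrite (score_expand hg (ltW i1)) -surjective_pairing in h.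
move/eqP : h; rewrite subr_eq0 => /eqP ->.
rewrite /scoreD -mulrA; congr (_ * _).
by rewrite mulrCA divff ?mulr1// gt_eqF.
Unshelve. all: by end_near. Qed.

Lemma near_scoreD_gt0 : \forall x \near WP, 0 < scoreD x.
Proof. by apply: (cvgr_gt _ cvg_scoreD); exact: Vyy_gt0. Qed.

(** As a function of [d], [plim m d m] is a quotient of two affine functions, so its increments
    factor exactly and no Taylor remainder appears. *)
Lemma plimmB (a b : R) : - mR < a -> - mR < b ->
  plim m a m - plim m b m = - (a - b) * (mR ^+ 2 / (Bden m a * Bden m b)).
Proof.
move=> ha hb; have := Bden_gt0 hm ha; have := Bden_gt0 hm hb.
by rewrite !plimm /Bden => B1 B2; field; rewrite !gt_eqF.
Qed.

Definition Qlin x : R := (Ncount x.1 x.2 m)%:R - x.1%:R * plim m (dh x) m.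

Lemma dh_gt x : - mR < dh x.
Proof. by have /andP[h _] := dhat_bounds x.1 x.2; exact: lt_le_trans h. Qed.

(** At the last step [tfrac] equals [(n + 1) - (n - 1) = 2], and [n] exceeds [K / m] by 1: hence the
    constant [2 - plim m d0 m]. *)
Lemma Qlin_expand : \forall x \near WP,
  Qlin x = Zr m d0 m (kn x.1) x.2 + (2 - plim m d0 m) +
    x.1%:R * (dh x - d0) * (mR ^+ 2 / (Bden m (dh x) * Bden m d0)).
Proof.
near=> x.
have n0 : (0 < x.1)%N by near: x; exact: near_n_gt0.
have hN : (Ncount x.1 x.2 m)%:R = Nr R m m (kn x.1) x.2.
  by rewrite NcountE /Nr /dsum tt_last.
have -> : Qlin x = (Ncount x.1 x.2 m)%:R - x.1%:R * plim m d0 m -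
    x.1%:R * (plim m (dh x) m - plim m d0 m) by rewrite /Qlin; ring.
rewrite (plimmB (dh_gt x) d0lt) hN /Zr eqxx /= mulr1n /tfrac tt_last//.
have -> : (kn x.1)%:R / mR = x.1%:R - 1 by rewrite natrM mulrC mulKf ?gt_eqF// -subn1 natrB.
rewrite -natr1; ring.
Unshelve. all: by end_near. Qed.

Lemma cvg_n_K : (fun n => n%:R / K n) @ \oo --> mR^-1.
Proof.
have h : (fun n => mR^-1 + (Num.sqrt (K n))^-1 * (Num.sqrt (K n))^-1) @ \oo --> mR^-1 + 0 * 0.
  by apply: cvgD; [exact: cvg_cst|apply: cvgM; exact: cvg_sqrtK_V].
rewrite mulr0 addr0 in h; apply: cvg_trans h; apply: near_eq_cvg.
apply: filterS near_K_gt0 => n Kn.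
have n0 : (0 < n)%N by case: n Kn => //=; rewrite muln0 ltxx.
rewrite -invfM -expr2 sqr_sqrtr ?ler0n//.
have -> : n%:R = K n / mR + 1 :> R.
  by rewrite natrM mulrC mulKf ?gt_eqF// -subn1 natrB// subrK.
by rewrite mulrDl mul1r mulrAC divff ?gt_eqF// mul1r.
Qed.

(* The conditional mean of the increment of [Z] when the current parameter is [d]; it
   is of order [1 / sqrt k] in mean as long as [d = d0], and of order 1 otherwise. *)
Definition drift_m (d : R) (i : nat) g : R :=
  - (mR + d) * (Nr R m m i g / Stot m i d) + (1 - plim m d0 m) / mR.

Lemma cond_Uinc_m dl i g : (forall t, - mR < dl t) -> reach i g ->
  cond m dl i g (fun v => Uinc m d0 m (deg g v)) = drift_m (dl (tt i)) i g.
Proof.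
move=> hdl hg; have := @cond_Uinc _ _ hm d0 dl m.-1 i g hdl hg.
rewrite prednK// eqxx /= => ->.
have -> : Nr R m m.-1 i g = 0.
  rewrite /Nr (@eq_dsum _ _ hm _ (fun=> 0) _ _ hg) ?dsum_cst ?mulr0// => r mr.
  by rewrite gtn_eqF// prednK.
by rewrite /drift_m; ring.
Qed.

Lemma drift_m_le i g : reach i g ->
  `|drift_m d0 i g| <= (mR + d0) / Stot m i d0 * (`|Zr m d0 m i g| + 4).
Proof.
move=> hg; have S0 := Stot_gt0 i d0lt; have B0 := Bden_gt0 hm d0lt.
have md0 : 0 < mR + d0 by have := d0lt; lra.
have m2 : 0 < 2 * mR + d0 by have := m0; lra.
have /andP[f1 f2] := tfrac_bounds R hm i.
have hp : plim m d0 m * (mR + d0) / (2 * mR + d0) = (1 - plim m d0 m) / mR.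
  by rewrite plimm; move: B0; rewrite /Bden => B0; field; rewrite !gt_eqF.
have hS : Stot m i d0 = tfrac R m i * (mR + d0) + i%:R / mR * (2 * mR + d0).
  by rewrite /Stot /tfrac; field; rewrite gt_eqF.
have hN : Nr R m m i g = Zr m d0 m i g + tfrac R m i + i%:R / mR * plim m d0 m.
  by rewrite /Zr eqxx /= mulr1n; ring.
pose q := plim m d0 m * (mR + d0) / (2 * mR + d0).
have -> : drift_m d0 i g = - ((mR + d0) / Stot m i d0) * (Zr m d0 m i g + (tfrac R m i * (1 - q))).
  rewrite /drift_m -hp hN /q.
  have -> : i%:R / mR * plim m d0 m = (Stot m i d0 - tfrac R m i * (mR + d0)) / (2 * mR + d0) * plim m d0 m.
    by rewrite hS; field; rewrite !gt_eqF.
  by field; rewrite !gt_eqF.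
have c0 : 0 <= (mR + d0) / Stot m i d0 by rewrite divr_ge0// ltW.
rewrite normrM normrN (ger0_norm c0).
rewrite ler_wpM2l ?divr_ge0 ?(ltW md0) ?(ltW S0)//.
rewrite (le_trans (ler_normD _ _))// lerD2l normrM.
have q0 : 0 <= q <= 1.
  rewrite /q -mulrA mulr_ge0 ?plim_ge0 ?divr_ge0 ?(ltW md0) ?(ltW m2)//=.
  rewrite mulrA hp ler_pdivrMr// mul1r.
  have := plim_ge0 hm d0lt m; have : 1 <= mR by rewrite ler1n.
  lra.
have /andP[q1 q2] := q0.
have -> : (4 : R) = 2 * 2 by ring.
by apply: ler_pM => //; rewrite ler_norml; apply/andP; split; lra.
Qed.

Lemma sum_inv_sqrt N : \sum_(0 <= i < N) (Num.sqrt (i%:R + 1 : R))^-1 <= 2 * Num.sqrt N%:R.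
Proof.
elim: N => [|N IH]; first by rewrite big_geq// sqrtr0 mulr0.
rewrite big_nat_recr//=; apply: (le_trans (lerD IH (lexx _))).
rewrite -(natr1 N); set s := Num.sqrt (N%:R + 1); set r := Num.sqrt N%:R.
have s0 : 0 < s by rewrite sqrtr_gt0 ltr_wpDl.
have r0 : 0 <= r by exact: sqrtr_ge0.
have hs : s ^+ 2 = r ^+ 2 + 1 by rewrite !sqr_sqrtr ?ler0n// addr_ge0.
have h2 : 0 <= (s - r) ^+ 2 by exact: sqr_ge0.
have : s^-1 <= 2 * (s - r).
  by rewrite -[s^-1]mul1r ler_pdivrMr//; rewrite !expr2 in hs h2; lra.
lra.
Qed.

Lemma Zr_psum k g : reach k g ->
  Zr m d0 m k g = psum m (fun _ h v => Uinc m d0 m (deg h v)) g +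
    Zr m d0 m 0 (nseq m (0%N, 1%N)).
Proof.
elim: k g => [|k IH] g; first by move=> ->; rewrite psum0 add0r.
move=> [g' [v [hg vt ->]]].
by rewrite (Zr_step hm d0 m hg vt) (psumS hm _ _ _ hg) IH// addrAC.
Qed.

(** The drift at step [i] is of order [|Z| / i], in mean [1 / sqrt i], and these sum to order
    [sqrt K]. *)
Lemma Ex_drift_pre : exists2 C, 0 <= C & forall n,
  E n (fun g => `|psum m (fun i h _ => (i < kt n)%N%:R * drift_m d0 i h) g|) <= C * Num.sqrt (K n).
Proof.
have [C C0 hC] := Zr_norm_le hm d0lt m.
have md0 : 0 < mR + d0 by have := d0lt; lra.
pose s0 := (mR + d0) / (1 + mR + d0).
have s00 : 0 < s0 by rewrite divr_gt0//; have := md0; lra.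
exists ((mR + d0) / s0 * (C + 4) * 2).
  by rewrite !mulr_ge0 ?invr_ge0 ?(ltW md0) ?(ltW s00)//; lra.
move=> n; have := @Ex_psum_dist (dn n) (fun i h => (i < kt n)%N%:R * drift_m d0 i h) (fun=> 0) (kn n) (ddlt n).
have -> : \sum_(0 <= i < kn n) (0 : R) = 0 by rewrite big1.
rewrite (eq_Ex hm (ddlt n) (f2 := fun g => `|psum m (fun i h _ => (i < kt n)%N%:R * drift_m d0 i h) g|)); last first.
  by move=> g _; rewrite subr0.
move=> h; apply: (le_trans h).
apply: (@le_trans _ _ (\sum_(0 <= i < kn n) (mR + d0) / s0 * (C + 4) * (Num.sqrt (i%:R + 1 : R))^-1)).
  apply: ler_sum => i _.
  have q0 : 0 < Num.sqrt (i%:R + 1 : R) by rewrite sqrtr_gt0 ltr_wpDl.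
  case: ltnP => hi; last first.
    rewrite (eq_Ex hm (ddlt n) (f2 := fun=> 0)) ?(Ex_cst hm (ddlt n)); last first.
      by move=> g _; rewrite mul0r subr0 normr0.
    by rewrite !mulr_ge0 ?invr_ge0 ?(ltW md0) ?(ltW s00) ?(ltW q0)//; lra.
  have S0 := Stot_gt0 i d0lt; have Slb := Stot_lb hm i d0lt; rewrite -/s0 in Slb.
  apply: (@le_trans _ _ (Ex (flaw m (dn n) i) (fun g => (mR + d0) / Stot m i d0 * (`|Zr m d0 m i g| + 4)))).
    apply: (ler_Ex hm (ddlt n)) => g hg; rewrite mul1r subr0; exact: drift_m_le.
  rewrite ExZ ExD (Ex_cst hm (ddlt n)).
  have := hC (dn n) (kt n) (ddlt n) (hlo (n := n)) i.
  have -> : (i - kt n = 0)%N by apply/eqP; rewrite subn_eq0 ltnW.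
  rewrite mulr0 addr0 => hZ.
  have q1 : 1 <= Num.sqrt (i%:R + 1 : R) by rewrite -[leLHS]sqrtr1 ler_sqrt ?lerDr// addr_ge0.
  have hq : i%:R + 1 = Num.sqrt (i%:R + 1 : R) ^+ 2 by rewrite sqr_sqrtr// addr_ge0.
  rewrite hq in Slb.
  set q := Num.sqrt _ in q0 q1 hZ Slb *.
  apply: (@le_trans _ _ ((mR + d0) / (s0 * q ^+ 2) * ((C + 4) * q))).
    apply: ler_pM.
    - by rewrite divr_ge0 ?(ltW md0) ?(ltW S0).
    - by rewrite addr_ge0// (Ex_ge0 hm (ddlt n)).
    - by rewrite ler_pM2l// lef_pV2 ?posrE// mulr_gt0// exprn_gt0.
    - lra.
  rewrite le_eqVlt; apply/orP; left; apply/eqP; field; rewrite !gt_eqF//.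
rewrite -mulr_sumr -[leRHS]mulrA ler_wpM2l ?sum_inv_sqrt//.
by rewrite !mulr_ge0 ?invr_ge0 ?(ltW md0) ?(ltW s00)//; lra.
Qed.

(** * Shifts produced by the late edges *)

Hypothesis hJpos : \forall n \near \oo, (kt n < kn n)%N.
Hypothesis hsqJ : (fun n => Num.sqrt (K n) / J n) @ \oo --> (0 : R).

Lemma near_J_gt0 : \forall n \near \oo, 0 < J n.
Proof. by apply: filterS hJpos => n hn; rewrite ltr0n subn_gt0. Qed.

Lemma cvg_L1_J (X : nat * mgraph -> R) (C : R) :
  (forall n, E n (fun g => `|X (n, g)|) <= C * Num.sqrt (K n)) ->
  (fun x => X x / J x.1) @ WP --> (0 : R).
Proof.
move=> h; apply: (whp_L1 hm ddlt (u := fun n => C * (Num.sqrt (K n) / J n))).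
  apply: filterS near_J_gt0 => n Jn.
  rewrite mulrA ler_pdivlMr// mulrC -ExZ; apply: (le_trans _ (h n)).
  apply: (ler_Ex hm (ddlt n)) => g hg.
  rewrite subr0 normrM [`|(J n)^-1|]gtr0_norm ?invr_gt0// mulrCA divff ?mulr1// gt_eqF//.
have h2 : (fun n => C * (Num.sqrt (K n) / J n)) @ \oo --> C * 0.
  by apply: cvgM; [exact: cvg_cst|exact: hsqJ].
by rewrite mulr0 in h2.
Qed.

Lemma near_kt_half : \forall n \near \oo, K n <= 2 * (kt n)%:R.
Proof.
have /cvgrPdist_lt := hJ => /(_ (2^-1)); rewrite invr_gt0 => /(_ (ltr0n _ 2)) h.
apply: filterS3 h near_K_gt0 hJpos => n h1 Kn kn'.
rewrite sub0r normrN ger0_norm ?divr_ge0// in h1.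
rewrite ltr_pdivrMr// in h1; rewrite natrB ?(ltnW kn')// in h1.
by move: h1; set a := (kt n)%:R; set b := K n; lra.
Qed.

Lemma cvg_kt : kt @ \oo --> \oo.
Proof.
apply/cvgnyPge => A.
have /cvgnyPge /(_ (2 * A)%N) h := cvg_kn.
apply: filterS2 h near_kt_half => n h1.
by rewrite -natrM ler_nat => h2; have := leq_trans h1 h2; rewrite leq_pmul2l.
Qed.

(* Convergence in [L^1] uniformly over the steps after the change. *)
Definition utail (phi : nat -> mgraph -> R) (l : R) := forall eps, 0 < eps ->
  \forall n \near \oo, forall i, (kt n <= i < kn n)%N ->
    Ex (flaw m (dn n) i) (fun g => `|phi i g - l|) <= eps.

Lemma near_tail (P : nat -> Prop) : (\forall i \near \oo, P i) ->
  \forall n \near \oo, forall i, (kt n <= i < kn n)%N -> P i.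
Proof.
move=> [N _ hN]; have /cvgnyPge /(_ N) := cvg_kt.
by apply: filterS => n hn i /andP[hi _]; apply: hN; exact: leq_trans hi.
Qed.

Lemma utail_det (u : nat -> R) l : u @ \oo --> l -> utail (fun i _ => u i) l.
Proof.
move=> hu eps e0; have /cvgrPdist_le /(_ _ e0) h := hu.
apply: filterS (near_tail h) => n hn i hi.
by rewrite (Ex_cst hm (ddlt n)) distrC; exact: hn.
Qed.

Lemma utail_lin a b phi psi l l' : utail phi l -> utail psi l' ->
  utail (fun i g => a * phi i g + b * psi i g) (a * l + b * l').
Proof.
move=> h1 h2 eps e0; pose D : R := `|a| + `|b| + 1.
have D0 : 0 < D by rewrite ltr_wpDl// addr_ge0.
have e1 : 0 < eps / D by rewrite divr_gt0.
apply: filterS2 (h1 _ e1) (h2 _ e1) => n g1 g2 i hi.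
apply: (@le_trans _ _ (Ex (flaw m (dn n) i)
    (fun g => `|a| * `|phi i g - l| + `|b| * `|psi i g - l'|))).
  apply: (ler_Ex hm (ddlt n)) => g _; rewrite -!normrM.
  have -> : a * phi i g + b * psi i g - (a * l + b * l') =
    a * (phi i g - l) + b * (psi i g - l') by ring.
  exact: ler_normD.
rewrite ExD !ExZ.
have -> : eps = `|a| * (eps / D) + `|b| * (eps / D) + eps / D.
  by rewrite -!mulrDl /D; field; rewrite gt_eqF.
by rewrite -[leLHS]addr0 !lerD// ?ler_wpM2l ?g1 ?g2// ltW.
Qed.

Lemma utail_mean phi l : utail phi l ->
  (fun x => psum m (fun i h _ => (kt x.1 <= i)%N%:R * phi i h) x.2 / J x.1) @ WP --> l.
Proof.
move=> h; apply: (whp_L1 hm ddlt (u := fun n => E n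
  (fun g => `|psum m (fun i h _ => (kt n <= i)%N%:R * phi i h) g / J n - l|))).
  by apply: nearW => n; exact: lexx.
apply/cvgrPdist_le => eps e0.
apply: filterS2 (h _ e0) near_J_gt0 => n hn Jn.
rewrite sub0r normrN ger0_norm; last by apply: (Ex_ge0 hm (ddlt n)).
rewrite -(ler_pM2l Jn) -ExZ.
apply: (@le_trans _ _ (E n (fun g => `|psum m (fun i h _ => (kt n <= i)%N%:R * phi i h) g -
   \sum_(0 <= i < kn n) (kt n <= i)%N%:R * l|))).
  apply: (ler_Ex hm (ddlt n)) => g hg.
  rewrite -mulr_suml sum_indicator_geq -[X in X * _](gtr0_norm Jn) -normrM mulrBr.
  by rewrite mulrCA divff ?mulr1// gt_eqF.
apply: (le_trans (@Ex_psum_dist (dn n) (fun i h => (kt n <= i)%N%:R * phi i h)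
  (fun i => (kt n <= i)%N%:R * l) (kn n) (ddlt n))).
rewrite -sum_indicator_geq mulr_suml big_nat [leRHS]big_nat; apply: ler_sum => i /andP[_ ik].
rewrite (eq_Ex hm (ddlt n) (f2 := fun g => (kt n <= i)%N%:R * `|phi i g - l|)); last first.
  by move=> g _; rewrite -mulrBr normrM normr_nat.
rewrite ExZ; case: leqP => hi; last by rewrite !mul0r.
by rewrite !mul1r hn// hi.
Qed.

Let d1lt : - mR < d1. Proof. by have /andP[? _] := hd1; apply: lt_trans hmin _. Qed.

(** The late edges are too few to move the degree frequencies: they contribute at most [C * J n],
    negligible against [i >= kt n >= K n / 2]. The limit is therefore taken under [plim m d0], while
    the normalisation sees [d1]. *)
Lemma utail_dsum (f : nat -> R) (F : R) : f r @[r --> \oo] --> 0 ->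
  (\sum_(m <= r < N) plim m d0 r * f r) @[N --> \oo] --> F ->
  utail (fun i g => dsum f (tt i) g / Stot m i d1) (F / (2 * mR + d1)).
Proof.
move=> hf hF eps e0.
pose s1 := (mR + d1) / (1 + mR + d1).
have md1 : 0 < mR + d1 by have := d1lt; lra.
have s10 : 0 < s1 by rewrite divr_gt0//; have := md1; lra.
have e1 : 0 < eps / 3 by rewrite divr_gt0.
have es : 0 < eps / 3 * s1 by rewrite mulr_gt0.
have [C C0 hC] := dsum_le hm d0lt hf hF es.
pose v i : R := C * (Num.sqrt (i.+1%:R))^-1 / s1 + `|F * ((tt i)%:R / Stot m i d1 - (2 * mR + d1)^-1)|.
have hv : v @ \oo --> (0 : R).
  have h : v @ \oo --> C * 0 / s1 + `|F * ((2 * mR + d1)^-1 - (2 * mR + d1)^-1)|.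
    apply: cvgD.
      apply: cvgM; last exact: cvg_cst.
      apply: cvgM; first exact: cvg_cst.
      have := @cvg_inv_sqrtn R.
      by rewrite -(cvg_shiftS (fun k : nat => (Num.sqrt (k%:R : R))^-1)).
    apply: cvg_norm; apply: cvgM; first exact: cvg_cst.
    by apply: cvgB; [exact: cvg_tt_Stot|exact: cvg_cst].
  by rewrite subrr !mulr0 mul0r normr0 addr0 in h.
have /cvgrPdist_le /(_ _ e1) h1 := hv; have {}h1 := near_tail h1.
have h2 : (fun n => 2 * C / s1 * (J n / K n)) @ \oo --> 2 * C / s1 * 0.
  by apply: cvgM; [exact: cvg_cst|exact: hJ].
rewrite mulr0 in h2; have /cvgrPdist_le /(_ _ e1) {}h2 := h2.
near=> n.
have g1 : forall i, (kt n <= i < kn n)%N -> `|0 - v i| <= eps / 3 by near: n.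
have g2 : `|0 - 2 * C / s1 * (J n / K n)| <= eps / 3 by near: n.
have Kn : 0 < K n by near: n; exact: near_K_gt0.
have Kh : K n <= 2 * (kt n)%:R by near: n; exact: near_kt_half.
move=> i hi; have /andP[ki ik] := hi.
have S0 := Stot_gt0 i d1lt; have Slb := Stot_lb hm i d1lt; rewrite -/s1 in Slb.
have i1 : 0 < i%:R + 1 :> R by rewrite ltr_wpDl.
apply: (@le_trans _ _ ((s1 * (i%:R + 1))^-1 * Ex (flaw m (dn n) i)
   (fun g => `|dsum f (tt i) g - (tt i)%:R * F|) +
   `|F * ((tt i)%:R / Stot m i d1 - (2 * mR + d1)^-1)|)).
  rewrite -ExZ -[X in _ <= _ + X](Ex_cst hm (ddlt n) i) -ExD.
  apply: (ler_Ex hm (ddlt n)) => g hg.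
  have -> : dsum f (tt i) g / Stot m i d1 - F / (2 * mR + d1) =
    (Stot m i d1)^-1 * (dsum f (tt i) g - (tt i)%:R * F) +
    F * ((tt i)%:R / Stot m i d1 - (2 * mR + d1)^-1) by ring.
  rewrite (le_trans (ler_normD _ _))// lerD2r normrM ler_wpM2r//.
  by rewrite gtr0_norm ?invr_gt0// lef_pV2 ?posrE// mulr_gt0.
have hD := hC (dn n) (kt n) (ddlt n) (hlo (n := n)) i.
have {}hD : Ex (flaw m (dn n) i) (fun g => `|dsum f (tt i) g - (tt i)%:R * F|) <=
    s1 * (i%:R + 1) * (eps / 3 + C * (Num.sqrt (i.+1%:R))^-1 / s1 + 2 * C / s1 * (J n / K n)).
  apply: (le_trans hD).
  have q0 : 0 < Num.sqrt (i%:R + 1 : R) by rewrite sqrtr_gt0.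
  have hq : i%:R + 1 = Num.sqrt (i%:R + 1 : R) ^+ 2 by rewrite sqr_sqrtr// ltW.
  have -> : s1 * (i%:R + 1) * (eps / 3 + C * (Num.sqrt (i.+1%:R))^-1 / s1 + 2 * C / s1 * (J n / K n)) =
     eps / 3 * s1 * (i%:R + 1) + C * ((i%:R + 1) / Num.sqrt (i%:R + 1)) + C * (J n * (2 * (i%:R + 1) / K n)).
    have aux (k j e3 q s a : R) : 0 < k -> 0 < q -> 0 < s ->
        s * a * (e3 + C * q^-1 / s + 2 * C / s * (j / k)) =
        e3 * s * a + C * (a / q) + C * (j * (2 * a / k)).
      by move=> k0 q0' s0; field; rewrite !gt_eqF.
    by rewrite -[i.+1%:R]natr1 aux.
  have -> : (i%:R + 1) / Num.sqrt (i%:R + 1 : R) = Num.sqrt (i%:R + 1).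
    by rewrite {1}hq expr2 mulfK// gt_eqF.
  rewrite lerD2l ler_wpM2l//.
  apply: (@le_trans _ _ (J n)); first by rewrite ler_nat leq_sub2r// ltnW.
  rewrite ler_peMr// ler_pdivlMr// mul1r (le_trans Kh)// ler_pM2l//.
  by rewrite (@le_trans _ _ i%:R) ?ler_nat// lerDl.
have si0 : 0 < s1 * (i%:R + 1) by rewrite mulr_gt0.
have := g1 i hi; rewrite sub0r normrN => /(le_trans (ler_norm _)).
move: g2; rewrite sub0r normrN => /(le_trans (ler_norm _)).
rewrite -(ler_pM2l (_ : 0 < (s1 * (i%:R + 1))^-1)) ?invr_gt0// in hD.
rewrite mulrA mulVf ?gt_eqF// mul1r in hD.
rewrite /v; lra.
Unshelve. all: by end_near. Qed.

Definition rho_alt : R := Hlim m d0 / (2 * mR + d1) - (2 * mR + d1)^-1 * (2 * mR + d0)^-1.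

Lemma utail_rho : utail (fun i g => rho m (fun=> d1) d0 i g) rho_alt.
Proof.
have h1 := utail_dsum (cvg_invd hm d0lt) (plim_invd_cvg hm d0lt).
have h2 : utail (fun i _ => (tt i)%:R / Stot m i d1 * ((tt i)%:R / Stot m i d0))
    ((2 * mR + d1)^-1 * (2 * mR + d0)^-1).
  by apply: utail_det; apply: cvgM; apply: cvg_tt_Stot.
have := utail_lin 1 (-1) h1 h2; rewrite /rho_alt.
rewrite mul1r mulN1r; congr (utail _ _); apply/funext => i; apply/funext => g.
have S1 := Stot_gt0 i d1lt; have S0 := Stot_gt0 i d0lt.
by rewrite /rho; field; rewrite !gt_eqF.
Qed.

Definition drift_alt : R := - (mR + d1) * (plim m d0 m / (2 * mR + d1)) + (1 - plim m d0 m) / mR.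

Lemma utail_drift : utail (drift_m d1) drift_alt.
Proof.
have h1 : utail (fun i g => dsum (is_m R m) (tt i) g / Stot m i d1) (plim m d0 m / (2 * mR + d1)).
  apply: utail_dsum.
    apply: cvg_near_cst; exists m.+1 => // r /= hr.
    by rewrite /is_m gtn_eqF.
  apply: cvg_near_cst; exists m.+1 => // N /= hN.
  rewrite big_ltn// big_nat big1 ?addr0 /is_m ?eqxx ?mulr1// => r /andP[hr _].
  by rewrite gtn_eqF// mulr0.
have h2 : utail (fun _ _ => (1 - plim m d0 m) / mR) ((1 - plim m d0 m) / mR).
  by apply: utail_det; exact: cvg_cst.
by have := utail_lin (- (mR + d1)) 1 h1 h2; rewrite mul1r.
Qed.

(** [rho] is Lipschitz in [d] with a constant common to all steps, so the estimator may be replaced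
    by its limit [d0]; a mean over the late steps remains. *)
Lemma cvg_scoreS_J : (fun x => scoreS (dh x) x / J x.1) @ WP --> (d1 - d0) * rho_alt.
Proof.
have h1 : (fun x => (d1 - d0) * (psum m (fun i h _ => (kt x.1 <= i)%N%:R * rho m (fun=> d1) d0 i h) x.2 / J x.1))
    @ WP --> (d1 - d0) * rho_alt.
  by apply: cvgM; [exact: cvg_cst|exact: (utail_mean utail_rho)].
pose c := (dmax - dmin) * (2 * ep^-1 ^+ 3).
have h2 : (fun x => c * `|dh x - d0|) @ WP --> c * `|d0 - d0|.
  apply: cvgM; first exact: cvg_cst.
  by apply: cvg_norm; apply: cvgB; [exact: cvg_dhat|exact: cvg_cst].
rewrite subrr normr0 mulr0 in h2.
have h3 : (fun x => scoreS (dh x) x / J x.1 -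
  (d1 - d0) * (psum m (fun i h _ => (kt x.1 <= i)%N%:R * rho m (fun=> d1) d0 i h) x.2 / J x.1))
    @ WP --> (0 : R).
  apply: (squeeze_norm0 h2); near=> x.
  have hg : reach (kn x.1) x.2 by near: x; exact: near_reach.
  have Jx : 0 < J x.1.
    near: x; exact: (whp_near hm (fun n => kn n) ddlt (P := fun n => 0 < J n) near_J_gt0).
  have /andP[dl _] := dhat_bounds x.1 x.2.
  set P := psum m _ _.
  have -> : scoreS (dh x) x / J x.1 - (d1 - d0) * (P / J x.1) =
    (scoreS (dh x) x - (d1 - d0) * P) / J x.1 by ring.
  rewrite normrM [`|(J x.1)^-1|]gtr0_norm ?invr_gt0// ler_pdivrMr// [leRHS]mulrC.
  rewrite /scoreS /P -psumZ -psumB.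
  have /andP[? ?] := hd0; have /andP[? ?] := hd1.
  have c0 : 0 <= c by rewrite mulr_ge0 ?mulr_ge0 ?exprn_ge0 ?invr_ge0 ?(ltW ep0)//; lra.
  apply: (psum_le_tail (phi := fun i h => (dn x.1 (tt i) - d0) * rho m (dn x.1) (dh x) i h -
     (d1 - d0) * ((kt x.1 <= i)%N%:R * rho m (fun=> d1) d0 i h)) hg); first by rewrite mulr_ge0.
  move=> i h hi; case: leqP => hk; last by rewrite hlo// subrr !mul0r mulr0 subrr normr0.
  have -> : rho m (fun=> d1) d0 i h = rho m (dn x.1) d0 i h by rewrite /rho hhi.
  rewrite hhi// !mul1r -mulrBr normrM /c -mulrA; apply: ler_pM => //.
    by rewrite ler_norml; apply/andP; split; lra.
  exact: (rho_lip hm hmin (ddmin x.1)).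
move: h1 h3; set P : nat * mgraph -> R := fun x => (d1 - d0) * _; set S : nat * mgraph -> R := fun x => scoreS _ x / _.
move=> h1 h3; have h : (fun x => (S x - P x) + P x) @ WP --> 0 + (d1 - d0) * rho_alt by exact: cvgD.
rewrite add0r in h; apply: (cvg_ext h) => x; exact: subrK.
Unshelve. all: by end_near. Qed.

Definition dhat_alt : R := mR^-1 * ((d1 - d0) * rho_alt / Vyy m d0).

Lemma cvg_dhat_J : (fun x => x.1%:R * (dh x - d0) / J x.1) @ WP --> dhat_alt.
Proof.
have hM : (fun x => scoreM x / J x.1) @ WP --> (0 : R) by exact: (cvg_L1_J Ex_scoreM).
have h : (fun x => x.1%:R / K x.1 * ((scoreM x / J x.1 + scoreS (dh x) x / J x.1) / scoreD x))
    @ WP --> mR^-1 * ((0 + (d1 - d0) * rho_alt) / Vyy m d0).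
  apply: cvgM; first exact: (whp_det hm (fun n => kn n) ddlt cvg_n_K).
  apply: cvgM; first by apply: cvgD => //; exact: cvg_scoreS_J.
  by apply: cvgV; [rewrite gt_eqF// Vyy_gt0|exact: cvg_scoreD].
rewrite add0r in h; apply: cvg_trans h; apply: near_eq_cvg; near=> x.
have Kx : 0 < K x.1 by near: x; exact: near_K.
have Dx : 0 < scoreD x by near: x; exact: near_scoreD_gt0.
rewrite -mulrDl; have <- : (dh x - d0) * K x.1 * scoreD x = scoreM x + scoreS (dh x) x.
  by near: x; exact: dhat_equation.
set k := K x.1 in Kx *; set j := J x.1.
have -> : (dh x - d0) * k * scoreD x / j / scoreD x = (dh x - d0) * k / j.
  by rewrite mulrAC mulfK// gt_eqF.
have aux (a D i l : R) : 0 < l -> a / l * (D * l * i) = a * D * i.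
  by move=> l0; field; rewrite gt_eqF.
exact: aux.
Unshelve. all: by end_near. Qed.

(** Doob decomposition of [Z] with the drift split at [kt]: the martingale and the early drift are
    of order [sqrt K = o(J)], so only the late drift is seen on the scale [J]. *)
Lemma cvg_Zr_J : (fun x => Zr m d0 m (kn x.1) x.2 / J x.1) @ WP --> drift_alt.
Proof.
pose c := 3 + `|(1 - plim m d0 m) / mR|.
have h1 : (fun x => mart m (dn x.1) (Uinc m d0 m) x.2 / J x.1) @ WP --> (0 : R).
  have c0 : 0 <= c by rewrite addr_ge0.
  apply: (@cvg_L1_J _ c) => n.
  have -> : c * Num.sqrt (K n) = Num.sqrt (K n * c ^+ 2).
    by rewrite sqrtrM ?ler0n// sqrtr_sqr ger0_norm// mulrC.
  apply: (Ex_norm_sqrt hm (ddlt n)); first by rewrite mulr_ge0 ?sqr_ge0.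
  apply: (Ex_mart_sqr_le hm hmin (ddmin n)) => r _.
  by have := Uinc_bound m d0 m r; rewrite eqxx.
have [C C0 hC] := Ex_drift_pre.
have h2 := @cvg_L1_J (fun x => psum m (fun i h _ => (i < kt x.1)%N%:R * drift_m d0 i h) x.2) C hC.
have h3 := utail_mean utail_drift.
pose z0 := Zr m d0 m 0 (nseq m (0%N, 1%N)).
have h4 : (fun x => z0 / J x.1) @ WP --> (0 : R).
  have hz : (fun n => z0 * (Num.sqrt (K n) / J n * (Num.sqrt (K n))^-1)) @ \oo --> z0 * (0 * 0).
    apply: cvgM; first exact: cvg_cst.
    by apply: cvgM; [exact: hsqJ|exact: cvg_sqrtK_V].
  rewrite !mulr0 in hz; have {}hz := whp_det hm (fun n => kn n) ddlt hz.
  apply: cvg_trans hz; apply: near_eq_cvg; near=> x.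
  have Kx : 0 < K x.1 by near: x; exact: near_K.
  by rewrite mulrAC divff ?mul1r// gt_eqF// sqrtr_gt0.
have h : (fun x => mart m (dn x.1) (Uinc m d0 m) x.2 / J x.1 +
    psum m (fun i h _ => (i < kt x.1)%N%:R * drift_m d0 i h) x.2 / J x.1 +
    psum m (fun i h _ => (kt x.1 <= i)%N%:R * drift_m d1 i h) x.2 / J x.1 + z0 / J x.1)
    @ WP --> 0 + 0 + drift_alt + 0.
  by do 3![apply: cvgD => //].
rewrite !add0r addr0 in h.
apply: cvg_trans h; apply: near_eq_cvg; near=> x.
have hg : reach (kn x.1) x.2 by near: x; exact: near_reach.
rewrite /= -!mulrDl; congr (_ / _).
rewrite (Zr_psum hg) -/z0; congr (_ + _); rewrite /mart -!psumD.
apply: (psum_eq hm hg) => i h v _ hi vt; rewrite /cen cond_Uinc_m//.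
case: ltnP => hk; first by rewrite hlo// mul1r mul0r; ring.
by rewrite hhi// mul0r mul1r; ring.
Unshelve. all: by end_near. Qed.

Definition Q_alt : R := drift_alt + dhat_alt * (mR ^+ 2 / (Bden m d0 * Bden m d0)).

Lemma cvg_Bden_dhat : (fun x => Bden m (dh x)) @ WP --> Bden m d0.
Proof.
rewrite /Bden; apply: cvgD; first exact: cvg_dhat.
apply: cvgM; first exact: cvg_cst.
by apply: cvgD; [exact: cvg_cst|exact: cvg_dhat].
Qed.

Lemma cvg_Q_J : (fun x => Qlin x / J x.1) @ WP --> Q_alt.
Proof.
have B0 := Bden_gt0 hm d0lt.
have h4 : (fun x => (2 - plim m d0 m) / J x.1) @ WP --> (0 : R).
  have hz : (fun n => (2 - plim m d0 m) * (Num.sqrt (K n) / J n * (Num.sqrt (K n))^-1)) @ \oo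
      --> (2 - plim m d0 m) * (0 * 0).
    apply: cvgM; first exact: cvg_cst.
    by apply: cvgM; [exact: hsqJ|exact: cvg_sqrtK_V].
  rewrite !mulr0 in hz; have {}hz := whp_det hm (fun n => kn n) ddlt hz.
  apply: cvg_trans hz; apply: near_eq_cvg; near=> x.
  have Kx : 0 < K x.1 by near: x; exact: near_K.
  by rewrite mulrAC divff ?mul1r// gt_eqF// sqrtr_gt0.
have h : (fun x => Zr m d0 m (kn x.1) x.2 / J x.1 + (2 - plim m d0 m) / J x.1 +
    x.1%:R * (dh x - d0) / J x.1 * (mR ^+ 2 / (Bden m (dh x) * Bden m d0))) @ WP -->
    drift_alt + 0 + dhat_alt * (mR ^+ 2 / (Bden m d0 * Bden m d0)).
  apply: cvgD; first by apply: cvgD; [exact: cvg_Zr_J|exact: h4].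
  apply: cvgM; first exact: cvg_dhat_J.
  apply: cvgM; first exact: cvg_cst.
  apply: cvgV; first by rewrite gt_eqF// mulr_gt0.
  by apply: cvgM; [exact: cvg_Bden_dhat|exact: cvg_cst].
rewrite addr0 in h; apply: cvg_trans h; apply: near_eq_cvg; near=> x.
have -> : Qlin x = Zr m d0 m (kn x.1) x.2 + (2 - plim m d0 m) +
    x.1%:R * (dh x - d0) * (mR ^+ 2 / (Bden m (dh x) * Bden m d0)).
  by near: x; exact: Qlin_expand.
ring.
Unshelve. all: by end_near. Qed.

(** [rho_alt] equals [Vyy * (2 m + d0) / (2 m + d1)], so [Vyy] drops out of [dhat_alt], and the two
    shifts add up to [d0 - d1] times a positive factor. *)
Lemma Q_alt_neq0 : d0 != d1 -> Q_alt != 0.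
Proof.
move=> ne; have B0 := Bden_gt0 hm d0lt; have V0 := Vyy_gt0 hm d0lt.
have p0 : 0 < 2 * mR + d0 by have := d0lt; have := m0; lra.
have p1 : 0 < 2 * mR + d1 by have := d1lt; have := m0; lra.
have q0 : 0 < mR + d0 by have := d0lt; lra.
have hr : rho_alt = Vyy m d0 * ((2 * mR + d0) / (2 * mR + d1)).
  by rewrite /rho_alt /Vyy; field; rewrite !gt_eqF.
have -> : Q_alt = (d0 - d1) * (mR ^+ 2 * (mR + d0) / (Bden m d0 ^+ 2 * (2 * mR + d1))).
  rewrite /Q_alt /dhat_alt hr /drift_alt plimm.
  have -> : mR^-1 * ((d1 - d0) * (Vyy m d0 * ((2 * mR + d0) / (2 * mR + d1))) / Vyy m d0) =
    mR^-1 * ((d1 - d0) * ((2 * mR + d0) / (2 * mR + d1))) by field; rewrite !gt_eqF.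
  by move: B0; rewrite /Bden => B0; field; rewrite !gt_eqF.
rewrite mulf_neq0 ?subr_eq0// gt_eqF// divr_gt0// mulr_gt0 ?exprn_gt0//.
Qed.

Lemma alt_reject (Wf : R -> R) (z : R) : d0 != d1 -> Wf x @[x --> d0] --> Wf d0 ->
  \forall x \near WP, Num.sqrt (x.1%:R * Wf (dh x)) * z < `|Qlin x|.
Proof.
move=> ne hW.
have hw : (fun x => x.1%:R / K x.1 * Wf (dh x)) @ WP --> mR^-1 * Wf d0.
  apply: cvgM; first exact: (whp_det hm (fun n => kn n) ddlt cvg_n_K).
  exact: (cvg_comp _ _ cvg_dhat hW).
have h1 : (fun x => Num.sqrt (x.1%:R / K x.1 * Wf (dh x)) * z * (Num.sqrt (K x.1) / J x.1)) @ WP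
    --> Num.sqrt (mR^-1 * Wf d0) * z * 0.
  apply: cvgM; last exact: (whp_det hm (fun n => kn n) ddlt hsqJ).
  apply: cvgM; last exact: cvg_cst.
  exact: (cvg_comp _ _ hw (@sqrt_continuous R (mR^-1 * Wf d0))).
rewrite mulr0 in h1.
have h2 : (fun x => `|Qlin x / J x.1| - Num.sqrt (x.1%:R / K x.1 * Wf (dh x)) * z * (Num.sqrt (K x.1) / J x.1))
   @ WP --> `|Q_alt| - 0.
  by apply: cvgB => //; apply: cvg_norm; exact: cvg_Q_J.
rewrite subr0 in h2.
near=> x.
have Kx : 0 < K x.1 by near: x; exact: near_K.
have Jx : 0 < J x.1.
  near: x; exact: (whp_near hm (fun n => kn n) ddlt (P := fun n => 0 < J n) near_J_gt0).
have : 0 < `|Qlin x / J x.1| - Num.sqrt (x.1%:R / K x.1 * Wf (dh x)) * z * (Num.sqrt (K x.1) / J x.1).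
  by near: x; apply: (cvgr_gt _ h2); rewrite normr_gt0 Q_alt_neq0.
have -> : x.1%:R * Wf (dh x) = K x.1 * (x.1%:R / K x.1 * Wf (dh x)).
  by rewrite mulrA mulrCA divff ?mulr1// gt_eqF.
rewrite (sqrtrM _ (ltW Kx)) normrM [`|(J x.1)^-1|]gtr0_norm ?invr_gt0//.
set s := Num.sqrt (x.1%:R / K x.1 * Wf (dh x)); set t := Num.sqrt (K x.1); set j := J x.1 in Jx *; set q := `|Qlin x|.
have -> : q * j^-1 - s * z * (t / j) = (q - t * s * z) / j by ring.
by rewrite pmulr_lgt0 ?invr_gt0// subr_gt0.
Unshelve. all: by end_near. Qed.

End Estimation.

Lemma whp_Pr_ge (R : realType) (m : nat) (hm : (0 < m)%N) (dn : nat -> nat -> R) (kn : nat -> nat)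
    (hdn : forall n t, - m%:R < dn n t) (A B : nat -> pred mgraph) (a b : R) :
  (\forall x \near whp m dn kn, B x.1 x.2 -> A x.1 x.2) ->
  (fun n => Pr (flaw m (dn n) (kn n)) (B n)) @ \oo --> b -> a < b ->
  \forall n \near \oo, a < Pr (flaw m (dn n) (kn n)) (A n).
Proof.
move=> hBA hB ab.
have hD : (fun n => Pr (flaw m (dn n) (kn n)) (B n) -
  Pr (flaw m (dn n) (kn n)) (fun g => `[< ~ (B n g -> A n g) >])) @ \oo --> b - 0.
  exact: cvgB.
rewrite subr0 in hD; have /cvgrPdist_lt := hD; move=> /(_ (b - a)); rewrite subr_gt0 => /(_ ab).
apply: filterS => n hn.
have : Pr (flaw m (dn n) (kn n)) (B n) <= Pr (flaw m (dn n) (kn n)) (A n) +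
    Pr (flaw m (dn n) (kn n)) (fun g => `[< ~ (B n g -> A n g) >]).
  apply: (Pr_flaw_leU hm hdn) => g _ hBg; apply/orP.
  by have [hAg|hAg] := pselect (A n g); [left|right; apply/asboolP => /(_ hBg)].
by move: hn; rewrite ltr_norml => /andP[]; lra.
Qed.

(** * The null model *)

Section Null.
Variables (R : realType) (m : nat).
Hypothesis hm : (0 < m)%N.
Local Notation mR := (m%:R : R).
Variables (dmin dmax d0 : R).
Hypothesis hmin : - mR < dmin.
Hypothesis hd0 : dmin < d0 < dmax.
Variable dhat : nat -> mgraph -> R.
Hypothesis hdhat : is_estimator m dmin dmax dhat.
Local Notation dh x := (dhat x.1 x.2).
Local Notation kn n := (m * n.-1)%N.
Local Notation K n := ((kn n)%:R : R).
Local Notation dn := (fun _ _ : nat => d0).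
Local Notation L n := (flaw m (fun=> d0) (kn n)).
Local Notation WP := (whp m dn (fun n => kn n)).
Let d0lt : - mR < d0. Proof. by have /andP[h _] := hd0; exact: lt_trans h. Qed.
(** The null model is treated as the case [d1 = d0], [kt = kn] of the estimation results, with no
    late edge. *)
Let hdn n t : dn n t = d0 \/ dn n t = d0. Proof. by left. Qed.
Let hlo n k : (k < kn n)%N -> dn n (tt m k) = d0. Proof. by []. Qed.
Let hhi n k : (kn n <= k)%N -> dn n (tt m k) = d0. Proof. by []. Qed.
Let hJ : (fun n => (kn n - kn n)%N%:R / K n) @ \oo --> (0 : R).
Proof.
have h : (fun _ : nat => 0 : R) @ \oo --> (0 : R) by exact: cvg_cst.
by apply: (cvg_ext h) => n; rewrite subnn mul0r.
Qed.
Let ddlt n t : - mR < dn n t. Proof. exact: d0lt. Qed.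
Local Instance whp_filterN : Filter WP := whp_filter hm (fun n => kn n) ddlt.
Implicit Types x : nat * mgraph.
Let m0 : 0 < mR := natm_gt0 R hm.
Let B0 : 0 < Bden m d0 := Bden_gt0 hm d0lt.
Let V0 : 0 < Vyy m d0 := Vyy_gt0 hm d0lt.

(** Estimation moves [Q] by about [n (dhat - d0) m^2 / Bden^2], and [dhat - d0] is close to
    [M / (K Vyy)]; as [n / K] tends to [1 / m], this is the resulting coefficient of [M]. *)
Definition kappa : R := mR / (Bden m d0 ^+ 2 * Vyy m d0).
Local Notation Y x := (Ystat m d0 1 kappa (kn x.1) x.2).

Lemma scoreS_null d x : scoreS m d0 dn d x = 0.
Proof.
rewrite /scoreS; have h := psumZ m 0 (fun i h (_ : nat) => rho m (fun=> d0) d i h) x.2.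
by rewrite mul0r in h; rewrite -[RHS]h subrr.
Qed.

(** [c] is the exact random coefficient of [M] in [Q / sqrt K]. It tends to [kappa] while [M] is
    bounded in [L^1], so [whp_tight0] allows the constant to replace it. *)
Lemma Q_null : (fun x => Qlin m dhat x / Num.sqrt (K x.1) - Y x) @ WP --> (0 : R).
Proof.
pose M x : R := scoreM m d0 dn x / Num.sqrt (K x.1).
pose c x : R := x.1%:R / K x.1 / scoreD m d0 dn dhat x * (mR ^+ 2 / (Bden m (dh x) * Bden m d0)).
have h1 : (fun x => c x - kappa) @ WP --> (0 : R).
  have h : (fun x => c x - kappa) @ WP -->
      mR^-1 / Vyy m d0 * (mR ^+ 2 / (Bden m d0 * Bden m d0)) - kappa.
    rewrite /c; apply: cvgB; last exact: cvg_cst.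
    apply: cvgM.
      apply: cvgM; first exact: (@whp_det R m hm dn (fun n => kn n) ddlt _ _ (@cvg_n_K R m hm)).
      apply: cvgV; first by rewrite gt_eqF.
      exact: (cvg_scoreD hm hmin hd0 hd0 hdn hlo hhi hJ hdhat).
    apply: cvgM; first exact: cvg_cst.
    apply: cvgV; first by rewrite gt_eqF// mulr_gt0.
    apply: cvgM; last exact: cvg_cst.
    exact: (cvg_Bden_dhat hm hmin hd0 hd0 hdn hlo hhi hJ hdhat).
  have e : mR^-1 / Vyy m d0 * (mR ^+ 2 / (Bden m d0 * Bden m d0)) - kappa = 0.
    by rewrite /kappa; field; rewrite !gt_eqF.
  by rewrite e in h.
have h2 : (fun x => M x * (c x - kappa)) @ WP --> (0 : R).
  apply: (@whp_tight0 _ _ hm _ _ ddlt M _ ((mR + dmin)^-1)) => //.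
  apply: filterS (@near_K_gt0 R m hm) => n Kn.
  have s0 : 0 < Num.sqrt (K n) by rewrite sqrtr_gt0.
  have h := Ex_scoreM hm hmin hd0 hd0 hdn n; rewrite -ler_pdivrMr// in h.
  apply: le_trans h; rewrite mulrC -ExZ; apply: (ler_Ex hm (ddlt n)) => g hg.
  by rewrite /M /= normrM [`|(Num.sqrt _)^-1|]gtr0_norm ?invr_gt0// mulrC.
have h3 : (fun x => (2 - plim m d0 m) * (Num.sqrt (K x.1))^-1) @ WP --> (2 - plim m d0 m) * 0.
  by apply: cvgM; [exact: cvg_cst|exact: (@whp_det R m hm dn (fun n => kn n) ddlt _ _ (@cvg_sqrtK_V R m hm))].
have h : (fun x => (2 - plim m d0 m) * (Num.sqrt (K x.1))^-1 + M x * (c x - kappa)) @ WP -->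
    (2 - plim m d0 m) * 0 + 0 by exact: cvgD.
rewrite mulr0 addr0 in h; apply: cvg_trans h; apply: near_eq_cvg; near=> x.
have Kx : 0 < K x.1.
  near: x; exact: (whp_near hm (fun n => kn n) ddlt (P := fun n => 0 < K n) (@near_K_gt0 R m hm)).
have Dx : 0 < scoreD m d0 dn dhat x.
  by near: x; exact: (near_scoreD_gt0 hm hmin hd0 hd0 hdn hlo hhi hJ hdhat).
have hE : (dh x - d0) * K x.1 * scoreD m d0 dn dhat x = scoreM m d0 dn x + scoreS m d0 dn (dh x) x.
  by near: x; exact: (dhat_equation hm hmin hd0 hd0 hdn hlo hhi hJ hdhat).
rewrite scoreS_null addr0 in hE.
have -> : Qlin m dhat x = Zr m d0 m (kn x.1) x.2 + (2 - plim m d0 m) +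
    x.1%:R * (dh x - d0) * (mR ^+ 2 / (Bden m (dh x) * Bden m d0)).
  by near: x; exact: (Qlin_expand hm hmin hd0 hd0 hdn hdhat).
rewrite /Ystat -[psum m _ _]/(scoreM m d0 dn x) mul1r /M -hE.
have s0 : 0 < Num.sqrt (K x.1) by rewrite sqrtr_gt0.
rewrite /c; set W := mR ^+ 2 / _; set Z := Zr _ _ _ _ _; set P := 2 - _.
have aux (a b k D s : R) : 0 < k -> 0 < D -> 0 < s ->
   P * s^-1 + b * k * D / s * (a / k / D * W - kappa) =
   (Z + P + a * b * W) / s - (Z + kappa * (b * k * D)) / s.
  by move=> k0 D0' s0'; field; rewrite !gt_eqF.
exact: aux.
Unshelve. all: by end_near. Qed.

Lemma sig2N y : sig2 m d0 (- 1) (- y) = sig2 m d0 1 y.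
Proof. by rewrite /sig2; ring. Qed.

(** Two one-sided limits, the one for [- Y] being [clt] at [(- 1, - kappa)]; the two events are
    disjoint because [a > 0]. *)
Lemma Pr_abs_Y (a : R) : 0 < a ->
  (fun n => Pr (L n) (fun g => a <= `|Ystat m d0 1 kappa (kn n) g|)) @ \oo -->
  2 * Phi (- a / Num.sqrt (sig2 m d0 1 kappa)).
Proof.
move=> a0; have s0 := sig2_gt0 hm d0lt kappa.
have h1 := cvg_comp _ _ (cvg_kn hm) (@clt R m hm d0 d0lt 1 kappa a s0).
have s0' : 0 < sig2 m d0 (- 1) (- kappa) by rewrite sig2N.
have h2 := cvg_comp _ _ (cvg_kn hm) (@clt R m hm d0 d0lt (- 1) (- kappa) a s0').
rewrite sig2N in h2.
have h : (fun n => Pr (L n) (fun g => a <= Ystat m d0 1 kappa (kn n) g) +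
   Pr (L n) (fun g => a <= Ystat m d0 (- 1) (- kappa) (kn n) g)) @ \oo -->
   Phi (- a / Num.sqrt (sig2 m d0 1 kappa)) + Phi (- a / Num.sqrt (sig2 m d0 1 kappa)).
  exact: cvgD.
have -> : 2 * Phi (- a / Num.sqrt (sig2 m d0 1 kappa)) =
  Phi (- a / Num.sqrt (sig2 m d0 1 kappa)) + Phi (- a / Num.sqrt (sig2 m d0 1 kappa)) by ring.
apply: (cvg_ext h) => n; rewrite !PrE -ExD; apply: (eq_Ex hm (ddlt n)) => g _.
have -> : Ystat m d0 (- 1) (- kappa) (kn n) g = - Ystat m d0 1 kappa (kn n) g.
  by rewrite /Ystat; ring.
set y := Ystat _ _ _ _ _ _; rewrite ler_normr.
case: (leP a y) => h3; case: (leP a (- y)) => h4 //=; rewrite ?addr0 ?add0r//.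
by exfalso; lra.
Qed.

Lemma null_limit (Wf : R -> R) (z : R) : 0 < z -> Wf x @[x --> d0] --> Wf d0 ->
  Wf d0 = mR * sig2 m d0 1 kappa ->
  (fun n => Pr (L n) (fun g => Num.sqrt (n%:R * Wf (dhat n g)) * z <= `|Qlin m dhat (n, g)|)) @ \oo
   --> 2 * Phi (- z).
Proof.
move=> z0 hW hWs; pose s := Num.sqrt (sig2 m d0 1 kappa).
have s0 : 0 < s by rewrite sqrtr_gt0 sig2_gt0.
pose a := s * z; have a0 : 0 < a by rewrite mulr_gt0.
have hw : (fun x => x.1%:R / K x.1 * Wf (dh x)) @ WP --> mR^-1 * Wf d0.
  apply: cvgM; first exact: (@whp_det R m hm dn (fun n => kn n) ddlt _ _ (@cvg_n_K R m hm)).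
  exact: (cvg_comp _ _ (cvg_dhat hm hmin hd0 hd0 hdn hlo hhi hJ hdhat) hW).
have hT : (fun x => Num.sqrt (x.1%:R / K x.1 * Wf (dh x)) * z) @ WP --> a.
  have -> : a = Num.sqrt (mR^-1 * Wf d0) * z by rewrite hWs mulKf ?gt_eqF.
  apply: cvgM; last exact: cvg_cst.
  exact: (cvg_comp _ _ hw (@sqrt_continuous R (mR^-1 * Wf d0))).
pose T n g := Num.sqrt (n%:R * Wf (dhat n g)) * z.
(* With high probability the rescaled random threshold is within [e / 2] of [a] and [Q / sqrt K]
   within [e / 2] of [Y], so rejection lies between two events on [|Y|] alone. *)
have hkey e : 0 < e -> \forall x \near WP,
    (T x.1 x.2 <= `|Qlin m dhat x| -> a - e <= `|Y x|) /\
    (a + e <= `|Y x| -> T x.1 x.2 <= `|Qlin m dhat x|).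
  move=> e0; have e2 : 0 < e / 2 by rewrite divr_gt0.
  near=> x.
  have Kx : 0 < K x.1.
    near: x; exact: (whp_near hm (fun n => kn n) ddlt (P := fun n => 0 < K n) (@near_K_gt0 R m hm)).
  have r0 : 0 < Num.sqrt (K x.1) by rewrite sqrtr_gt0.
  have b1 : `|0 - (Qlin m dhat x / Num.sqrt (K x.1) - Y x)| < e / 2.
    by near: x; have /cvgrPdist_lt := Q_null; apply.
  have b2 : `|a - Num.sqrt (x.1%:R / K x.1 * Wf (dh x)) * z| < e / 2.
    by near: x; have /cvgrPdist_lt := hT; apply.
  have hTx : T x.1 x.2 = Num.sqrt (K x.1) * (Num.sqrt (x.1%:R / K x.1 * Wf (dh x)) * z).
    rewrite /T mulrA -(sqrtrM _ (ltW Kx)); congr (Num.sqrt _ * z).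
    by rewrite mulrA mulrCA divff ?mulr1// gt_eqF.
  have hQx : `|Qlin m dhat x| = Num.sqrt (K x.1) * `|Qlin m dhat x / Num.sqrt (K x.1)|.
    rewrite normrM [`|(Num.sqrt _)^-1|]gtr0_norm ?invr_gt0// mulrCA divff ?mulr1// gt_eqF//.
  rewrite hTx hQx ler_pM2l//.
  move: b1 b2; set q := Qlin m dhat x / _; set y := Y x; set t := Num.sqrt _ * z.
  rewrite sub0r normrN => b1 b2.
  have c1 : `|q| <= `|y| + `|q - y|.
    by rewrite -{1}(subrK y q) addrC ler_normD.
  have c2 : `|y| <= `|q| + `|q - y|.
    by rewrite -{1}(subrK q y) addrC (distrC q) ler_normD.
  move: b2; rewrite ltr_norml => /andP[b2 b3].
  by split => h; lra.
pose F b := 2 * Phi (- b / s).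
have hF : F b @[b --> a] --> F a.
  apply: cvgM; first exact: cvg_cst.
  apply: (cvg_comp (fun b : R => - b / s) (@Phi R) _ (@Phi_continuous R (- a / s))).
  apply: cvgM; last exact: cvg_cst.
  by apply: cvgN; exact: cvg_id.
have hFa : F a = 2 * Phi (- z).
  by rewrite /F; congr (2 * Phi _); rewrite /a; field; rewrite gt_eqF.
rewrite -hFa; apply/cvgrPdist_lt => eps e0.
have /cvgrPdist_lt /(_ _ e0) /nbhs_ballP[r /= r0 hr] := hF.
(* [e < r] keeps [F (a - e)] and [F (a + e)] within [eps] of [F a]; [e < a] keeps the lower
   threshold positive, as [Pr_abs_Y] demands. *)
pose e := Num.min r a / 2.
have e00 : 0 < e by rewrite divr_gt0// lt_min r0.
have er : e < r by rewrite /e ltr_pdivrMr// (@le_lt_trans _ _ r) ?ge_min ?lexx// ltr_pMr// ltr1n.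
have ea : e < a by rewrite /e ltr_pdivrMr// (@le_lt_trans _ _ a) ?ge_min ?lexx ?orbT// ltr_pMr// ltr1n.
have hm1 : `|F a - F (a - e)| < eps.
  by apply: hr; rewrite /ball /= opprB addrC subrK gtr0_norm.
have hp1 : `|F a - F (a + e)| < eps.
  by apply: hr; rewrite /ball /= opprD addrA subrr add0r normrN gtr0_norm.
have g1 := @whp_Pr_le _ _ hm _ _ ddlt (fun n g => T n g <= `|Qlin m dhat (n, g)|)
  (fun n g => a - e <= `|Ystat m d0 1 kappa (kn n) g|) (F a + eps) (F (a - e)).
have g2 := @whp_Pr_ge _ _ hm _ _ ddlt (fun n g => T n g <= `|Qlin m dhat (n, g)|)
  (fun n g => a + e <= `|Ystat m d0 1 kappa (kn n) g|) (F a - eps) (F (a + e)).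
move: hm1 hp1; rewrite !ltr_norml => /andP[i1 i2] /andP[i3 i4].
have {}g1 : \forall n \near \oo, Pr (L n) (fun g => T n g <= `|Qlin m dhat (n, g)|) < F a + eps.
  apply: g1; [|apply: Pr_abs_Y; lra|lra].
  by apply: (@filterS _ _ whp_filterN _ _ _ (hkey e e00)) => -[n g] [].
have {}g2 : \forall n \near \oo, F a - eps < Pr (L n) (fun g => T n g <= `|Qlin m dhat (n, g)|).
  apply: g2; [|apply: Pr_abs_Y; lra|lra].
  by apply: (@filterS _ _ whp_filterN _ _ _ (hkey e e00)) => -[n g] [].
apply: filterS2 g1 g2 => n; rewrite /T => g1 g2.
by rewrite ltr_norml; apply/andP; split; lra.
Unshelve. all: by end_near. Qed.

End Null.

(** * The coefficients [p_k], [v], [w] and [u] *)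

Section Coefficients.
Variables (R : realType) (m : nat).
Hypothesis hm : (0 < m)%N.
Local Notation mR := (m%:R : R).
Let m0 : 0 < mR := natm_gt0 R hm.

Section AtPoint.
Variable d : R.
Hypothesis hd : - mR < d.
Let md0 : 0 < mR + d. Proof. by have := hd; lra. Qed.
Let dm1 : -1 < d / mR. Proof. by rewrite ltr_pdivlMr// mulN1r. Qed.
Let p2 : 0 < 2 * mR + d. Proof. by have := hd; have := m0; lra. Qed.
Let B0 : 0 < Bden m d := Bden_gt0 hm hd.

(** The functional equation [GammaD1] gives the quotient of Gamma values the recursion of [plimS];
    positivity of [Gamma] permits the cancellations. *)
Lemma pk_plim k : (m <= k)%N -> pk m k d = plim m d k.
Proof.
have hA : 0 < mR + 2 + d + d / mR by have := md0; have := dm1; lra.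
have g1 := Gamma_gt0 md0; have g2 := Gamma_gt0 hA.
move=> mk; rewrite -(subnKC mk); elim: (k - m)%N => [|i IH].
  rewrite addn0 /pk plimm.
  have -> : mR + 3 + d + d / mR = mR + 2 + d + d / mR + 1 by ring.
  rewrite GammaD1//; have -> : Bden m d = mR * (mR + 2 + d + d / mR).
    by rewrite /Bden; field; rewrite gt_eqF.
  move: hA g1 g2; set A := mR + 2 + d + d / mR; set G1 := Gamma _; set G2 := Gamma _.
  move=> hA g1 g2; have aux (a g h : R) : 0 < a -> 0 < g -> 0 < h ->
     (2 + d / mR) * (g * h) / (g * (a * h)) = (2 * mR + d) / (mR * a).
    by move=> a0 g0 h0; field; rewrite !gt_eqF.
  exact: aux.
rewrite addnS plimS ?leq_addr// -IH /pk.
have hk : 0 < (m + i)%:R + d by apply: (natd_gt0 hm hd); rewrite leq_addr.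
have hk3 : 0 < (m + i)%:R + 3 + d + d / mR by have := hk; have := dm1; lra.
have -> : (m + i).+1%:R + d = (m + i)%:R + d + 1 by rewrite -natr1; ring.
have -> : (m + i).+1%:R + 3 + d + d / mR = (m + i)%:R + 3 + d + d / mR + 1 by rewrite -[(m + i).+1%:R]natr1; ring.
rewrite !GammaD1//; have g3 := Gamma_gt0 hk3.
have aux (a p q g h u v : R) : 0 < q -> 0 < g -> 0 < v ->
   a * (p * h * u) / (g * (q * v)) = a * (h * u) / (g * v) * (p / q).
  by move=> ? ? ?; field; rewrite !gt_eqF.
exact: (aux _ _ _ _ _ _ _ hk3 g1 g3).
Qed.

Lemma v_coefE : v_coef m d = mR * Vyy m d.
Proof.
rewrite /v_coef.
have h : (fun K => \sum_(m <= k < K) (mR * pk m k d / ((k%:R + d) * (2 * mR + d)))) @ \oo -->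
    mR / (2 * mR + d) * Hlim m d.
  have h : (fun K => mR / (2 * mR + d) * \sum_(m <= r < K) plim m d r * invd d r) @ \oo -->
      mR / (2 * mR + d) * Hlim m d.
    by apply: cvgM; [exact: cvg_cst|exact: (plim_invd_cvg hm hd)].
  apply: (cvg_ext h) => K; rewrite mulr_sumr; apply: eq_big_nat => k /andP[mk _].
  rewrite (pk_plim mk) /invd; have := natd_gt0 hm hd mk => k0.
  by field; rewrite !gt_eqF.
rewrite (cvg_lim (@Rhausdorff R) h) /Vyy; field.
by rewrite gt_eqF.
Qed.

(** [w] is [m] times the part of [sig2] due to [Z] alone. With [1 + wrate = Bden / (2 m + d)] the
    cross term is [- 2 kappa^2 Vyy] and the square is [kappa^2 Vyy]; their sum, times [m], is
    [u]. *)
Lemma wu_sig2 : w_coef m d + u_coef m d = mR * sig2 m d 1 (kappa m d).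
Proof.
have V0 := Vyy_gt0 hm hd.
have a2 : 0 < d + 2 * mR * (1 + mR + d).
  have := mulr_gt0 m0 md0; have := m0; have := md0; rewrite mulrDr; lra.
have hB : Bden m d = d + mR * (2 + mR + d) by [].
rewrite /w_coef /u_coef v_coefE -hB /sig2 /kappa (VxyE hm hd) (VxxE hm hd) /wrate.
have e1 : 1 + mR * (mR + d) / (2 * mR + d) = Bden m d / (2 * mR + d).
  by rewrite hB; field; rewrite gt_eqF.
have e2 : 1 + 2 * (mR * (mR + d) / (2 * mR + d)) = (d + 2 * mR * (1 + mR + d)) / (2 * mR + d).
  by field; rewrite gt_eqF.
rewrite e1 e2; move: B0 V0 a2; set B := Bden m d; set V := Vyy m d; set a := d + _.
move=> B0' V0 a0.
have aux (x y s : R) : 0 < s -> x + - (mR ^+ 4 / (mR * V * B ^+ 4)) =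
  mR * (y + 2 * (- 1) * (mR / (B ^+ 2 * V)) * (mR / (B * s)) * (1 / (B / s)) +
    (mR / (B ^+ 2 * V)) ^+ 2 * V) + (x - mR * y).
  by move=> s0; field; rewrite !gt_eqF.
rewrite (aux _ (1 ^+ 2 * ((mR + d) * mR * (1 + mR + d) / B ^+ 2) * (1 / (a / (2 * mR + d)))) _ p2).
rewrite -[RHS]addr0; congr (_ + _); have aux2 (s t : R) : 0 < s ->
  mR ^+ 2 * (mR + d) * t * s / (a * B ^+ 2) -
  mR * (1 ^+ 2 * ((mR + d) * mR * t / B ^+ 2) * (1 / (a / s))) = 0.
  by move=> s0; field; rewrite !gt_eqF.
exact: aux2.
Qed.

End AtPoint.

Section Continuity.
Variable d0 : R.
Hypothesis hd0 : - mR < d0.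

Lemma near_gtNm : \forall d \near d0, - mR < d.
Proof. exact: (@cvgr_gt _ _ (nbhs d0) _ (fun x => x) d0 cvg_id). Qed.

Lemma cvg_Bden : Bden m d @[d --> d0] --> Bden m d0.
Proof.
rewrite /Bden; apply: cvgD; first exact: cvg_id.
apply: cvgM; first exact: cvg_cst.
by apply: cvgD; [exact: cvg_cst|exact: cvg_id].
Qed.

Lemma cvg_plim r : plim m d r @[d --> d0] --> plim m d0 r.
Proof.
have [rm|mr] := ltnP r m.
  have h : (fun _ : R => 0 : R) @ d0 --> (0 : R) by exact: cvg_cst.
  by rewrite (plim_lt _ rm); apply: (cvg_ext h) => d; rewrite plim_lt.
rewrite -(subnKC mr); elim: (r - m)%N => [|i IH].
  rewrite addn0 plimm.
  have h : (fun d => (2 * mR + d) / Bden m d) @ d0 --> (2 * mR + d0) / Bden m d0.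
    apply: cvgM; first by apply: cvgD; [exact: cvg_cst|exact: cvg_id].
    by apply: cvgV; [rewrite gt_eqF// Bden_gt0|exact: cvg_Bden].
  by apply: (cvg_ext h) => d; rewrite plimm.
have dm1 : -1 < d0 / mR by rewrite ltr_pdivlMr// mulN1r.
have hk : 0 < (m + i)%:R + d0 by apply: (natd_gt0 hm hd0); rewrite leq_addr.
have hk3 : 0 < (m + i)%:R + 3 + d0 + d0 / mR by have := hk; have := dm1; lra.
rewrite addnS plimS ?leq_addr//.
have h : (fun d => plim m d (m + i) * (((m + i)%:R + d) / ((m + i)%:R + 3 + d + d / mR))) @ d0 -->
   plim m d0 (m + i) * (((m + i)%:R + d0) / ((m + i)%:R + 3 + d0 + d0 / mR)).
  apply: cvgM => //; apply: cvgM; first by apply: cvgD; [exact: cvg_cst|exact: cvg_id].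
  apply: cvgV; first by rewrite gt_eqF.
  apply: cvgD; first by apply: cvgD; [exact: cvg_cst|exact: cvg_id].
  by apply: cvgM; [exact: cvg_id|exact: cvg_cst].
by apply: (cvg_ext h) => d; rewrite plimS ?leq_addr.
Qed.

Lemma cvg_partial_H K : (\sum_(m <= r < K) plim m d r * invd d r) @[d --> d0] -->
  \sum_(m <= r < K) plim m d0 r * invd d0 r.
Proof.
elim: K => [|K IH].
  have h : (fun _ : R => 0 : R) @ d0 --> (0 : R) by exact: cvg_cst.
  by rewrite big_geq//; apply: (cvg_ext h) => d; rewrite big_geq.
have [mK|Km] := leqP m K; last first.
  have h : (fun _ : R => 0 : R) @ d0 --> (0 : R) by exact: cvg_cst.
  by rewrite big_geq//; apply: (cvg_ext h) => d; rewrite big_geq.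
have h : (fun d => \sum_(m <= r < K) plim m d r * invd d r + plim m d K * invd d K) @ d0 -->
   \sum_(m <= r < K) plim m d0 r * invd d0 r + plim m d0 K * invd d0 K.
  apply: cvgD => //; apply: cvgM; first exact: cvg_plim.
  rewrite /invd; apply: cvgV; first by rewrite gt_eqF// (natd_gt0 hm hd0).
  by apply: cvgD; [exact: cvg_cst|exact: cvg_id].
by rewrite big_nat_recr//; apply: (cvg_ext h) => d; rewrite big_nat_recr.
Qed.

(** Beyond [N] the frequencies have total mass at most 1 and [invd] is at most [1 / (N + b)].
    Uniformity in [d >= b] makes [Hlim] a locally uniform limit of its continuous partial sums. *)
Lemma Hlim_tail (d : R) (N : nat) (b : R) : - mR < b -> b <= d -> (m <= N)%N ->
  `|Hlim m d - \sum_(m <= r < N) plim m d r * invd d r| <= (N%:R + b)^-1.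
Proof.
move=> hb bd mN; have hd : - mR < d by exact: lt_le_trans bd.
have Nb := natd_gt0 hm hb mN.
have h : (fun K => \sum_(m <= r < K) plim m d r * invd d r - \sum_(m <= r < N) plim m d r * invd d r)
   @ \oo --> Hlim m d - \sum_(m <= r < N) plim m d r * invd d r.
  by apply: cvgB; [exact: (plim_invd_cvg hm hd)|exact: cvg_cst].
have h2 : (fun K => `|\sum_(m <= r < K) plim m d r * invd d r - \sum_(m <= r < N) plim m d r * invd d r|)
   @ \oo --> `|Hlim m d - \sum_(m <= r < N) plim m d r * invd d r| by exact: cvg_norm.
rewrite -(cvg_lim (@Rhausdorff R) h2); apply: limr_le; first by apply/cvg_ex; eexists; exact: h2.
exists N => // K /= NK.
rewrite (big_cat_nat mN NK) /= addrAC subrr add0r.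
have i0 r : (m <= r)%N -> 0 <= plim m d r * invd d r.
  by move=> mr; rewrite mulr_ge0 ?plim_ge0//; case/andP: (invd_le hm hd (lexx d) mr).
rewrite ger0_norm; last first.
  by rewrite big_nat sumr_ge0// => r /andP[Nr _]; rewrite i0// (leq_trans mN).
apply: (@le_trans _ _ (\sum_(N <= r < K) plim m d r * (N%:R + b)^-1)).
  rewrite big_nat [leRHS]big_nat; apply: ler_sum => r /andP[Nr _].
  rewrite ler_wpM2l ?plim_ge0// /invd.
  have h3 : N%:R + b <= r%:R + d by rewrite lerD// ler_nat.
  by rewrite lef_pV2 ?posrE// (lt_le_trans Nb).
rewrite -mulr_suml -[leRHS]mul1r ler_wpM2r ?invr_ge0 ?(ltW Nb)//.
have := sum_plim_le1 hm hd K; rewrite (big_cat_nat mN NK) /=; apply: le_trans.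
by rewrite lerDr sumr_ge0// => r _; exact: plim_ge0.
Qed.

Lemma cvg_Hlim : Hlim m d @[d --> d0] --> Hlim m d0.
Proof.
apply/cvgrPdist_le => eps e0.
(* The midpoint of [- m] and [d0]: a lower bound for all [d] near [d0] at which the tail estimate is
   still valid. *)
pose b := (d0 - mR) / 2; have hb : - mR < b by rewrite /b; have := hd0; lra.
have bd : b < d0 by rewrite /b; have := hd0; lra.
have e3 : 0 < eps / 3 by rewrite divr_gt0.
pose N := (m + (Num.truncn (3 / eps + `|b|)).+1)%N.
have hN : (N%:R + b)^-1 <= eps / 3.
  have h1 : 3 / eps + `|b| < N%:R.
    apply: (lt_le_trans (truncnS_gt _)).
    by rewrite /N ler_nat leq_addl.
  have h2 : 3 / eps <= N%:R + b by have := ler_norm (- b); rewrite normrN; lra.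
  have -> : eps / 3 = (3 / eps)^-1 by rewrite invf_div.
  have h3 : 0 < 3 / eps by rewrite divr_gt0.
  by rewrite lef_pV2 ?posrE// (lt_le_trans h3).
have mN : (m <= N)%N by rewrite leq_addr.
have /cvgrPdist_le /(_ _ e3) hp := @cvg_partial_H N.
near=> d.
have hbd : b <= d by apply: ltW; near: d; exact: (@cvgr_gt _ _ (nbhs d0) _ (fun x => x) d0 cvg_id).
have h1 := Hlim_tail hb hbd mN; have h0 := Hlim_tail hb (ltW bd) mN.
have h2 : `|\sum_(m <= r < N) plim m d0 r * invd d0 r - \sum_(m <= r < N) plim m d r * invd d r| <= eps / 3.
  by near: d.
move: h0 h1 h2; set H0 := Hlim m d0; set H := Hlim m d; set S0 := \sum_(_ <= _ < _) _; set S := \sum_(_ <= _ < _) _.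
move=> /le_trans /(_ hN) h0 /le_trans /(_ hN) h1 h2.
move: h0 h1 h2; rewrite !ler_norml => /andP[? ?] /andP[? ?] /andP[? ?].
by apply/andP; split; lra.
Unshelve. all: by end_near. Qed.

Lemma cvg_Vyy : Vyy m d @[d --> d0] --> Vyy m d0.
Proof.
have p2 : 0 < 2 * mR + d0 by have := hd0; have := m0; lra.
have hi : (fun d => (2 * mR + d)^-1) @ d0 --> (2 * mR + d0)^-1.
  apply: cvgV; first by rewrite gt_eqF.
  by apply: cvgD; [exact: cvg_cst|exact: cvg_id].
by rewrite /Vyy; apply: cvgB; apply: cvgM => //; exact: cvg_Hlim.
Qed.

Lemma cvg_wu : (w_coef m d + u_coef m d) @[d --> d0] --> w_coef m d0 + u_coef m d0.
Proof.
have md0 : 0 < mR + d0 by have := hd0; lra.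
have a2 : 0 < d0 + 2 * mR * (1 + mR + d0).
  have := mulr_gt0 m0 md0; have := m0; have := md0; rewrite mulrDr; lra.
have B0 := Bden_gt0 hm hd0; have V0 := Vyy_gt0 hm hd0.
have hid : (fun d : R => d) @ d0 --> d0 by exact: cvg_id.
have hc c : (fun _ : R => c) @ d0 --> (c : R) by exact: cvg_cst.
have hX n (f : R -> R) (l : R) : f @ d0 --> l -> (fun d => f d ^+ n) @ d0 --> l ^+ n.
  move=> hf; elim: n => [|n IH]; first exact: (hc 1).
  have h : (fun d => f d * f d ^+ n) @ d0 --> l * l ^+ n by exact: cvgM.
  by rewrite exprS; apply: (cvg_ext h) => d; rewrite exprS.
apply: cvgD.
  rewrite /w_coef; apply: cvgM.
    apply: cvgM; last by apply: cvgD.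
    apply: cvgM; last by apply: cvgD.
    by apply: cvgM; [exact: hc|apply: cvgD].
  apply: cvgV; first by rewrite gt_eqF// mulr_gt0// exprn_gt0.
  apply: cvgM; last by apply: hX; exact: cvg_Bden.
  by apply: cvgD => //; apply: cvgM; [exact: hc|apply: cvgD].
have h : (fun d => - (mR ^+ 4 / (mR * Vyy m d * Bden m d ^+ 4))) @ d0 --> u_coef m d0.
  rewrite /u_coef (v_coefE hd0); apply: cvgN; apply: cvgM; first exact: hc.
  apply: cvgV; first by rewrite gt_eqF// mulr_gt0 ?mulr_gt0 ?exprn_gt0.
  apply: cvgM; last by apply: hX; exact: cvg_Bden.
  by apply: cvgM; [exact: hc|exact: cvg_Vyy].
apply: cvg_trans h; apply: near_eq_cvg.
by apply: filterS near_gtNm => d hd; rewrite /u_coef (v_coefE hd).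
Qed.

End Continuity.
End Coefficients.

(** * The change point *)

Section ChangePoint.
Variables (R : realType) (m : nat).
Hypothesis hm : (0 < m)%N.
Variables c gam : R.
Hypothesis hc : 0 < c.
Hypothesis hgam : 0 < gam < 1.
Local Notation mR := (m%:R : R).
Let m0 : 0 < mR := natm_gt0 R hm.

(* [tau] may be negative; since every edge comes from a vertex [t >= 2], replacing it
   by [max tau 1] does not change the law. *)
Definition change_time n : nat := `|Num.max (tau c gam n) 1|%N.
(** Only the vertices [2, ..., change_time n] add edges to [G_1] before the change, [m] each: hence
    the predecessor. *)
Definition change_step n : nat := (m * (change_time n).-1)%N.

Lemma change_timeE n : (change_time n)%:Z = Num.max (tau c gam n) 1.
Proof. by rewrite /change_time gez0_abs// le_max orbT. Qed.

Lemma delta_alt_tt (d0 d1 : R) n k :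
  delta_alt d0 d1 c gam n (tt m k) = if (k < change_step n)%N then d0 else d1.
Proof.
rewrite /delta_alt; congr (if _ then _ else _).
have -> : ((tt m k)%:Z <= tau c gam n) = (tt m k <= change_time n)%N.
  by rewrite -lez_nat change_timeE le_max [X in _ = _ || X](_ : _ = false) ?orbF.
rewrite /tt /change_step mulnC -ltn_divLR//.
by case: (change_time n) => [|T] //=.
Qed.

Lemma powR_inv_cvg0 (a : R) : 0 < a -> (fun n : nat => (n%:R `^ a)^-1) @ \oo --> (0 : R).
Proof.
move=> a0; apply/cvgrPdist_le => eps e0.
exists (Num.truncn (eps^-1 `^ a^-1)).+1 => // n /= hn.
have h1 : eps^-1 `^ a^-1 <= n%:R.
  by rewrite ltW// (lt_le_trans (truncnS_gt _))// ler_nat.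
have h2 : eps^-1 <= n%:R `^ a.
  have -> : eps^-1 = (eps^-1 `^ a^-1) `^ a.
    by rewrite -powRrM mulVf ?gt_eqF// powRr1// invr_ge0 ltW.
  by apply: (ge0_ler_powR (ltW a0)) => //; rewrite nnegrE// powR_ge0.
have ei : 0 < eps^-1 by rewrite invr_gt0.
rewrite sub0r normrN ger0_norm ?invr_ge0 ?powR_ge0// -[leRHS]invrK lef_pV2 ?posrE//.
exact: lt_le_trans h2.
Qed.

Lemma cvg_powR_div : (fun n : nat => n%:R `^ gam / n%:R) @ \oo --> (0 : R).
Proof.
have /andP[g0 g1] := hgam.
have h := @powR_inv_cvg0 (1 - gam); rewrite subr_gt0 in h; have {}h := h g1.
apply: cvg_trans h; apply: near_eq_cvg; exists 1%N => // n /= n0.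
have n0' : 0 < n%:R :> R by rewrite ltr0n.
have e : n%:R `^ (gam + (1 - gam)) = n%:R `^ gam * n%:R `^ (1 - gam) :> R.
  by apply: powRD; apply/implyP => _; rewrite gt_eqF.
have e1 : gam + (1 - gam) = 1 by ring.
rewrite e1 (powRr1 (ltW n0')) in e.
have aux (x p q : R) : 0 < p -> x = p * q -> q^-1 = p / x.
  by move=> p0 ->; rewrite invfM mulrA divff ?mul1r// gt_eqF.
exact: (aux _ _ _ (powR_gt0 gam n0') e).
Qed.

(** For large [n] the maximum with 1 is inactive, and rounding [tau] down costs at most 1. *)
Lemma near_change : \forall n \near \oo, (1 < n)%N /\
  c * n%:R `^ gam <= n%:R - (change_time n)%:R <= c * n%:R `^ gam + 1.
Proof.
have h : (fun n : nat => c * (n%:R `^ gam / n%:R) + (n%:R : R)^-1) @ \oo --> c * 0 + 0.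
  apply: cvgD; first by apply: cvgM; [exact: cvg_cst|exact: cvg_powR_div].
  have := @powR_inv_cvg0 1 ltr01; apply: cvg_trans; apply: near_eq_cvg; apply: nearW => n.
  by rewrite powRr1.
rewrite mulr0 addr0 in h; have /cvgrPdist_le /(_ _ ltr01) {}h := h.
near=> n.
have n1 : (1 < n)%N by near: n; exists 2%N.
have hn : `|0 - (c * (n%:R `^ gam / n%:R) + (n%:R)^-1)| <= 1 by near: n.
have n0' : 0 < n%:R :> R by rewrite ltr0n (ltn_trans _ n1).
split => //; set P := n%:R `^ gam in hn *.
have P0 : 0 <= P by exact: powR_ge0.
have h1 : c * P + 1 <= n%:R.
  have := hn; rewrite sub0r normrN => /(le_trans (ler_norm _)).
  have -> : c * (P / n%:R) + (n%:R)^-1 = (c * P + 1) / n%:R by ring.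
  by rewrite ler_pdivrMr// mul1r.
have t1 : 1 <= tau c gam n by rewrite /tau floor_ge_int -/P; lra.
have -> : (change_time n)%:R = (tau c gam n)%:~R :> R.
  by rewrite -[LHS]/((change_time n)%:Z%:~R) change_timeE max_l.
have f1 := floor_le (n%:R - c * P); have f2 := lt_succ_floor (n%:R - c * P).
rewrite -[Num.Def.floor _]/(tau c gam n) in f1 f2.
rewrite intrD in f2; apply/andP; split; lra.
Unshelve. all: by end_near. Qed.

Lemma change_step_J n : (1 < n)%N -> 0 <= n%:R - (change_time n)%:R :> R ->
  (m * n.-1 - change_step n)%:R = mR * (n%:R - (change_time n)%:R).
Proof.
move=> n1; rewrite subr_ge0 ler_nat => h; rewrite /change_step -mulnBr natrM; congr (_ * _).
have T0 : (0 < change_time n)%N by rewrite -ltz_nat change_timeE lt_max orbT.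
by rewrite -natrB//; congr (_%:R); lia.
Qed.

Lemma cvg_change_J : (fun n => (m * n.-1 - change_step n)%:R / (m * n.-1)%:R) @ \oo --> (0 : R).
Proof.
have h : (fun n : nat => 2 * (c * (n%:R `^ gam / n%:R) + (n%:R : R)^-1)) @ \oo --> 2 * (c * 0 + 0).
  apply: cvgM; first exact: cvg_cst.
  apply: cvgD; first by apply: cvgM; [exact: cvg_cst|exact: cvg_powR_div].
  have := @powR_inv_cvg0 1 ltr01; apply: cvg_trans; apply: near_eq_cvg; apply: nearW => n.
  by rewrite powRr1.
rewrite mulr0 addr0 mulr0 in h; apply: (squeeze_norm0 h).
apply: filterS near_change => n [n1 /andP[c1 c2]].
have P0 : 0 <= n%:R `^ gam :> R by exact: powR_ge0.
have q0 : 0 <= n%:R - (change_time n)%:R :> R by apply: le_trans c1; rewrite mulr_ge0// ltW.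
rewrite change_step_J// natrM.
have n0' : 1 < n%:R :> R by rewrite ltr1n.
have -> : n.-1%:R = n%:R - 1 :> R by rewrite -subn1 natrB// ltnW.
have n2 : 2 <= n%:R :> R by rewrite (ler_nat _ 2).
move: c1 c2 q0 n0' n2; set x := n%:R; set t := (change_time n)%:R; set P := x `^ gam.
move=> c1 c2 q0 n0' n2; have x1 : 0 < x - 1 by lra.
have x0 : 0 < x by lra.
rewrite ger0_norm; last by rewrite divr_ge0 ?mulr_ge0// ltW.
have -> : mR * (x - t) / (mR * (x - 1)) = (x - t) / (x - 1) by field; rewrite !gt_eqF.
rewrite ler_pdivrMr//.
have -> : 2 * (c * (P / x) + x^-1) * (x - 1) = (c * P + 1) * (2 * (x - 1) / x) by ring.
apply: (le_trans c2); rewrite ler_peMr ?addr_ge0 ?mulr_ge0 ?(ltW hc) ?powR_ge0//.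
by rewrite ler_pdivlMr//; lra.
Qed.

Lemma near_change_lt : \forall n \near \oo, (change_step n < m * n.-1)%N.
Proof.
apply: filterS near_change => n [n1 /andP[c1 c2]].
have P0 : 0 < n%:R `^ gam :> R by apply: powR_gt0; rewrite ltr0n ltnW.
have q0 : 0 < n%:R - (change_time n)%:R :> R by apply: lt_le_trans c1; rewrite mulr_gt0.
by rewrite -subn_gt0 -(ltr0n R) change_step_J ?ltW// mulr_gt0.
Qed.

Hypothesis hgam2 : 1 / 2 < gam.

Lemma cvg_sqrt_powR : (fun n : nat => Num.sqrt (n%:R : R) / n%:R `^ gam) @ \oo --> (0 : R).
Proof.
have h := @powR_inv_cvg0 (gam - 2^-1).
have g2 : 0 < gam - 2^-1 by have := hgam2; lra.
have {}h := h g2.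
apply: cvg_trans h; apply: near_eq_cvg; exists 1%N => // n /= n0.
have n0' : 0 < n%:R :> R by rewrite ltr0n.
have e : n%:R `^ (2^-1 + (gam - 2^-1)) = n%:R `^ 2^-1 * n%:R `^ (gam - 2^-1) :> R.
  by apply: powRD; apply/implyP => _; rewrite gt_eqF.
have e1 : 2^-1 + (gam - 2^-1) = gam by ring.
rewrite e1 in e.
have aux (x p q : R) : 0 < p -> x = p * q -> q^-1 = p / x.
  by move=> p0 ->; rewrite invfM mulrA divff ?mul1r// gt_eqF.
rewrite -(powR12_sqrt (ltW n0')).
exact: (aux _ _ _ (powR_gt0 2^-1 n0') e).
Qed.

Lemma cvg_sqrt_change_J :
  (fun n => Num.sqrt ((m * n.-1)%:R : R) / (m * n.-1 - change_step n)%:R) @ \oo --> (0 : R).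
Proof.
have h : (fun n : nat => Num.sqrt mR / (mR * c) * (Num.sqrt (n%:R : R) / n%:R `^ gam)) @ \oo -->
   Num.sqrt mR / (mR * c) * 0.
  by apply: cvgM; [exact: cvg_cst|exact: cvg_sqrt_powR].
rewrite mulr0 in h; apply: (squeeze_norm0 h).
apply: filterS near_change => n [n1 /andP[c1 c2]].
have P0 : 0 < n%:R `^ gam :> R by apply: powR_gt0; rewrite ltr0n ltnW.
have q0 : 0 < n%:R - (change_time n)%:R :> R by apply: lt_le_trans c1; rewrite mulr_gt0.
rewrite (change_step_J n1 (ltW q0)).
rewrite ger0_norm; last by rewrite divr_ge0 ?sqrtr_ge0 ?mulr_ge0// ltW.
have h2 : Num.sqrt ((m * n.-1)%:R : R) <= Num.sqrt mR * Num.sqrt n%:R.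
  by rewrite -sqrtrM ?ler0n// ler_wsqrtr// -natrM ler_nat leq_mul// leq_pred.
have -> : Num.sqrt mR / (mR * c) * (Num.sqrt n%:R / n%:R `^ gam) =
  Num.sqrt mR * Num.sqrt n%:R * (mR * (c * n%:R `^ gam))^-1 by field; rewrite !gt_eqF.
apply: ler_pM => //; first by rewrite invr_ge0 mulr_ge0// ltW.
by rewrite lef_pV2 ?posrE ?mulr_gt0// ler_pM2l.
Qed.

End ChangePoint.

(** * The normal quantile and the two error probabilities *)

Lemma Pr_eq (R : realType) (L : law R) (A B : pred mgraph) : A =1 B -> Pr L A = Pr L B.
Proof. by move=> h; apply: eq_bigl => x; rewrite h. Qed.

Lemma quantile_Phi (R : realType) (a z : R) : is_normal_quantile a z -> Phi (- z) = a.
Proof. by move=> ->; rewrite -tail_Phi. Qed.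

(** [Phi 0 = 1 / 2] by symmetry, and [Phi] is nondecreasing. *)
Lemma quantile_gt0 (R : realType) (a z : R) : a < 1 / 2 -> is_normal_quantile a z -> 0 < z.
Proof.
move=> a2 /quantile_Phi h; rewrite ltNge; apply/negP => z0.
have h0 : Phi (0 : R) = 1 / 2 by have := PhiN (0 : R); rewrite oppr0; lra.
have := @Phi_nd R 0 (- z); rewrite oppr_ge0 h0 h => /(_ z0); lra.
Qed.

Theorem theorem3p6 (R : realType) (m : nat)
    (delta0 delta1 c gam dmin dmax alpha z : R) (dhat : nat -> mgraph -> R)
    (hm : (1 <= m)%N)
    (hdmin : - m%:R < dmin) (hdminmax : dmin <= dmax)
    (hdelta0 : dmin < delta0 < dmax) (hdelta1 : dmin < delta1 < dmax)
    (hc : 0 < c) (hgam : 0 < gam < 1)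
    (halpha : 0 < alpha < 1)
    (hz : is_normal_quantile (alpha / 2) z)
    (hdhat : is_estimator m dmin dmax dhat) :
  ((fun n => Pr (pa_law m (delta_null delta0) n)
               (fun g => phi_cal m dhat z n g != 0%N)) @ \oo --> alpha) /\
  (delta0 != delta1 -> 1 / 2 < gam ->
   (fun n => Pr (pa_law m (delta_alt delta0 delta1 c gam n) n)
               (fun g => phi_cal m dhat z n g == 0%N)) @ \oo --> (0 : R)).
Proof.
have /andP[a0 a1] := halpha.
have d0lt : - m%:R < delta0 by have /andP[h _] := hdelta0; exact: lt_trans h.
have z0 : 0 < z by apply: (quantile_gt0 _ hz); lra.
pose Wf (d : R) : R := w_coef m d + u_coef m d.
have hW : Wf d @[d --> delta0] --> Wf delta0 by exact: (cvg_wu hm d0lt).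
(* The estimator is at least [dmin > - m] on every graph, so [pk_plim] applies to it. *)
have hQ n g : Qstat m n g (dhat n g) = Qlin m dhat (n, g).
  rewrite /Qstat /Qlin pk_plim//; have [/andP[h _] _] := hdhat n g.
  exact: lt_le_trans h.
have hphi n g : (phi_cal m dhat z n g == 0%N) =
    ~~ (Num.sqrt (n%:R * Wf (dhat n g)) * z <= `|Qlin m dhat (n, g)|).
  by rewrite /phi_cal hQ; case: ifP.
split.
  have h := null_limit hm hdmin hdelta0 hdhat z0 hW (wu_sig2 hm d0lt).
  rewrite (quantile_Phi hz) in h; have e : 2 * (alpha / 2) = alpha by field.
  (* The value of [pa_law] at time 0 is a placeholder; from time 1 on it is [flaw] after [m * n.-1]
     edges. *)
  rewrite e in h; apply: cvg_trans h; apply: near_eq_cvg; exists 1%N => // n /= n0.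
  rewrite -(prednK n0) pa_lawE// (prednK n0).
  by apply: Pr_eq => g; rewrite hphi negbK.
move=> ne g2.
have hdn n t : delta_alt delta0 delta1 c gam n t = delta0 \/
    delta_alt delta0 delta1 c gam n t = delta1.
  by rewrite /delta_alt; case: ifP; [left|right].
have hlo n k : (k < change_step m c gam n)%N ->
    delta_alt delta0 delta1 c gam n (tt m k) = delta0.
  by rewrite delta_alt_tt// => ->.
have hhi n k : (change_step m c gam n <= k)%N ->
    delta_alt delta0 delta1 c gam n (tt m k) = delta1.
  by rewrite delta_alt_tt// ltnNge => ->.
have h := alt_reject hm hdmin hdelta0 hdelta1 hdn hlo hhi (cvg_change_J hm hc hgam)
  hdhat (near_change_lt hm hc hgam) (cvg_sqrt_change_J hm hc hgam g2) z ne hW.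
have hdlt n t : - m%:R < delta_alt delta0 delta1 c gam n t.
  by case: (hdn n t) => ->//; have /andP[? _] := hdelta1; exact: lt_trans hdmin _.
(* Membership in the filter [whp] unfolds to the convergence to 0 of the probability of the
   complement, which contains the event of acceptance. *)
apply: (squeeze_norm0 h); exists 1%N => // n /= n0.
rewrite -(prednK n0) pa_lawE// (prednK n0).
rewrite ger0_norm ?(Pr_flaw_ge0 hm (fun n => (m * n.-1)%N) hdlt n)// !PrE.
apply: (ler_Ex hm (hdlt n)) => g _; rewrite hphi ler_nat.
case hle : (Num.sqrt (n%:R * Wf (dhat n g)) * z <= `|Qlin m dhat (n, g)|) => //.
rewrite (_ : `[< _ >] = true)//; apply/asboolP => /= h2.
by rewrite ltW in hle.
Qed.
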